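(* Let $I\subset\mathbb{R}$ be an open bounded interval and let $k_0>0$ be a constant satisfying the nonlinear interpolation inequality (N) stated in the context. For every $0<k<k_0$, the functionals $F^k_\varepsilon$ $\Gamma(L^1)$-converge, as $\varepsilon\to0^+$, to the functional $F^k\colon L^1(I)\to[0,+\infty]$ given by $$F^k(u):=\begin{cases}\mathbf{m}_k\,\#(S(u)) & \text{if } u\in BV(I;\{\pm1\}),\\ +\infty & \text{if } u\in L^1(I)\setminus BV(I;\{\pm1\}),\end{cases}$$ where $\#(S(u))$ is the number of jumps of $u$ in $I$ and $$\mathbf{m}_k:=\inf\Big\{\int_{\mathbb{R}}\big(W(f)-k(f')^2+(f'')^2\big)\,dx\colon f\in\mathcal{A}\Big\}.$$
   Context: Standing assumptions on $W$: $W\colon\mathbb{R}\to[0,+\infty)$ is continuous, $W^{-1}(\{0\})=\{-1,1\}$, and there exists $c>0$ such that $W(s)\ge c\,(s-1)^2$ for all $s\ge0$ and $W(s)\ge c\,(s+1)^2$ for all $s\le 0$. For $\varepsilon,k>0$, the functional $F^k_\varepsilon\colon L^1(I)\to(-\infty,+\infty]$ is $$F^k_\varepsilon(u)=\int_I\Big(\frac{W(u)}{\varepsilon}-k\,\varepsilon\,(u')^2+\varepsilon^3(u'')^2\Big)dx\ \text{ if } u\in W^{2,2}(I),\qquad F^k_\varepsilon(u)=+\infty \text{ if } u\in L^1(I)\setminus W^{2,2}(I).$$ The class $\mathcal{A}$ is $$\mathcal{A}:=\{f\in W^{2,2}_{\rm loc}(\mathbb{R})\colon f(x)=1 \text{ if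 } x>T,\ f(x)=-1 \text{ if } x<-T,\ \text{for some } T>0\}.$$ Inequality (N): the constant $k_0>0$ (which exists for such $W$) satisfies, for every $a<b$ and every $u\in W^{2,2}(a,b)$, $$k_0\int_a^b (u')^2\,dx \leq \frac{1}{(b-a)^2}\int_a^b W(u)\,dx+(b-a)^2\int_a^b(u'')^2\,dx.$$ $BV(I;\{\pm1\})$ is the set of functions of bounded variation on $I$ with values in $\{-1,1\}$ almost everywhere; $S(u)$ is the (finite) jump set of such a function. $\Gamma(L^1)$-convergence of $F^k_\varepsilon$ to $F^k$ means $\Gamma$-convergence with respect to the strong $L^1(I)$ topology: for every $u\in L^1(I)$ and every $u_\varepsilon\to u$ in $L^1(I)$ one has $F^k(u)\le\liminf_{\varepsilon\to0}F^k_\varepsilon(u_\varepsilon)$, and for every $u\in L^1(I)$ there exists $u_\varepsilon\to u$ in $L^1(I)$ with $\limsup_{\varepsilon\to0}F^k_\varepsilon(u_\varepsilon)\le F^k(u)$. *)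

(* Defs.v *)
From HB Require Import structures.
From mathcomp Require Import all_boot all_order all_algebra.
From mathcomp Require Import all_classical all_reals all_analysis.

Set Implicit Arguments.
Unset Strict Implicit.
Unset Printing Implicit Defensive.

Import Order.TTheory GRing.Theory Num.Theory.
Import numFieldNormedType.Exports.

Local Open Scope classical_set_scope.
Local Open Scope ring_scope.

(* Elements of L^1(O), L^2(O), W^{2,2}(O), ... are represented by functions
   R -> R, of which only the restriction to O, up to null sets, matters. *)
Section FunctionSpaces.
Context {R : realType}.
Implicit Types (O : set R) (u v phi : R -> R).

Local Notation mu := (@lebesgue_measure R).

Definition L1 O u := mu.-integrable O (EFin \o u).

Definition L2 O u :=
  measurable_fun O u /\ (\int[mu]_(x in O) ((u x) ^+ 2)%:E < +oo)%E.

Definition L2loc O u := forall K, compact K -> K `<=` O -> L2 K u.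

(* C^1_c(O), extended by 0 to the whole line. *)
Definition test_function O phi :=
  [/\ forall x, derivable phi x 1,
      continuous (derive1 phi) &
      exists K, [/\ compact K, K `<=` O & forall x, ~ K x -> phi x = 0]].

(* As in Brezis, ch. 8, the test functions are taken in C^1_c(O); C^oo_c(O)
   yields the same weak derivatives. *)
Definition is_weak_derivative O u v :=
  [/\ locally_integrable O u, locally_integrable O v &
      forall phi, test_function O phi ->
        \int[mu]_(x in O) (u x * derive1 phi x) =
        - \int[mu]_(x in O) (v x * phi x)].

(* The weak derivative, unique up to null sets; 0 if there is none. *)
Definition weak_derivative O u : R -> R :=
  xget (fun=> 0) [set v | is_weak_derivative O u v].

Definition W12 O u :=
  L2 O u /\ exists v, L2 O v /\ is_weak_derivative O u v.

Definition W22 O u := W12 O u /\ W12 O (weak_derivative O u).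

Definition W12loc O u :=
  L2loc O u /\ exists v, L2loc O v /\ is_weak_derivative O u v.

Definition W22loc O u := W12loc O u /\ W12loc O (weak_derivative O u).

Definition total_variation_in O u : \bar R :=
  ereal_sup [set (\int[mu]_(x in O) (u x * derive1 phi x))%:E | phi in
    [set phi | test_function O phi /\ forall x, `|phi x| <= 1]].

Definition BV O u := L1 O u /\ (total_variation_in O u < +oo)%E.

Definition BVpm1 O u :=
  BV O u /\ {ae mu, forall x, O x -> u x = -1 \/ u x = 1}.

(* Approximate jump points: distinct approximate one-sided limits zl, zr. *)
Definition jump_set O u : set R :=
  [set x | O x /\ exists zl zr, [/\ zl != zr,
    iavg (fun y => u y - zl) `]x - r, x[ @[r --> 0^'+] --> 0%E &
    iavg (fun y => u y - zr) `]x, x + r[ @[r --> 0^'+] --> 0%E]].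

(* u_e -> u0 in L^1(O) as e -> 0^+, for a family in L^1(O) indexed by e > 0. *)
Definition cvgL1 O (u_ : R -> R -> R) u0 :=
  (forall e, 0 < e -> L1 O (u_ e)) /\
  (\int[mu]_(x in O) `|u_ e x - u0 x|%:E)%E @[e --> 0^'+] --> 0%E.

Definition Gamma_L1_cvg O (F_ : R -> (R -> R) -> \bar R)
    (F : (R -> R) -> \bar R) :=
  (forall u (u_ : R -> R -> R), L1 O u -> cvgL1 O u_ u ->
    (F u <= limf_einf (fun e => F_ e (u_ e)) 0^'+)%E) /\
  (forall u, L1 O u -> exists u_ : R -> R -> R, cvgL1 O u_ u /\
    (limf_esup (fun e => F_ e (u_ e)) 0^'+ <= F u)%E).

End FunctionSpaces.

Section PhaseTransition.
Context {R : realType}.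
Implicit Types (W u f : R -> R) (O : set R) (a b c e k : R).

Local Notation mu := (@lebesgue_measure R).

Definition double_well W :=
  [/\ continuous W, forall s, 0 <= W s, W @^-1` [set 0] = [set -1; 1] &
      exists c, [/\ 0 < c,
        forall s, 0 <= s -> c * (s - 1) ^+ 2 <= W s &
        forall s, s <= 0 -> c * (s + 1) ^+ 2 <= W s]].

Definition nonlinear_interpolation W k0 :=
  forall a b u, a < b -> W22 `]a, b[ u ->
    let u' := weak_derivative `]a, b[ u in
    let u'' := weak_derivative `]a, b[ u' in
    (k0%:E * \int[mu]_(x in `]a, b[) ((u' x) ^+ 2)%:E <=
     (((b - a) ^+ 2)^-1)%:E * \int[mu]_(x in `]a, b[) (W (u x))%:E +
     ((b - a) ^+ 2)%:E * \int[mu]_(x in `]a, b[) ((u'' x) ^+ 2)%:E)%E.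

Definition F_eps W O k e u : \bar R :=
  let u' := weak_derivative O u in
  let u'' := weak_derivative O u' in
  if `[< W22 O u >] then
    (\int[mu]_(x in O)
      (W (u x) / e - k * e * (u' x) ^+ 2 + e ^+ 3 * (u'' x) ^+ 2)%:E)%E
  else +oo%E.

Definition profiles : set (R -> R) :=
  [set f | W22loc setT f /\ exists T, [/\ 0 < T,
    forall x, T < x -> f x = 1 & forall x, x < - T -> f x = -1]].

Definition profile_energy W k f : \bar R :=
  let f' := weak_derivative setT f in
  let f'' := weak_derivative setT f' in
  (\int[mu]_x (W (f x) - k * (f' x) ^+ 2 + (f'' x) ^+ 2)%:E)%E.

Definition m_ W k : \bar R := ereal_inf (profile_energy W k @` profiles).

Definition F_lim W O k u : \bar R :=
  if `[< BVpm1 O u >] then (m_ W k * counting (jump_set O u))%E else +oo%E.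

End PhaseTransition.

(* Main.v *)
Require Import Defs.
From HB Require Import structures.
From mathcomp Require Import all_boot all_order all_algebra.
From mathcomp Require Import all_classical all_reals all_analysis.
From mathcomp Require finmap.
From mathcomp Require Import measurable_realfun ring lra.
Import Order.TTheory GRing.Theory Num.Theory.
Import numFieldNormedType.Exports.
Local Open Scope classical_set_scope.
Local Open Scope ring_scope.

(** The density of the functional is not bounded below, since the square of the
    first derivative enters with a negative sign.  The interpolation inequality
    restores a bound from below on every interval that is long compared with
    the scale [e], and from there on the argument is that of Modica and Mortola:
    away from the jumps nothing is paid, and each jump costs one optimal profile.

    Sobolev functions are replaced by triples [H2 p q f g h], in which [f] is a
    primitive of [g] on the compact interval [p, q], [g] is a primitive of [h],
    and [h] is square integrable.  A function of class W22 agrees almost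
    everywhere with such an [f] ([W22_H2]), and [f] is of class W22 ([H2_W22]);
    both directions rest on the du Bois-Reymond lemma and on integration by
    parts.  Triples can be restricted, glued at a point where the values and the
    slopes agree ([H2_splice]) and reparametrised ([H2_affine]), and their energy
    follows.  In these terms the constant of the theorem is the infimum of the
    energies, at scale 1, of connections: triples which start at -1 and end at 1
    with slope 0 ([m_finite_pos]).

    Coercivity.  Cut an interval into pieces of a length [l] slightly larger than
    [e] and sum the interpolation inequality over them.  This bounds
    [k0 * e * \int g^2] by [\int W(f) / e + (l / e)^2 * e^3 * \int h^2], so that
    for [k < k0] the negative term is absorbed as soon as [l / e] is close to 1
    ([coercivity]).  Hence long intervals have nonnegative energy, a bound on the
    energy makes [\int W(f)] and [e^2 * \int g^2] of order [e]
    ([energy_estimates]), and the optimal constant is positive, because a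
    function cannot pass from -1 to 1 without paying in [W(f)] or in [g^2].

    Lower bound.  Let [u_e] tend to [u] in L1 with energies at most [M] for
    arbitrarily small [e].  Since the integral of [W(u_e)] tends to 0, [u] takes
    its values in the wells ([approachable_pm1]).  If [u] takes the values 1 and
    -1 alternately, on [n + 1] sets of positive measure that follow each other,
    then each set contains a point where [u_e] is close to its well and
    [e * u_e'] is close to 0 ([Chebyshev]).  A short cubic arc of small energy
    joins such data to the well ([hermite_cap]), so the energy between two
    consecutive points is almost that of a connection ([near_transition]), and
    [n] times the optimal constant is at most [M] ([lower_bound]).  A function
    whose alternations are bounded in number is a step function
    ([no_alternation_step]), and its jump set consists of its sign changes
    ([step_jump_set]).

    Upper bound.  Alternations also bound the total variation from below, by
    means of test functions made of ramps ([alternates_total_variation]), so a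
    function of bounded variation with values in the wells is a step function
    too ([BV_step]).  Gluing an almost optimal connection, compressed by the
    factor [e], at every jump gives functions with almost the right energy
    ([recovery]); a diagonal choice ([diagonal]) turns these approximations into
    one recovery family. *)

(** * Integrals and primitives on compact intervals *)

(** Linear arithmetic is fast when it starts from few hypotheses.  The local
    versions below keep the section variables, which cannot be cleared. *)
Tactic Notation "lra_from" hyp_list(l) := revert l; clear; lra.

Section Toolkit.
Context {R : realType}.
Implicit Types (p q r x y c l : R) (f g h u v : R -> R).
Local Notation mu := (@lebesgue_measure R).

(** Compact intervals are used throughout, although the theorem is about an open
    one: endpoints are null sets, and gluing and boundary values need them. *)
Definition itg p q h := mu.-integrable `[p, q] (EFin \o h).
Definition I p q h : R := \int[mu]_(x in `[p, q]) h x.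

Lemma itg_sub p q p' q' h : p <= p' -> q' <= q -> itg p q h -> itg p' q' h.
Proof.
move=> pp qq; apply: integrableS => //.
by move=> x /=; rewrite !in_itv /= => /andP[a b]; apply/andP; split; lra.
Qed.

Lemma itg_ext p q h1 h2 : (forall x, p <= x <= q -> h1 x = h2 x) ->
  itg p q h1 -> itg p q h2.
Proof.
move=> e; apply: eq_integrable => // x; rewrite inE /= in_itv /= => xpq.
by rewrite e.
Qed.

Lemma I_ext p q h1 h2 : (forall x, p <= x <= q -> h1 x = h2 x) ->
  I p q h1 = I p q h2.
Proof.
by move=> e; apply: eq_Rintegral => x; rewrite inE /= in_itv /= => xpq; exact: e.
Qed.

Lemma itg_D p q h1 h2 : itg p q h1 -> itg p q h2 -> itg p q (fun x => h1 x + h2 x).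
Proof. by move=> i1 i2; apply: (integrableD _ i1 i2). Qed.

Lemma itg_Z p q c h : itg p q h -> itg p q (fun x => c * h x).
Proof. by move=> i1; apply: (integrableZl _ c i1). Qed.

Lemma itg_N p q h : itg p q h -> itg p q (fun x => - h x).
Proof. by move=> i1; apply: (integrableN i1). Qed.

Lemma itg_B p q h1 h2 : itg p q h1 -> itg p q h2 -> itg p q (fun x => h1 x - h2 x).
Proof. by move=> i1 i2; apply: itg_D => //; apply: itg_N. Qed.

Lemma itg_abs p q h : itg p q h -> itg p q (fun x => `|h x|).
Proof. by move=> i1; apply: (integrable_norm i1). Qed.

Lemma itg_cont p q h : {within `[p, q], continuous h} -> itg p q h.
Proof. by apply: continuous_compact_integrable; exact: segment_compact. Qed.

Lemma itg_cst p q c : itg p q (fun=> c).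
Proof. by apply: itg_cont; apply: continuous_subspaceT => x; exact: cvg_cst. Qed.

Lemma I_D p q h1 h2 : itg p q h1 -> itg p q h2 ->
  I p q (fun x => h1 x + h2 x) = I p q h1 + I p q h2.
Proof. by move=> *; apply: RintegralD. Qed.

Lemma I_B p q h1 h2 : itg p q h1 -> itg p q h2 ->
  I p q (fun x => h1 x - h2 x) = I p q h1 - I p q h2.
Proof. by move=> *; apply: RintegralB. Qed.

Lemma I_Z p q c h : itg p q h -> I p q (fun x => c * h x) = c * I p q h.
Proof. by move=> *; apply: RintegralZl. Qed.

Lemma I_le p q h1 h2 : itg p q h1 -> itg p q h2 ->
  (forall x, p <= x <= q -> h1 x <= h2 x) -> I p q h1 <= I p q h2.
Proof.
move=> i1 i2 le12; apply: le_Rintegral => // x /=; rewrite in_itv /=; exact: le12.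
Qed.

Lemma I_ge0 p q h : (forall x, p <= x <= q -> 0 <= h x) -> 0 <= I p q h.
Proof. by move=> h0; apply: Rintegral_ge0 => x /=; rewrite in_itv /=; exact: h0. Qed.

Lemma I_abs p q h : itg p q h -> `|I p q h| <= I p q (fun x => `|h x|).
Proof. by move=> i1; apply: le_normr_Rintegral. Qed.

Lemma I_cst p q c : p <= q -> I p q (fun=> c) = c * (q - p).
Proof.
move=> pq; rewrite /I Rintegral_cst //= lebesgue_measure_itv /= lte_fin.
case: ltP => //= qp; have -> : p = q by lra.
by rewrite subrr mulr0.
Qed.

Lemma I_pt p h : I p p h = 0.
Proof. by rewrite /I set_itv1 Rintegral_set1. Qed.

Lemma itv_cc_split p q r : p <= q -> q <= r -> `[p, r]%classic = `[p, q] `|` `]q, r].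
Proof.
move=> pq qr; rewrite -itv_bndbnd_setU // ?bnd_simp //.
Qed.

Lemma I_chasles p q r h : p <= q -> q <= r -> itg p r h -> I p r h = I p q h + I q r h.
Proof.
move=> pq qr i; rewrite /I (itv_cc_split p q r) // Rintegral_setU //=; last 2 first.
- by rewrite -itv_cc_split.
- apply/disj_setPS => x /= [] /=; rewrite !in_itv /= => /andP[_ a] /andP[b _].
  by move: (lt_le_trans b a); rewrite ltxx.
congr +%R; rewrite Rintegral_itv_obnd_cbnd //; apply: integrableS i => //.
by move=> x /=; rewrite !in_itv /= => /andP[a b]; apply/andP; split; lra.
Qed.

Lemma itg_cat p q r h : p <= q -> q <= r -> itg p q h -> itg q r h -> itg p r h.
Proof.
move=> pq qr i j; rewrite /itg (itv_cc_split p q r) //.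
have mi : measurable_fun `[p, q] h by apply/measurable_EFinP; case/integrableP: i.
have mj : measurable_fun `]q, r] h.
  apply: (@measurable_funS _ _ _ _ `[q, r]%classic) => //; last first.
    by apply/measurable_EFinP; case/integrableP: j.
  by move=> x /=; rewrite !in_itv /= => /andP[a b]; apply/andP; split; lra.
apply/integrableP; split; first by apply/measurable_funU => //; split; apply/measurable_EFinP.
apply: (@le_lt_trans _ _ (\int[mu]_(x in `[p, q]) `|(EFin \o h) x| + \int[mu]_(x in `]q, r]) `|(EFin \o h) x|)%E).
  rewrite ge0_integral_setU //=.
  - apply/measurable_EFinP; apply: measurableT_comp => //; exact/measurable_funU.
  - apply/disj_setPS => x /= [] /=; rewrite !in_itv /= => /andP[_ a] /andP[b _].
    by move: (lt_le_trans b a); rewrite ltxx.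
case/integrableP: i => _ i; case/integrableP: j => mj' j.
apply: lte_add_pinfty => //.
apply: le_lt_trans j; apply: ge0_subset_integral => //=.
  apply/measurable_EFinP; apply: measurableT_comp => //; exact/measurable_EFinP.
by move=> x /=; rewrite !in_itv /= => /andP[a b]; apply/andP; split; lra.
Qed.

Lemma EFin_I p q h : itg p q h -> (\int[mu]_(x in `[p, q]) (h x)%:E)%E = (I p q h)%:E.
Proof. by move=> i; rewrite /I /Rintegral fineK //; exact: integrable_fin_num i. Qed.

Lemma int_oo_cc p q (h : R -> \bar R) : measurable_fun `]p, q[ h ->
  (\int[mu]_(x in `]p, q[) h x = \int[mu]_(x in `[p, q]) h x)%E.
Proof.
by move=> mh; rewrite (@integral_itv_bndoo R p q h true false).
Qed.

Lemma itg_oo p q h : mu.-integrable `]p, q[ (EFin \o h) <-> itg p q h.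
Proof.
split=> [i|]; last first.
  apply: integrableS => // x /=; rewrite !in_itv /= => /andP[a b]; apply/andP; split; lra.
have [pq|qp] := ltP p q; last first.
  rewrite /itg; have -> : `[p, q]%classic = `[p,q] `&` `[p,q]%classic by rewrite setIid.
  have [->|ne] := eqVneq p q.
    apply/integrableP; split.
      rewrite setIid set_itv1; exact: measurable_fun_set1.
    rewrite setIid set_itv1 integral_set1 //.
  by rewrite set_itv_ge ?setIid ?bnd_simp -?ltNge ?lt_neqAle ?(eq_sym q) ?ne ?qp //; exact: integrable_set0.
case/integrableP: i => m i.
have mc : measurable_fun `[p, q] (EFin \o h).
  by apply/measurable_EFinP; move/measurable_EFinP: m; exact: measurable_fun_itv_cc.
apply/integrableP; split => //.
by rewrite -int_oo_cc //; apply: measurableT_comp.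
Qed.

(** Passage from the open interval of the Sobolev classes to the closed one. *)
Lemma I_oo p q h : itg p q h -> \int[mu]_(x in `]p, q[) h x = I p q h.
Proof.
move=> i; rewrite /I /Rintegral int_oo_cc //.
by case/integrableP: ((itg_oo p q h).2 i).
Qed.

Lemma ae_imp (P Q : R -> Prop) : (forall x, P x -> Q x) ->
  {ae mu, forall x, P x} -> {ae mu, forall x, Q x}.
Proof. by move=> PQ; apply: negligibleS => x /= nQ HP; apply: nQ; exact: PQ. Qed.

Lemma ae_imp2 (P1 P2 Q : R -> Prop) : (forall x, P1 x -> P2 x -> Q x) ->
  {ae mu, forall x, P1 x} -> {ae mu, forall x, P2 x} -> {ae mu, forall x, Q x}.
Proof.
move=> PQ H1 H2; apply: negligibleS (negligibleU H1 H2) => x /= nQ.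
have [HP1|] := pselect (P1 x); last by left.
by right => HP2; apply: nQ; exact: PQ.
Qed.

Lemma negligible_set1 x : mu.-negligible [set x].
Proof. by exists [set x]; split => //; rewrite lebesgue_measure_set1. Qed.

Lemma ae_oo_cc p q (P : R -> Prop) : {ae mu, forall x, x \in `]p, q[ -> P x} ->
  {ae mu, forall x, x \in `[p, q] -> P x}.
Proof.
move=> H.
have N : mu.-negligible ([set p] `|` [set q]).
  by apply: negligibleU; exact: negligible_set1.
move: H; rewrite /almost_everywhere => H.
apply: negligibleS (negligibleU H N) => x /= nPx.
have [->|xp] := eqVneq x p; first by right; left.
have [->|xq] := eqVneq x q; first by right; right.
left => HP; apply: nPx; rewrite in_itv /= => /andP[px qx].
by apply: HP; rewrite in_itv /= !lt_neqAle px qx xq eq_sym xp.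
Qed.

Lemma I_ae p q h1 h2 : itg p q h1 -> itg p q h2 ->
  {ae mu, forall x, x \in `]p, q[ -> h1 x = h2 x} -> I p q h1 = I p q h2.
Proof.
move=> i1 i2 /ae_oo_cc e; rewrite /I /Rintegral; congr fine.
apply: ae_eq_integral => //.
- by case/integrableP: i1.
- by case/integrableP: i2.
- by apply: ae_imp e => x /= H xpq; rewrite H.
Qed.

Lemma itg_ae p q h1 h2 : itg p q h1 -> measurable_fun `]p, q[ h2 ->
  {ae mu, forall x, x \in `]p, q[ -> h1 x = h2 x} -> itg p q h2.
Proof.
move=> i1 m2 e; apply/itg_oo; move/itg_oo: i1 => /integrableP[m1 i1].
apply/integrableP; split; first exact/measurable_EFinP.
rewrite (le_lt_trans _ i1) // le_eqVlt; apply/orP; left; apply/eqP.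
apply: ge0_ae_eq_integral => //.
- by apply/measurable_EFinP; apply: measurableT_comp.
- by apply: measurableT_comp.
- by apply: ae_imp e => x /= H xpq; rewrite H.
Qed.

Lemma affine_measurable c l : measurable_fun setT (fun t : R => c + l * t).
Proof. by apply: measurable_funD => //; apply: measurable_funM. Qed.

(** The measure [|l| * mu (phi^-1 A)] agrees with [mu] on intervals, and Lebesgue
    measure is determined by its values there. *)
Lemma mu_affine c l (A : set R) : l != 0 -> measurable A ->
  mu A = (`|l|%:E * mu [set t | A (c + l * t)%R])%E.
Proof.
move=> l0 mA.
pose phi := (fun t => c + l * t) : measurableTypeR R -> measurableTypeR R.
have mf : measurable_fun setT phi by exact: affine_measurable.
have al : (0 <= `|l|)%R by [].
suff H : mu A = mscale (NngNum al) (pushforward mu phi) A by exact: (H mf).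
move=> m; apply: lebesgue_measure_unique => // _ [[p q] /= _ <-].
rewrite /mscale /pushforward /=.
have /orP[ln|lp] : (l < 0) || (0 < l) by rewrite -neq_lt.
- rewrite (_ : pushforward mu phi _ = mu `[(q - c) / l, (p - c) / l[%classic); last first.
    congr (mu _); apply/seteqP; split => t /=; rewrite !in_itv /= /phi ltr_ndivlMr // ler_ndivrMr //;
    by move=> /andP[? ?]; apply/andP; split; lra.
  rewrite !lebesgue_measure_itv /= !lte_fin ltr_nM2r ?invr_lt0 // ltrD2r.
  case: ifP => _; last by rewrite mule0.
  rewrite -!EFinD -EFinM ltr0_norm // -mulrBl mulrC mulrN mulfVK //.
  by congr EFin; ring.
- rewrite (_ : pushforward mu phi _ = mu `](p - c) / l, (q - c) / l]%classic); last first.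
    congr (mu _); apply/seteqP; split => t /=; rewrite !in_itv /= /phi ltr_pdivrMr // ler_pdivlMr //;
    by move=> /andP[? ?]; apply/andP; split; lra.
  rewrite !lebesgue_measure_itv /= !lte_fin ltr_pM2r ?invr_gt0 // ltrD2r.
  case: ifP => _; last by rewrite mule0.
  by rewrite -!EFinD -EFinM gtr0_norm // -mulrBl mulrC mulfVK // opprB addrA subrK.
Qed.

Lemma int_affine_ge0 c l (D : set R) (h : R -> \bar R) : l != 0 -> measurable D ->
  measurable_fun D h -> (forall x, D x -> 0 <= h x)%E ->
  (\int[mu]_(x in D) h x = `|l|%:E * \int[mu]_(t in [set t | D (c + l * t)%R]) h (c + l * t)%R)%E.
Proof.
move=> l0 mD mh h0.
pose phi := (fun t => c + l * t) : measurableTypeR R -> measurableTypeR R.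
have mf : measurable_fun setT phi by exact: affine_measurable.
have al : (0 <= `|l|)%R by [].
have E := ge0_integral_pushforward mf mu mD mh (fun x Dx => h0 x (set_mem Dx)).
rewrite [X in (_ * X)%E](_ : _ = (\int[mu]_(x in phi @^-1` D) (h \o phi) x)%E) // -E.
have E2 := @ge0_integral_mscale _ (measurableTypeR R) R
  (measure_function_pushforward__canonical__measure_function_Measure mu mf)
  D mD (NngNum al) h mh h0.
rewrite -[RHS]E2.
by apply: eq_measure_integral => //= A mA _; rewrite (mu_affine c l).
Qed.

Lemma int_affine c l (D : set R) (h : R -> R) : l != 0 -> measurable D ->
  mu.-integrable D (EFin \o h) ->
  mu.-integrable [set t | D (c + l * t)] (EFin \o (fun t => h (c + l * t))) /\
  (\int[mu]_(x in D) h x = `|l| * \int[mu]_(t in [set t | D (c + l * t)]) h (c + l * t)).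
Proof.
move=> l0 mD ih.
have mh : measurable_fun D h by apply/measurable_EFinP; case/integrableP: ih.
pose phi := (fun t => c + l * t) : R -> R.
have mD' : measurable [set t | D (c + l * t)].
  by have := affine_measurable c l measurableT _ mD; rewrite setTI.
have mh' : measurable_fun [set t | D (c + l * t)] (fun t => h (c + l * t)).
  apply: (measurable_comp (F := D)) => //.
    by move=> _ [x Dx <-].
  by apply: measurable_funTS; exact: affine_measurable.
have nl : 0 < `|l| by rewrite normr_gt0.
have ih' : mu.-integrable [set t | D (c + l * t)] (EFin \o (fun t => h (c + l * t))).
  apply/integrableP; split; first exact/measurable_EFinP.
  case/integrableP: ih => _; rewrite (int_affine_ge0 c l D) //=; last first.
    by apply/measurable_EFinP; apply: measurableT_comp.
  rewrite /=.
  set J := (\int[mu]_(_ in _) _)%E => Hl.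
  have J0 : (0 <= J)%E by apply: integral_ge0 => x _; rewrite lee_fin.
  move: Hl J0; case: J => [r| |] //=.
    by move=> *; rewrite ltry.
  by rewrite mulry gtr0_sg // mul1e.
split => //.
rewrite /Rintegral integralE [in RHS]integralE.
rewrite (int_affine_ge0 c l D) //; last by apply: measurable_funepos; exact/measurable_EFinP.
rewrite (int_affine_ge0 c l D (fun x => (EFin \o h)^\- x)%E) //; last first.
  by apply: measurable_funeneg; exact/measurable_EFinP.
have F1 := @integrable_pos_fin_num _ _ _ mu _ mD' _ ih'.
have F2 := @integrable_neg_fin_num _ _ _ mu _ mD' _ ih'.
rewrite [X in fine (_ * X - _)%E](_ : _ = \int[mu]_(x in [set t | D (c + l * t)%R])
  (EFin \o (fun t => h (c + l * t)%R))^\+ x)%E; last first.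
  by apply: eq_integral => t _; rewrite !funeposE.
rewrite [X in fine (_ - _ * X)%E](_ : _ = \int[mu]_(x in [set t | D (c + l * t)%R])
  (EFin \o (fun t => h (c + l * t)%R))^\- x)%E; last first.
  by apply: eq_integral => t _; rewrite !funenegE.
by rewrite fineB ?fin_numM // !fineM // -mulrBr -fineB.
Qed.

Lemma I_affine p q c l h : 0 < l -> itg (c + l * p) (c + l * q) h ->
  itg p q (fun t => h (c + l * t)) /\
  I (c + l * p) (c + l * q) h = l * I p q (fun t => h (c + l * t)).
Proof.
move=> l0 ih; have [|] := int_affine c l `[c + l * p, c + l * q] h (lt0r_neq0 l0) _ ih => //.
rewrite gtr0_norm //.
suff -> : [set t | `[c + l * p, c + l * q]%classic (c + l * t)] = `[p, q]%classic by [].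
by apply/seteqP; split => t /=; rewrite !in_itv /= !lerD2l !ler_pM2l.
Qed.

Lemma I_affineN p q c l h : l < 0 -> itg (c + l * q) (c + l * p) h ->
  itg p q (fun t => h (c + l * t)) /\
  I (c + l * q) (c + l * p) h = - l * I p q (fun t => h (c + l * t)).
Proof.
move=> l0 ih; have [|] := int_affine c l `[c + l * q, c + l * p] h (ltr0_neq0 l0) _ ih => //.
rewrite ltr0_norm //.
suff -> : [set t | `[c + l * q, c + l * p]%classic (c + l * t)] = `[p, q]%classic by [].
by apply/seteqP; split => t /=; rewrite !in_itv /= !lerD2l !ler_nM2l // andbC.
Qed.

(** An absolutely continuous [g] with derivative [h], described by the fundamental
    theorem of calculus so that no pointwise derivative occurs. *)
Definition prim p q g h := itg p q h /\
  forall x, p <= x <= q -> g x = g p + I p x h.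

Lemma prim_sub p q p' q' g h : p <= p' -> q' <= q -> prim p q g h -> prim p' q' g h.
Proof.
move=> pp qq [i e]; split; first exact: itg_sub i.
move=> x /andP[px xq].
have E := e x; have E' := e p'.
rewrite E ?E' ?(I_chasles p p' x) ?addrA //; try (by apply/andP; split; lra).
apply: itg_sub i => //; lra.
Qed.

Lemma primB p q x y g h : prim p q g h -> p <= x -> x <= y -> y <= q ->
  g y - g x = I x y h.
Proof.
move=> H px xy yq; have [_ ->] := prim_sub p q x y g h px yq H; first by ring.
by rewrite xy lexx.
Qed.

(** Absolute continuity of the integral. *)
Lemma prim_cont p q g h : prim p q g h -> {within `[p, q], continuous g}.
Proof.
move=> [i e]; have [pq|qp] := leP p q; last first.
  rewrite set_itv_ge; last by rewrite bnd_simp -ltNge.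
  by apply/subspace_continuousP => x.
have C := @parameterized_integral_continuous R p q h pq i.
have E : {in `[p, q]%classic, (fun x => g p + I p x h) =1 g}.
  by move=> x; rewrite inE /= in_itv /= => /e ->.
apply: (subspace_eq_continuous E) => x.
by apply: cvgD; [exact: cvg_cst|exact: C].
Qed.

Lemma prim_ext p q g1 g2 h1 h2 : p <= q ->
  (forall x, p <= x <= q -> g1 x = g2 x) ->
  (forall x, p <= x <= q -> h1 x = h2 x) -> prim p q g1 h1 -> prim p q g2 h2.
Proof.
move=> pq eg eh [i e]; split; first exact: itg_ext i.
move=> x /andP[px xq]; rewrite -!eg ?lexx ?px ?xq // e ?px //.
congr +%R; apply: I_ext => y /andP[? ?]; apply: eh; apply/andP; split; lra.
Qed.

(** The value at the junction is that of the right piece; gluing is only done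
    where both pieces agree, see [splice_l]. *)
Definition splice q f1 f2 : R -> R := fun x => if x < q then f1 x else f2 x.

Lemma splice_l q f1 f2 x : f1 q = f2 q -> x <= q -> splice q f1 f2 x = f1 x.
Proof. by move=> e; rewrite /splice; case: ltgtP => // -> _. Qed.

Lemma splice_r q f1 f2 x : q <= x -> splice q f1 f2 x = f2 x.
Proof. by rewrite /splice; case: ltP. Qed.

Lemma I_oo_ext p q h1 h2 : (forall x, p < x < q -> h1 x = h2 x) ->
  itg p q h1 -> itg p q h2 /\ I p q h1 = I p q h2.
Proof.
move=> e i1.
have i2 : itg p q h2.
  apply/itg_oo; move/itg_oo: i1; apply: eq_integrable => // x.
  by rewrite inE /= in_itv /= => xpq; rewrite e.
split=> //; rewrite -!I_oo //; apply: eq_Rintegral => x.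
by rewrite inE /= in_itv /=; exact: e.
Qed.

Lemma itg_splice p q r h1 h2 : p <= q -> q <= r -> itg p q h1 -> itg q r h2 ->
  itg p r (splice q h1 h2) /\ I p r (splice q h1 h2) = I p q h1 + I q r h2.
Proof.
move=> pq qr i1 i2.
have [j1 e1] : itg p q (splice q h1 h2) /\ I p q h1 = I p q (splice q h1 h2).
  by apply: I_oo_ext => // x /andP[_ xq]; rewrite /splice xq.
have [j2 e2] : itg q r (splice q h1 h2) /\ I q r h2 = I q r (splice q h1 h2).
  by apply: I_oo_ext => // x /andP[qx _]; rewrite /splice ltNge (ltW qx).
have i := itg_cat _ _ _ _ pq qr j1 j2.
by split=> //; rewrite (I_chasles p q r) // e1 e2.
Qed.

Lemma prim_splice p q r g1 g2 h1 h2 : p <= q -> q <= r -> g1 q = g2 q ->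
  prim p q g1 h1 -> prim q r g2 h2 -> prim p r (splice q g1 g2) (splice q h1 h2).
Proof.
move=> pq qr gq [i1 e1] [i2 e2].
split; first by case: (itg_splice p q r h1 h2).
move=> x /andP[px xr]; rewrite (splice_l q g1 g2 p) //.
have [xq|qx] := leP x q.
  rewrite splice_l // e1 ?px //; congr +%R.
  have [] // := I_oo_ext p x h1 (splice q h1 h2).
    by move=> y /andP[py yx]; rewrite /splice (lt_le_trans yx).
  by apply: itg_sub i1.
have qx' := ltW qx.
have := itg_splice p q x h1 h2 pq qx' i1 (itg_sub _ _ _ _ _ (lexx _) xr i2).
move=> [_ ->]; rewrite splice_r // e2 ?qx' // -gq e1 ?pq ?lexx //; ring.
Qed.

Lemma prim_C1 p q g h : p <= q -> (forall x, is_derive x 1 g (h x)) -> continuous h ->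
  prim p q g h.
Proof.
move=> pq dg ch; have ci x y : {within `[x, y], continuous h}.
  by apply: continuous_subspaceT => z; exact: ch.
split; first exact: itg_cont.
move=> x /andP[px _]; have {}px : p = x \/ p < x by case: ltgtP px => // ? _; [right|left].
case: px => [->|px]; first by rewrite I_pt addr0.
have cg y : {for y, continuous g}.
  by apply: differentiable_continuous; apply/derivable1_diffP; case: (dg y).
have := @continuous_FTC2 R h g p x px (ci _ _).
move=> /(_ _ _)/=; rewrite EFin_I; last exact: itg_cont.
move=> H; suff E : (I p x h)%:E = (g x - g p)%:E by case: E => ->; ring.
rewrite EFinB; apply: H.
- split.
  + by move=> y _; case: (dg y).
  + by apply: cvg_at_right_filter; exact: cg.
  + by apply: cvg_at_left_filter; exact: cg.
- by move=> y _; rewrite derive1E; case: (dg y).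
Qed.

End Toolkit.

(** * Ramps, Lebesgue points and the du Bois-Reymond lemma *)

Section WeakDeriv.
Context {R : realType}.
Implicit Types (p q r x y c l z e : R) (f g h u v w phi : R -> R).
Local Notation mu := (@lebesgue_measure R).

(** A Taylor estimate with quadratic remainder: enough for piecewise quadratic
    functions and for cubics, and checked by real arithmetic alone. *)
Lemma is_derive_quad f x d K :
  (forall t, `|t| <= 1 -> `|f (t + x) - f x - d * t| <= K * t ^+ 2) ->
  is_derive x 1 f d.
Proof.
move=> H.
have K0 : 0 <= K.
  have := H 1; rewrite normr1 lexx => /(_ isT); move=> /(le_trans (normr_ge0 _)).
  by rewrite expr1n mulr1.
suff C : (fun t => t^-1 *: (f (t *: 1 + x) - f x)) @ 0^' --> d.
  by apply: DeriveDef; [apply/cvg_ex; exists d|apply/cvg_lim].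
apply/cvgrPdist_le => e e0.
have eK : 0 < e / (K + 1) by rewrite divr_gt0 // ltr_wpDl.
near=> t.
have t0 : t != 0 by near: t; exact: nbhs_dnbhs_neq.
have te : `|t| <= e / (K + 1).
  near: t; apply: dnbhs0_le => //.
rewrite scaler1; have -> : d - t^-1 *: (f (t + x) - f x) = - (t^-1 * (f (t + x) - f x - d * t)).
  by rewrite -[_ *: _]/(_ * _); field.
rewrite normrN normrM normfV mulrC ler_pdivrMr ?normr_gt0 //.
apply: (le_trans (H t _)).
  by near: t; exact: dnbhs0_le.
rewrite -[t ^+ 2]ger0_norm ?sqr_ge0 // normrX expr2 mulrA ler_pM2r ?normr_gt0 //.
move: te; rewrite ler_pdivlMr ?ltr_wpDl // => te.
by rewrite (le_trans _ te) // mulrC ler_wpM2l // lerDl.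
Unshelve. all: by end_near. Qed.

Definition pos x : R := Num.max x 0.

Lemma pos_cont : continuous pos.
Proof. by move=> x; apply: continuous_max; [exact: cvg_id|exact: cvg_cst]. Qed.

(** The tent function with support [-1, 1], as a second difference of [pos]. *)
Definition bump x : R := pos (x + 1) - 2 * pos x + pos (x - 1).
(** The same second difference applied to [pos^2 / 2], hence a primitive of [bump]
    of class C1 that rises from 0 to 1. *)
Definition step01 x : R := (pos (x + 1) ^+ 2 - 2 * pos x ^+ 2 + pos (x - 1) ^+ 2) / 2.

Lemma bump_cont : continuous bump.
Proof.
have sc a : continuous (fun x : R => pos (x + a)).
  move=> x; apply: (continuous_comp (f := fun x => x + a) (g := pos)); last exact: pos_cont.
  by apply: cvgD; [exact: cvg_id|exact: cvg_cst].
move=> x; apply: cvgD; last exact: (sc (-1)).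
apply: cvgB; first exact: (sc 1).
by apply: cvgM; [exact: cvg_cst|exact: pos_cont].
Qed.

Lemma is_derive_step01 x : is_derive x 1 step01 (bump x).
Proof.
apply: (is_derive_quad _ _ _ 2) => t _.
have D a y : `|pos (t + y + a) ^+ 2 - pos (y + a) ^+ 2 - 2 * pos (y + a) * t| <= t ^+ 2.
  rewrite /pos ler_norml; apply/andP.
  by case: (leP (y + a) 0) => x0; case: (leP (t + y + a) 0) => tx; split; nra.
have := D 1 x; have := D 0 x; have := D (-1) x; rewrite !addr0 /bump /step01 !ler_norml.
by move=> /andP[? ?] /andP[? ?] /andP[? ?]; apply/andP; split; lra.
Qed.

Lemma bump_ge0 x : 0 <= bump x <= 1.
Proof.
rewrite /bump /pos; apply/andP.
by case: (leP (x + 1) 0) => ?; case: (leP x 0) => ?; case: (leP (x - 1) 0) => ?; split; lra.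
Qed.

Lemma bump_out x : (x <= -1) || (1 <= x) -> bump x = 0.
Proof.
rewrite /bump /pos => /orP.
by case: (leP (x + 1) 0) => ?; case: (leP x 0) => ?; case: (leP (x - 1) 0) => ? [] ?; lra.
Qed.

Lemma step01_itv x : 0 <= step01 x <= 1.
Proof.
rewrite /step01 /pos; apply/andP.
by case: (leP (x + 1) 0) => ?; case: (leP x 0) => ?; case: (leP (x - 1) 0) => ?; split; nra.
Qed.

Lemma step01_l x : x <= -1 -> step01 x = 0.
Proof.
rewrite /step01 /pos => ?.
by case: (leP (x + 1) 0) => ?; case: (leP x 0) => ?; case: (leP (x - 1) 0) => ?; nra.
Qed.

Lemma step01_r x : 1 <= x -> step01 x = 1.
Proof.
rewrite /step01 /pos => ?.
by case: (leP (x + 1) 0) => ?; case: (leP x 0) => ?; case: (leP (x - 1) 0) => ?; nra.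
Qed.

Definition ramp l z x : R := step01 ((x - z) / l).
(** The derivative of [ramp l z]: a tent of integral 1 supported in [z - l, z + l].
    It serves both as an approximate identity and as the derivative of test
    functions. *)
Definition hat l z x : R := l^-1 * bump ((x - z) / l).

Lemma is_derive_ramp l z x : is_derive x 1 (ramp l z) (hat l z x).
Proof.
have D : is_derive x 1 (fun t : R => (t - z) / l) (l^-1).
  apply: (is_derive_quad _ _ _ 0) => t _.
  by rewrite mul0r (_ : _ - _ = 0) ?normr0 //; ring.
rewrite /hat.
have := @is_derive1_comp _ step01 _ x _ _ (is_derive_step01 ((x - z) / l)) D.
by rewrite mulrC.
Qed.

Lemma hat_cont l z : continuous (hat l z).
Proof.
move=> x; apply: cvgM; first exact: cvg_cst.
apply: (continuous_comp (f := fun x => (x - z) / l) (g := bump)); last exact: bump_cont.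
by apply: cvgM; [apply: cvgB; [exact: cvg_id|exact: cvg_cst]|exact: cvg_cst].
Qed.

Lemma hat_ge0 l z x : 0 < l -> 0 <= hat l z x <= l^-1.
Proof.
move=> l0; have /andP[b0 b1] := bump_ge0 ((x - z) / l).
by rewrite /hat mulr_ge0 ?invr_ge0 ?(ltW l0) //= -[leRHS]mulr1 ler_wpM2l // invr_ge0 ltW.
Qed.

Lemma hat_out l z x : 0 < l -> (x <= z - l) || (z + l <= x) -> hat l z x = 0.
Proof.
move=> l0 H; rewrite /hat bump_out ?mulr0 // ler_pdivrMr // ler_pdivlMr //.
by apply/orP; case/orP: H => ?; [left|right]; lra.
Qed.

Lemma ramp_l l z x : 0 < l -> x <= z - l -> ramp l z x = 0.
Proof. by move=> l0 H; rewrite /ramp step01_l // ler_pdivrMr //; lra. Qed.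

Lemma ramp_r l z x : 0 < l -> z + l <= x -> ramp l z x = 1.
Proof. by move=> l0 H; rewrite /ramp step01_r // ler_pdivlMr //; lra. Qed.

Lemma hat_int l z : 0 < l -> I (z - l) (z + l) (hat l z) = 1.
Proof.
move=> l0.
have P := prim_C1 (z - l) (z + l) (ramp l z) (hat l z) _ (is_derive_ramp l z) (hat_cont l z).
have lz : z - l <= z + l by lra.
by rewrite -(primB _ _ _ _ _ _ (P lz)) // ramp_r // ramp_l // subr0.
Qed.

Lemma cont_bounded p q g : {within `[p, q], continuous g} ->
  exists2 M, 0 < M & forall x, p <= x <= q -> `|g x| <= M.
Proof.
move=> cg; have /compact_bounded[M [_ HM]] := continuous_compact cg (@segment_compact R p q).
exists (`|M| + 1); first by rewrite ltr_wpDl.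
move=> x xpq; apply: (HM (`|M| + 1)); first by rewrite (le_lt_trans (ler_norm _)) // ltrDl.
by exists x => //; rewrite /= in_itv.
Qed.

Lemma within_cont p q g : continuous g -> {within `[p, q], continuous g}.
Proof. by move=> cg; apply: continuous_subspaceT. Qed.

Lemma within_measurable p q g : {within `[p, q], continuous g} -> measurable_fun `[p, q] g.
Proof. by move=> cg; apply: subspace_continuous_measurable_fun. Qed.

Lemma itg_Mc p q h g : itg p q h -> {within `[p, q], continuous g} ->
  itg p q (fun x => h x * g x).
Proof.
move=> ih cg; have [M M0 HM] := cont_bounded p q g cg.
have := @integrableMl _ _ R mu `[p, q]%classic _ (EFin \o h) g ih.
apply => //; first exact: within_measurable.
exists M; split; first by rewrite num_real.
move=> B MB x /=; rewrite in_itv /= => /HM H; exact: le_trans H (ltW MB).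
Qed.

(** Lebesgue points of [f], with the interval of integration inside [p, q]. *)
Definition Lpt p q f x := forall e, 0 < e -> exists2 d, 0 < d &
  forall l, 0 < l < d -> [/\ p <= x - l, x + l <= q &
    I (x - l) (x + l) (fun y => `|f y - f x|) <= 2 * l * e].

Lemma ae_Lpt p q f : itg p q f -> {ae mu, forall x, x \in `]p, q[ -> Lpt p q f x}.
Proof.
move=> i; have L := integrable_locally_restrict _ i.
have {L} := lebesgue_differentiation (L _).
move=> /(_ (measurable_itv _)); apply: ae_imp => x Hx; rewrite in_itv /= => /andP[px xq] e e0.
have : \forall r \near (0 : R)^'+, (davg (f \_ `[p, q]) x r < e%:E)%E.
  move: Hx; rewrite /lebesgue_pt => /fine_cvgP[F C].
  have C' : \forall r \near (0 : R)^'+, fine (davg (f \_ `[p, q]) x r) < e.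
    by apply: (cvgr_lt 0).
  near=> r; have /fineK <- : davg (f \_ `[p, q]) x r \is a fin_num by near: r.
  by rewrite lte_fin; near: r.
rewrite near_withinE => -[d /= d0 Hd].
exists (Num.min d (Num.min (x - p) (q - x))).
  by rewrite !lt_min d0 !subr_gt0 px xq.
move=> l /andP[l0]; rewrite !lt_min => /andP[ld /andP[lp lq]].
have H := Hd l _ l0.
split; [lra|lra|].
have {}H : (davg (f \_ `[p, q]) x l < e%:E)%E by apply: H; rewrite /ball_ /= sub0r normrN gtr0_norm.
move: H; rewrite /davg /iavg lebesgue_measure_ball ?(ltW l0) // ball_itv.
have il : itg (x - l) (x + l) (fun y => `|f y - f x|).
  apply: itg_abs; apply: itg_B; last exact: itg_cst.
  apply: itg_sub i; lra.
rewrite (_ : (\int[mu]_(y in _) _)%E = (I (x - l) (x + l) (fun y => `|f y - f x|))%:E); last first.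
  rewrite -EFin_I // -int_oo_cc; last first.
    by case/integrableP: ((itg_oo _ _ _).2 il).
  apply: eq_integral => y; rewrite inE /= in_itv /= => /andP[xy yx].
  rewrite !patchE !mem_set //= in_itv /=; apply/andP; split; lra.
rewrite inver ifF; last by rewrite mulrn_eq0 /= gt_eqF.
rewrite -EFinM lte_fin => /ltW; rewrite mulrC ler_pdivrMr ?pmulrn_lgt0 // mulr_natl.
by rewrite mulrC.
Unshelve. all: by end_near. Qed.

(** The tents [hat l x] are bounded by [1 / l] on an interval of length [2 * l], so
    averaging against them converges at every Lebesgue point. *)
Lemma Lpt_avg p q f x : itg p q f -> Lpt p q f x -> forall e, 0 < e -> exists2 d, 0 < d &
  forall l, 0 < l < d -> [/\ p <= x - l, x + l <= q &
     `|I p q (fun y => f y * hat l x y) - f x| <= e].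
Proof.
move=> i L e e0; have [|d d0 H] := L (e / 2); first by rewrite divr_gt0.
exists d => // l /[dup] /andP[l0 _] /H [pl lq Hl]; split => //.
have lx : x - l <= x + l by lra.
have il := itg_sub _ _ _ _ _ pl lq i.
have ck y z : {within `[y, z], continuous (hat l x)} by apply: within_cont; exact: hat_cont.
have ik := itg_Mc _ _ _ _ i (ck p q).
have zl y z : z <= x - l -> I y z (fun y => f y * hat l x y) = 0.
  move=> zx; rewrite (I_ext _ _ _ (fun=> 0)) ?/I ?Rintegral_cst ?mul0r //.
  by move=> t /andP[yt tz]; rewrite hat_out ?mulr0 // (le_trans tz).
have zr y z : x + l <= y -> I y z (fun y => f y * hat l x y) = 0.
  move=> zx; rewrite (I_ext _ _ _ (fun=> 0)) ?/I ?Rintegral_cst ?mul0r //.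
  by move=> t /andP[yt tz]; rewrite hat_out ?mulr0 // (le_trans zx yt) orbT.
rewrite (I_chasles p (x - l) q) //; last by lra.
have ik2 : itg (x - l) q (fun y => f y * hat l x y) by apply: itg_sub ik.
rewrite (I_chasles (x - l) (x + l) q) // (zl p) // (zr _ q) // add0r addr0.
rewrite -[f x]mulr1 -(hat_int l x l0) -I_Z; last exact: itg_cont.
rewrite -I_B; first last.
- by apply: itg_Z; exact: itg_cont.
- exact: itg_Mc.
apply: le_trans (I_abs _ _ _ _) _.
  apply: itg_B; [exact: itg_Mc|apply: itg_Z; exact: itg_cont].
have iab : itg (x - l) (x + l) (fun y => `|f y - f x|).
  by apply: itg_abs; apply: itg_B => //; exact: itg_cst.
apply: (@le_trans _ _ (I (x - l) (x + l) (fun y => l^-1 * `|f y - f x|))).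
  apply: I_le; last 2 first.
  - exact: itg_Z.
  - move=> y _; rewrite -mulrBl normrM mulrC ler_wpM2r //.
    by have /andP[k0 k1] := hat_ge0 l x y l0; rewrite ger0_norm.
  apply: itg_abs; apply: itg_B; [exact: itg_Mc|apply: itg_Z; exact: itg_cont].
rewrite I_Z // mulrC ler_pdivrMr //; apply: le_trans Hl _.
by rewrite le_eqVlt; apply/orP; left; apply/eqP; field.
Qed.

(** How almost everywhere statements are turned into points below. *)
Lemma ae_exists (A : set R) (P : R -> Prop) : measurable A -> (0 < mu A)%E ->
  {ae mu, forall x, A x -> P x} -> exists2 x, A x & P x.
Proof.
move=> mA A0 [N [mN N0 HN]]; apply/not_exists2P => H.
have : A `<=` N.
  move=> x Ax; apply: HN => /= HP; case: (H x) => //; apply; exact: HP.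
move=> /(le_measure mu) => /(_ (mem_set mA) (mem_set mN)).
move=> /(lt_le_trans A0) H0.
by move: (lt_eqF H0) => /negbT/eqP; apply; exact: esym N0.
Qed.

Lemma lebesgue_oo_gt0 p q : p < q -> (0 < mu `]p, q[)%E.
Proof. by move=> pq; rewrite lebesgue_measure_itv /= lte_fin pq -EFinB lte_fin subr_gt0. Qed.

Lemma ae_exists_oo p q (P : R -> Prop) : p < q ->
  {ae mu, forall x, x \in `]p, q[ -> P x} -> exists2 x, p < x < q & P x.
Proof.
move=> pq H; have [||x] := ae_exists `]p, q[ P _ (lebesgue_oo_gt0 _ _ pq) => //.
by rewrite /= in_itv /= => ? ?; exists x.
Qed.

Definition test_on p q phi := test_function `]p, q[ phi.

Lemma test_out O phi x : test_function O phi -> ~ O x -> phi x = 0 /\ derive1 phi x = 0.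
Proof.
move=> [d c [K [cK KO H]]] Ox; have Kx : ~ K x by move=> /KO.
split; first exact: H.
have : \near x, cst 0 x = phi x.
  have : open (~` K) by apply: closed_openC; apply: compact_closed cK; exact: Rhausdorff.
  move=> /(_ x Kx) ; apply: filterS => y /= /H; by [].
move=> E; rewrite derive1E -(near_eq_derive _ E) derive_cst //.
Qed.

Lemma ramp_test p q l x y : 0 < l -> p < x - l -> x + l < q -> p < y - l -> y + l < q ->
  test_on p q (fun t => ramp l x t - ramp l y t) /\
  derive1 (fun t => ramp l x t - ramp l y t) = (fun t => hat l x t - hat l y t).
Proof.
move=> l0 px xq py yq.
have D (t : R) : is_derive t 1 (fun t => ramp l x t - ramp l y t) (hat l x t - hat l y t).
  by apply: is_deriveB; exact: is_derive_ramp.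
have E : derive1 (fun t => ramp l x t - ramp l y t) = (fun t => hat l x t - hat l y t).
  by apply/funext => t; rewrite derive1E; have [_ ->] := D t.
split=> //; split.
- by move=> t; have [] := D t.
- by rewrite E => t; apply: cvgB; exact: hat_cont.
- exists `[Num.min x y - l, Num.max x y + l]%classic; split.
  + exact: segment_compact.
  + move=> t /=; rewrite !in_itv /= => /andP[H1 H2]; apply/andP.
    by move: H1 H2; case: (leP x y) => xy; split; lra.
  + move=> t /=; rewrite in_itv /= => /negP; rewrite negb_and -!ltNge => /orP[] H.
    * by rewrite !ramp_l ?subrr // (le_trans (ltW H)) // lerD2r ge_min lexx ?orbT.
    * by rewrite !ramp_r ?subrr // (le_trans _ (ltW H)) // lerD2r le_max lexx ?orbT.
Qed.

(** The difference of two ramps of equal height is compactly supported; its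
    derivative is the difference of two tents, so the averages of [w] around any
    two Lebesgue points coincide. *)
Lemma du_Bois_Reymond p q w : p < q -> itg p q w ->
  (forall phi, test_on p q phi -> I p q (fun x => w x * derive1 phi x) = 0) ->
  exists c, {ae mu, forall x, x \in `]p, q[ -> w x = c}.
Proof.
move=> pq iw H; have L := ae_Lpt p q w iw.
have [x0 /andP[px0 x0q] Lx0] := ae_exists_oo _ _ _ pq L.
exists (w x0); apply: ae_imp L => x Lx /[dup] xpq /Lx {}Lx.
apply/eqP; rewrite -subr_eq0 -normr_le0; apply/ler_addgt0Pr => e e0.
rewrite add0r; have e2 : 0 < e / 2 by rewrite divr_gt0.
have [d d0 Hd] := Lpt_avg _ _ _ _ iw Lx _ e2.
have [d' d'0 Hd'] := Lpt_avg _ _ _ _ iw Lx0 _ e2.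
pose m := Num.min d d'; have m0 : 0 < m by rewrite lt_min d0.
have md : m <= d by rewrite ge_min lexx.
have md' : m <= d' by rewrite ge_min lexx orbT.
have [pm mq _] := Hd (m / 2) ltac:(apply/andP; split; lra_from m0 md).
have [pm' mq' _] := Hd' (m / 2) ltac:(apply/andP; split; lra_from m0 md').
have [_ _ A] := Hd (m / 4) ltac:(apply/andP; split; lra_from m0 md).
have [_ _ A'] := Hd' (m / 4) ltac:(apply/andP; split; lra_from m0 md').
have [T E] := ramp_test p q (m / 4) x x0 ltac:(lra_from m0) ltac:(lra_from pm m0)
  ltac:(lra_from mq m0) ltac:(lra_from pm' m0) ltac:(lra_from mq' m0).
have := H _ T; rewrite E.
have ck z : itg p q (fun y => w y * hat (m / 4) z y).
  by apply: itg_Mc => //; apply: within_cont; exact: hat_cont.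
rewrite (I_ext _ _ _ (fun t => w t * hat (m / 4) x t - w t * hat (m / 4) x0 t)); last first.
  by move=> t _; rewrite mulrBr.
rewrite I_B //.
move: A A'; set a1 := I _ _ _; set a2 := I _ _ _; rewrite !ler_norml.
move=> /andP[h1 h2] /andP[h3 h4] h5; by apply/andP; split; lra_from h1 h2 h3 h4 h5.
Qed.

End WeakDeriv.

(** * Weak derivatives are primitives *)

Section WeakDeriv2.
Context {R : realType}.
Implicit Types (p q r x y c l z e : R) (f g h u v w phi : R -> R) (O : set R).
Local Notation mu := (@lebesgue_measure R).

Lemma cvgn_small (u_ : (\bar R)^nat) e : 0 < e -> u_ n @[n --> \oo] --> 0%E ->
  exists n, (u_ n < e%:E)%E.
Proof.
move=> e0 /fine_cvgP[F C].
have C' : \forall n \near \oo, fine (u_ n) < e by apply: (cvgr_lt 0).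
near \oo => n; exists n; have /fineK <- : u_ n \is a fin_num by near: n.
by rewrite lte_fin; near: n.
Unshelve. all: by end_near. Qed.

Lemma L1_approx p q v e : 0 < e -> itg p q v ->
  exists2 g, continuous g & I p q (fun x => `|v x - g x|) <= e.
Proof.
move=> e0 i.
have [||g_ [cg ig C]] := @approximation_continuous_integrable R `[p, q] v _ _ i => //.
  exact: compact_finite_measure (@segment_compact R p q).
have [n Hn] := cvgn_small _ _ e0 C.
exists (g_ n) => //; rewrite -lee_fin -EFin_I; first exact: ltW.
by apply: itg_abs; apply: itg_B => //; exact: ig.
Qed.

Lemma FTC_prim p q g : p < q -> continuous g ->
  derivable_oo_LRcontinuous (fun x => I p x g) p q /\
  {in `]p, q[, derive1 (fun x => I p x g) =1 g}.
Proof.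
move=> pq cg; have ig y z : itg y z g by apply: itg_cont; exact: within_cont.
have D x : p < x -> derivable (fun x => I p x g) x 1 /\ derive1 (fun x => I p x g) x = g x.
  move=> px; apply: (@continuous_FTC1_closed R g p x (x + 1)) => //; last exact: cg.
  - by rewrite ltrDl.
  - exact: ig.
have P : prim p q (fun x => I p x g) g.
  by split; [exact: ig|move=> x _; rewrite I_pt add0r].
have /continuous_within_itvP := prim_cont _ _ _ _ P; move=> /(_ pq) [_ L Rr].
split.
- split => //.
  by move=> x; rewrite in_itv /= => /andP[px _]; case: (D x px).
- by move=> x; rewrite in_itv /= => /andP[px _]; case: (D x px).
Qed.

Lemma IBP_cont p q g phi : p < q -> continuous g ->
  (forall x, derivable phi x 1) -> continuous (derive1 phi) ->
  phi p = 0 -> phi q = 0 ->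
  I p q (fun x => I p x g * derive1 phi x) = - I p q (fun x => g x * phi x).
Proof.
move=> pq cg dphi cphi pp qq.
have [F1 F2] := FTC_prim p q g pq cg.
have cp y : {for y, continuous phi}.
  by apply: differentiable_continuous; apply/derivable1_diffP; exact: dphi.
have F3 : derivable_oo_LRcontinuous phi p q.
  split.
  - by move=> y _.
  - by apply: cvg_at_right_filter; exact: cp.
  - by apply: cvg_at_left_filter; exact: cp.
have := @Rintegration_by_parts R (fun x => I p x g) phi g (derive1 phi) p q pq
  (within_cont p q g cg) F1 F2 (within_cont p q _ cphi) F3 (fun _ _ => erefl).
by rewrite pp qq !mulr0 subrr sub0r.
Qed.

(** For a continuous density this is classical; both sides are continuous in the
    density with respect to the L1 norm, in which continuous functions are dense. *)
Lemma IBP p q f v phi : p < q -> prim p q f v ->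
  (forall x, derivable phi x 1) -> continuous (derive1 phi) ->
  phi p = 0 -> phi q = 0 ->
  I p q (fun x => f x * derive1 phi x) = - I p q (fun x => v x * phi x).
Proof.
move=> pq Pf dphi cphi pp qq; have [iv ef] := Pf.
have cp : continuous phi.
  by move=> y; apply: differentiable_continuous; apply/derivable1_diffP; exact: dphi.
have cpw y z : {within `[y, z], continuous phi} by exact: within_cont.
have cdw y z : {within `[y, z], continuous (derive1 phi)} by exact: within_cont.
have [M M0 HM] := cont_bounded p q _ (cpw p q).
have [M' M'0 HM'] := cont_bounded p q _ (cdw p q).
have cf := prim_cont _ _ _ _ Pf.
have ifd : itg p q (fun x => f x * derive1 phi x) by exact: (itg_Mc _ _ _ _ (itg_cont _ _ _ cf) (cdw p q)).
have ivp : itg p q (fun x => v x * phi x) by exact: (itg_Mc _ _ _ _ iv (cpw p q)).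
have ip : itg p q phi := itg_cont _ _ _ (cpw p q).
have idp : itg p q (derive1 phi) := itg_cont _ _ _ (cdw p q).
apply/eqP; rewrite -subr_eq0 opprK -normr_le0; apply/ler_addgt0Pr => e e0; rewrite add0r.
(* M and M' bound phi and its derivative, so C bounds the effect on both sides
   of replacing v by a continuous g, relative to their L1 distance. *)
pose C := M' * (q - p) + M.
have C0 : 0 < C by rewrite addr_gt0 // mulr_gt0 // subr_gt0.
have [g cg Hg] := L1_approx p q v (e / C) (divr_gt0 e0 C0) iv.
have ig y z : itg y z g by apply: itg_cont; exact: within_cont.
have Pg : prim p q (fun x => I p x g) g.
  by split; [exact: ig|move=> x _; rewrite I_pt add0r].
have iGd : itg p q (fun x => I p x g * derive1 phi x).
  exact: (itg_Mc _ _ _ _ (itg_cont _ _ _ (prim_cont _ _ _ _ Pg)) (cdw p q)).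
have igp : itg p q (fun x => g x * phi x) := itg_Mc _ _ _ _ (ig p q) (cpw p q).
have ivg : itg p q (fun x => `|v x - g x|) by apply: itg_abs; exact: itg_B.
have Z : I p q (derive1 phi) = 0.
  have := prim_C1 p q phi (derive1 phi) (ltW pq).
  move=> /(_ _ cphi) P.
  have {}P : prim p q phi (derive1 phi).
    by apply: P => x; apply: DeriveDef => //; rewrite derive1E.
  by rewrite -(primB _ _ _ _ _ _ P) ?(ltW pq) // pp qq subrr.
have H := IBP_cont p q g phi pq cg dphi cphi pp qq.
have -> : I p q (fun x => f x * derive1 phi x) + I p q (fun x => v x * phi x) =
   I p q (fun x => (f x - f p - I p x g) * derive1 phi x) + I p q (fun x => (v x - g x) * phi x).
  rewrite (I_ext _ _ (fun x => (f x - f p - I p x g) * derive1 phi x)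
    (fun x => f x * derive1 phi x - (f p * derive1 phi x + I p x g * derive1 phi x))); last first.
    by move=> x _; ring.
  rewrite (I_ext _ _ (fun x => (v x - g x) * phi x)
    (fun x => v x * phi x - g x * phi x)); last by move=> x _; ring.
  rewrite !I_B // ?I_D // ?I_Z // ?Z ?H ?mulr0 ?add0r //.
  - by ring.
  - exact: itg_Z.
  - by apply: itg_D => //; exact: itg_Z.
apply: le_trans (ler_normD _ _) _.
have B1 x : p <= x <= q -> `|f x - f p - I p x g| <= I p q (fun x => `|v x - g x|).
  move=> /andP[px xq].
  have s1 : itg p x v by apply: itg_sub iv.
  have -> : f x - f p - I p x g = I p x (fun x => v x - g x).
    by rewrite ef ?px // I_B //; ring.
  apply: le_trans (I_abs _ _ _ _) _; first exact: itg_B.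
  rewrite (I_chasles p x q) // lerDl; exact: I_ge0.
have E : `|I p q (fun x => (f x - f p - I p x g) * derive1 phi x)| <= M' * (q - p) * I p q (fun x => `|v x - g x|).
  have i1 : itg p q (fun x => (f x - f p - I p x g) * derive1 phi x).
    apply: (itg_Mc _ _ _ _ _ (cdw p q)); apply: itg_B; last exact: itg_cont (prim_cont _ _ _ _ Pg).
    by apply: itg_B; [exact: (itg_cont _ _ _ cf)|exact: itg_cst].
  apply: le_trans (I_abs _ _ _ i1) _.
  rewrite -mulrA mulrCA mulrC -I_cst ?(ltW pq) //; apply: I_le; [exact: itg_abs|exact: itg_cst|].
  move=> x xpq; rewrite normrM mulrC ler_pM //; [exact: HM'|exact: B1].
have E' : `|I p q (fun x => (v x - g x) * phi x)| <= M * I p q (fun x => `|v x - g x|).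
  have i1 : itg p q (fun x => (v x - g x) * phi x) by exact: (itg_Mc _ _ _ _ (itg_B _ _ _ _ iv (ig p q)) (cpw p q)).
  apply: le_trans (I_abs _ _ _ i1) _.
  rewrite -I_Z //; apply: I_le; [exact: itg_abs|exact: itg_Z|].
  by move=> x xpq; rewrite normrM mulrC ler_wpM2r //; exact: HM.
apply: le_trans (lerD E E') _; rewrite -mulrDl -/C.
by rewrite mulrC -ler_pdivlMr.
Qed.

Lemma int_restrict O p q h : `]p, q[ `<=` O -> (forall x, ~ `]p, q[%classic x -> h x = 0) ->
  \int[mu]_(x in O) h x = \int[mu]_(x in `]p, q[) h x.
Proof.
move=> sub h0; rewrite Rintegral_mkcond [RHS]Rintegral_mkcond; apply: eq_Rintegral => x _.
rewrite !patchE; case: ifPn => xO; case: ifPn => xpq //; rewrite ?notin_setE in xpq xO; last first.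
  by rewrite inE in xpq; case: xO; exact: sub.
exact: h0.
Qed.

Lemma weak_restrict O p q u v : `]p, q[ `<=` O -> is_weak_derivative O u v ->
  is_weak_derivative `]p, q[ u v.
Proof.
move=> sub [[mu1 o1 l1] [mu2 o2 l2] H].
have mO : measurable O by exact: open_measurable.
split.
- split => //; [exact: measurable_funS mu1|].
  by move=> K KO cK; apply: l1 => //; exact: subset_trans sub.
- split => //; [exact: measurable_funS mu2|].
  by move=> K KO cK; apply: l2 => //; exact: subset_trans sub.
- move=> phi T.
  have TO : test_function O phi.
    by case: T => d c [K [cK KO H0]]; split => //; exists K; split => //; exact: subset_trans sub.
  have := H phi TO.
  rewrite (int_restrict O p q (fun x => u x * derive1 phi x)) //; last first.
    by move=> x /(test_out _ _ _ T)[_ ->]; rewrite mulr0.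
  rewrite (int_restrict O p q (fun x => v x * phi x)) // => x /(test_out _ _ _ T)[-> _].
  by rewrite mulr0.
Qed.

Lemma test_ends p q phi : test_on p q phi -> phi p = 0 /\ phi q = 0.
Proof.
move=> T; split; [case: (test_out _ _ p T)|case: (test_out _ _ q T)] => //;
  by rewrite /= in_itv /= ltxx ?andbF.
Qed.

Lemma prim_weak p q f v : p < q -> prim p q f v -> is_weak_derivative `]p, q[ f v.
Proof.
move=> pq P; have [iv _] := P; have cf := prim_cont _ _ _ _ P.
have i_f : itg p q f by exact: itg_cont.
split.
- by apply: open_integrable_locally => //; apply/itg_oo.
- by apply: open_integrable_locally => //; apply/itg_oo.
- move=> phi T; have [T1 T2] := test_ends _ _ _ T; have [d c _] := T.
  have cp : continuous phi.
    by move=> y; apply: differentiable_continuous; apply/derivable1_diffP; exact: d.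
  have j1 := itg_Mc _ _ _ _ i_f (within_cont _ _ _ c : {within `[p, q], continuous (derive1 phi)}).
  have j2 := itg_Mc _ _ _ _ iv (within_cont _ _ _ cp : {within `[p, q], continuous phi}).
  rewrite (I_oo _ _ _ j1) (I_oo _ _ _ j2).
  exact: (IBP _ _ _ _ _ pq P d c T1 T2).
Qed.

(** The difference between [u] and the primitive of [v] has weak derivative 0. *)
Lemma weak_prim p q u v : p < q -> itg p q u -> itg p q v ->
  is_weak_derivative `]p, q[ u v ->
  exists2 f, prim p q f v & {ae mu, forall x, x \in `]p, q[ -> u x = f x}.
Proof.
move=> pq iu iv [_ _ H].
have PV : prim p q (fun x => I p x v) v.
  by split=> // x _; rewrite I_pt add0r.
have iV : itg p q (fun x => I p x v) by apply: itg_cont; exact: prim_cont PV.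
have [||c Hc] := du_Bois_Reymond p q (fun x => u x - I p x v) pq.
- exact: itg_B.
- move=> phi T; have [T1 T2] := test_ends _ _ _ T; have [d cd _] := T.
  have cp : continuous phi.
    by move=> y; apply: differentiable_continuous; apply/derivable1_diffP; exact: d.
  have := H _ T; have := IBP _ _ _ _ phi pq PV d cd T1 T2.
  have j1 : itg p q (fun x => u x * derive1 phi x) by exact: (itg_Mc _ _ _ _ iu (within_cont _ _ _ cd)).
  have j2 : itg p q (fun x => I p x v * derive1 phi x) by exact: (itg_Mc _ _ _ _ iV (within_cont _ _ _ cd)).
  have j3 : itg p q (fun x => v x * phi x) by exact: (itg_Mc _ _ _ _ iv (within_cont _ _ _ cp)).
  rewrite (I_oo _ _ _ j1) (I_oo _ _ _ j3) => E1 E2.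
  rewrite (I_ext _ _ _ (fun x => u x * derive1 phi x - I p x v * derive1 phi x)); last first.
    by move=> x _; rewrite mulrBl.
  by rewrite I_B // E1 E2 subrr.
- exists (fun x => I p x v + c); last by apply: ae_imp Hc => x Hx /Hx; lra.
  by split=> // x _; rewrite I_pt; ring.
Qed.

(** At a Lebesgue point the averages over small intervals converge to the value. *)
Lemma int0_ae p q w : itg p q w -> (forall x y, p <= x -> x <= y -> y <= q -> I x y w = 0) ->
  {ae mu, forall x, x \in `]p, q[ -> w x = 0}.
Proof.
move=> iw H; apply: ae_imp (ae_Lpt p q w iw) => x L /L {}L.
apply/eqP; rewrite -normr_le0; apply/ler_addgt0Pr => e e0; rewrite add0r.
have [d d0 Hd] := L _ e0; have [|pl lq B] := Hd (d / 2); first by apply/andP; split; lra.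
have dd : 0 < d / 2 by rewrite divr_gt0.
have xx : x - d / 2 <= x + d / 2 by lra.
have isub := itg_sub _ _ _ _ _ pl lq iw.
have : `|I (x - d / 2) (x + d / 2) (fun y => w y - w x)| <= 2 * (d / 2) * e.
  by apply: le_trans B; apply: I_abs; apply: itg_B => //; exact: itg_cst.
rewrite I_B //; last exact: itg_cst.
rewrite H // I_cst // sub0r normrN normrM (gtr0_norm (x := _ - _)); last by lra.
move: dd; set l := d / 2 => l0.
have -> : x + l - (x - l) = 2 * l by ring.
by rewrite [leRHS]mulrC ler_pM2r // mulr_gt0.
Qed.

Lemma prim_uniq p q f v1 v2 : prim p q f v1 -> prim p q f v2 ->
  {ae mu, forall x, x \in `]p, q[ -> v1 x = v2 x}.
Proof.
move=> P1 P2; have [i1 _] := P1; have [i2 _] := P2.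
have H := int0_ae p q (fun x => v1 x - v2 x) (itg_B _ _ _ _ i1 i2).
apply: ae_imp (H _) => [x Hx /Hx|x y px xy yq]; first by lra.
rewrite I_B; [|exact: itg_sub i1|exact: itg_sub i2].
by rewrite -(primB _ _ _ _ _ _ P1) // -(primB _ _ _ _ _ _ P2) // subrr.
Qed.

Lemma cont_ae0 p q g : p < q -> {within `[p, q], continuous g} ->
  {ae mu, forall x, x \in `]p, q[ -> g x = 0} -> forall x, p <= x <= q -> g x = 0.
Proof.
move=> pq /subspace_continuousP C E x /[dup] xpq /andP[px xq].
apply/eqP/negPn/negP => gx.
have gx0 : 0 < `|g x| by rewrite normr_gt0.
have := C x; rewrite /= in_itv /= xpq => /(_ isT) /cvgrPdist_lt /(_ _ gx0).
rewrite near_withinE => -[d /= d0 Hd].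
have [y /andP[y1 y2] yE] : exists2 y, Num.max p (x - d) < y < Num.min q (x + d) & g y = 0.
  apply: ae_exists_oo.
    by rewrite gt_max !lt_min pq; apply/and3P; split; lra.
  apply: ae_imp E => y Hy; rewrite in_itv /= => /andP[]; rewrite gt_max lt_min.
  by move=> /andP[py _] /andP[yq _]; apply: Hy; rewrite in_itv /= py.
move: y1 y2; rewrite gt_max lt_min => /andP[py xy] /andP[yq yx].
have : `|g x - g y| < `|g x|.
  apply: (Hd y); rewrite /ball_ /= ?in_itv /=; last by apply/andP; split; lra.
  by rewrite ltr_norml; apply/andP; split; lra.
by rewrite yE subr0 ltxx.
Qed.

Lemma prim_B p q f1 f2 v1 v2 : prim p q f1 v1 -> prim p q f2 v2 ->
  prim p q (fun x => f1 x - f2 x) (fun x => v1 x - v2 x).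
Proof.
move=> [i1 e1] [i2 e2]; split; first exact: itg_B.
move=> x /[dup] xpq /andP[px xq]; rewrite e1 // e2 // I_B; first by ring.
- by apply: itg_sub i1.
- by apply: itg_sub i2.
Qed.

Lemma prim_ae_eq p q f1 f2 v1 v2 : p < q -> prim p q f1 v1 -> prim p q f2 v2 ->
  {ae mu, forall x, x \in `]p, q[ -> f1 x = f2 x} ->
  (forall x, p <= x <= q -> f1 x = f2 x) /\
  {ae mu, forall x, x \in `]p, q[ -> v1 x = v2 x}.
Proof.
move=> pq P1 P2 E; have [i1 e1] := P1; have [i2 e2] := P2.
have H x : p <= x <= q -> f1 x = f2 x.
  move=> xpq; apply/eqP; rewrite -subr_eq0; apply/eqP.
  apply: (cont_ae0 p q (fun x => f1 x - f2 x)) => //.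
    exact: prim_cont (prim_B _ _ _ _ _ _ P1 P2).
  by apply: ae_imp E => y Hy /Hy ->; rewrite subrr.
split=> //; apply: prim_uniq P1 _.
by apply: prim_ext P2 => // [|x xpq]; [exact: ltW|rewrite H].
Qed.

Lemma loc_itg O u p q : locally_integrable O u -> `[p, q] `<=` O -> itg p q u.
Proof.
move=> [m o l] S; apply/integrableP; split.
  by apply/measurable_EFinP; apply: measurable_funS m => //; exact: open_measurable.
exact: l (@segment_compact _ _ _).
Qed.

(** Stated on subintervals compactly contained in [O], where both functions are
    integrable; [ae_exhaust] and [ae_exhaustT] extend the conclusion to [O]. *)
Lemma weak_uniq O u1 u2 v1 v2 p q : p < q -> `[p, q] `<=` O ->
  is_weak_derivative O u1 v1 -> is_weak_derivative O u2 v2 ->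
  {ae mu, forall x, x \in `]p, q[ -> u1 x = u2 x} ->
  {ae mu, forall x, x \in `]p, q[ -> v1 x = v2 x}.
Proof.
move=> pq S w1 w2 E.
have S' : `]p, q[ `<=` O by apply: subset_trans S; exact: subset_itv_oo_cc.
have [lu1 lv1 _] := w1; have [lu2 lv2 _] := w2.
have [f1 P1 E1] := weak_prim _ _ _ _ pq (loc_itg _ _ _ _ lu1 S) (loc_itg _ _ _ _ lv1 S)
  (weak_restrict _ _ _ _ _ S' w1).
have [f2 P2 E2] := weak_prim _ _ _ _ pq (loc_itg _ _ _ _ lu2 S) (loc_itg _ _ _ _ lv2 S)
  (weak_restrict _ _ _ _ _ S' w2).
have [] // := prim_ae_eq _ _ _ _ _ _ pq P1 P2.
have E12 : {ae mu, forall x, x \in `]p, q[ -> u1 x = f1 x /\ u2 x = f2 x}.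
  by apply: ae_imp2 E1 E2 => x a b xpq; split; [exact: a|exact: b].
by apply: ae_imp2 E12 E => x a c xpq; have [<- <-] := a xpq; exact: c.
Qed.

Lemma ae_exhaust p q (P : R -> Prop) :
  (forall x y, p < x -> x < y -> y < q -> {ae mu, forall t, t \in `]x, y[ -> P t}) ->
  {ae mu, forall t, t \in `]p, q[ -> P t}.
Proof.
move=> H; have [pq|qp] := ltP p q; last first.
  by apply: aeW => x; rewrite in_itv /= => /andP[a b]; move: (lt_trans a b); rewrite ltNge qp.
pose d n : R := (q - p) / n.+3%:R.
have Hn n : {ae mu, forall t, t \in `]p + d n, q - d n[ -> P t}.
  have d0 : 0 < d n by rewrite divr_gt0 // subr_gt0.
  have dd : d n <= (q - p) / 3 by rewrite ler_pM2l ?subr_gt0 // lef_pV2 ?posrE // ler_nat.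
  apply: H; lra.
have : {ae mu, forall t n, t \in `]p + d n, q - d n[ -> P t} by exact/ae_foralln.
apply: ae_imp => t Ht; rewrite in_itv /= => /andP[pt tq].
pose m := Num.min (t - p) (q - t); have m0 : 0 < m by rewrite lt_min !subr_gt0 pt.
pose n := Num.truncn ((q - p) / m).
have dn : d n < m.
  rewrite /d ltr_pdivrMr // mulrC -ltr_pdivrMr //.
  apply: lt_le_trans (truncnS_gt _) _.
  by rewrite ler_nat /n; apply/leqW/leqW.
apply: (Ht n); move: dn; rewrite lt_min in_itv /= => /andP[? ?]; apply/andP; split; lra.
Qed.

Lemma ae_exhaustT (P : R -> Prop) :
  (forall x y, x < y -> {ae mu, forall t, t \in `]x, y[ -> P t}) ->
  {ae mu, forall t, P t}.
Proof.
move=> H.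
have : {ae mu, forall t (n : nat), t \in `](- n.+1%:R), n.+1%:R[ -> P t}.
  by apply/ae_foralln => n; apply: H; rewrite gtrN.
apply: ae_imp => t Ht; apply: (Ht (Num.truncn `|t|)); rewrite in_itv /= -ltr_norml.
exact: truncnS_gt.
Qed.

(** The weak derivative is a choice, so all that is known of it is this. *)
Lemma weak_derivP O u v : is_weak_derivative O u v ->
  is_weak_derivative O u (weak_derivative O u).
Proof. by move=> H; apply: (@xgetPex _ _ (is_weak_derivative O u)); exists v. Qed.

Lemma L2_itg p q u : L2 `]p, q[ u -> itg p q u /\ itg p q (fun x => u x ^+ 2).
Proof.
move=> [m s].
have i2 : itg p q (fun x => u x ^+ 2).
  apply/itg_oo/integrableP; split.
    by apply/measurable_EFinP; exact: measurable_funX.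
  apply: le_lt_trans s; rewrite le_eqVlt; apply/orP; left; apply/eqP.
  by apply: eq_integral => x _ /=; rewrite ger0_norm // sqr_ge0.
split=> //; apply/itg_oo.
have i3 : mu.-integrable `]p, q[ (EFin \o (fun x => 1 + u x ^+ 2)).
  by apply/itg_oo; apply: itg_D => //; exact: itg_cst.
apply: le_integrable i3 => //; first exact/measurable_EFinP.
move=> x _ /=; rewrite lee_fin [leRHS]ger0_norm ?addr_ge0 ?sqr_ge0 //.
by rewrite ler_norml; apply/andP; split; nra.
Qed.

Lemma itg_L2 p q u : itg p q u -> itg p q (fun x => u x ^+ 2) -> L2 `]p, q[ u.
Proof.
move=> /itg_oo/integrableP[m _] /itg_oo i; split; first exact/measurable_EFinP.
case/integrableP: i => _; apply: le_lt_trans; rewrite le_eqVlt; apply/orP; left; apply/eqP.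
by apply: eq_integral => x _ /=; rewrite ger0_norm // sqr_ge0.
Qed.

(** The representation of W22 used in the whole proof: a function with its first
    two derivatives, where values and slopes make sense up to the endpoints. *)
Definition H2 p q f g h :=
  [/\ prim p q f g, prim p q g h & itg p q (fun x => h x ^+ 2)].

Lemma H2_sub p q p' q' f g h : p <= p' -> q' <= q -> H2 p q f g h -> H2 p' q' f g h.
Proof.
by move=> pp qq [a b c]; split; [exact: prim_sub a|exact: prim_sub b|exact: itg_sub c].
Qed.

Lemma H2_splice p q r f1 f2 g1 g2 h1 h2 : p <= q -> q <= r ->
  f1 q = f2 q -> g1 q = g2 q -> H2 p q f1 g1 h1 -> H2 q r f2 g2 h2 ->
  H2 p r (splice q f1 f2) (splice q g1 g2) (splice q h1 h2).
Proof.
move=> pq qr fq gq [a1 b1 c1] [a2 b2 c2]; split; [exact: prim_splice|exact: prim_splice|].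
have [i _] := itg_splice p q r _ _ pq qr c1 c2.
by apply: itg_ext i => x _; rewrite /splice; case: ifP.
Qed.

Lemma weak_H2 p q u v w : p < q -> itg p q u -> itg p q v -> itg p q w ->
  itg p q (fun x => w x ^+ 2) ->
  is_weak_derivative `]p, q[ u v -> is_weak_derivative `]p, q[ v w ->
  exists f g, [/\ H2 p q f g w,
    {ae mu, forall x, x \in `]p, q[ -> u x = f x} &
    {ae mu, forall x, x \in `]p, q[ -> v x = g x}].
Proof.
move=> pq iu iv iw iw2 W1 W2.
have [f P1 E1] := weak_prim _ _ _ _ pq iu iv W1.
have [g P2 E2] := weak_prim _ _ _ _ pq iv iw W2.
exists f, g; split=> //; split=> //.
have ig : itg p q g by apply: itg_cont; exact: prim_cont P2.
split=> // x /andP[px xq]; have [_ ->] := P1; last by rewrite px.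
congr +%R; apply: I_ae.
- by apply: itg_sub iv.
- by apply: itg_sub ig.
- apply: ae_imp E2 => y Hy yx; apply: Hy; move: yx; rewrite !in_itv /= => /andP[py yx].
  by apply/andP; split; lra.
Qed.

Lemma W22_H2 p q u : p < q -> W22 `]p, q[ u -> exists f g h, [/\ H2 p q f g h,
    {ae mu, forall x, x \in `]p, q[ -> u x = f x},
    {ae mu, forall x, x \in `]p, q[ -> weak_derivative `]p, q[ u x = g x} &
    {ae mu, forall x, x \in `]p, q[ ->
       weak_derivative `]p, q[ (weak_derivative `]p, q[ u) x = h x}].
Proof.
move=> pq [[Lu [v [Lv Wv]]] [Lu' [w [Lw Ww]]]].
have [iu _] := L2_itg _ _ _ Lu; have [iu' _] := L2_itg _ _ _ Lu'.
have [iw iw2] := L2_itg _ _ _ Lw.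
have [f [g [H E1 E2]]] := weak_H2 _ _ _ _ _ pq iu iu' iw iw2 (weak_derivP _ _ _ Wv) Ww.
exists f, g, w; split=> //.
have WW := weak_derivP _ _ _ Ww.
have [P1 P2 _] := H.
set w' := weak_derivative _ _ in WW *.
apply: ae_exhaust => x y px xy yq.
apply: (weak_uniq `]p, q[ (weak_derivative `]p, q[ u) (weak_derivative `]p, q[ u)) => //.
- by move=> t /=; rewrite !in_itv /= => /andP[? ?]; apply/andP; split; lra.
- exact: aeW.
Qed.
End WeakDeriv2.

(** * Sobolev classes on bounded intervals and on the line *)

Section Sobolev.
Context {R : realType}.
Implicit Types (p q r x y c l z e : R) (f g h u v w phi : R -> R) (O : set R).
Local Notation mu := (@lebesgue_measure R).

Lemma Rintegral_ae O u1 u2 : measurable O -> measurable_fun O u1 -> measurable_fun O u2 ->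
  {ae mu, forall x, O x -> u1 x = u2 x} ->
  \int[mu]_(x in O) u1 x = \int[mu]_(x in O) u2 x.
Proof.
move=> mO m1 m2 E; rewrite /Rintegral; congr fine; apply: ae_eq_integral => //.
- exact/measurable_EFinP.
- exact/measurable_EFinP.
- by apply: ae_imp E => x /= H Ox; rewrite H.
Qed.

Lemma is_weak_ae O u1 u2 v : is_weak_derivative O u1 v -> locally_integrable O u2 ->
  {ae mu, forall x, O x -> u1 x = u2 x} -> is_weak_derivative O u2 v.
Proof.
move=> [[m1 o l1] lv H] l2 E; have [m2 _ _] := l2.
have mO := open_measurable o.
split=> // phi T; rewrite -H //; have [d c _] := T.
have mp : measurable_fun O (derive1 phi) by apply: measurable_funTS; exact: continuous_measurable_fun.
apply: Rintegral_ae => //; [exact: measurable_funM|exact: measurable_funM|].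
by apply: ae_imp E => x Hx Ox; rewrite Hx.
Qed.

(** The two domains of interest, bounded open intervals and the line, are covered
    by countably many compact intervals; this is all that is needed to treat
    them at once. *)
Definition exhaustible O := open O /\ forall P : R -> Prop,
  (forall x y, x < y -> `[x, y] `<=` O -> {ae mu, forall t, t \in `]x, y[ -> P t}) ->
  {ae mu, forall t, O t -> P t}.

Lemma exhaustible_oo p q : exhaustible `]p, q[.
Proof.
split=> // P H; apply: ae_exhaust => x y px xy yq; apply: H => // t /=.
by rewrite !in_itv /= => /andP[? ?]; apply/andP; split; lra.
Qed.

Lemma exhaustibleT : exhaustible setT.
Proof.
split; first exact: openT.
move=> P H; suff : {ae mu, forall t, P t} by apply: ae_imp.
by apply: ae_exhaustT => x y xy; exact: H.
Qed.

(** The second derivative is taken of the chosen first derivative, which is only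
    almost everywhere equal to [g]; hence the detour through [is_weak_ae]. *)
Lemma weak_derivative_iter O f g h : exhaustible O ->
  is_weak_derivative O f g -> is_weak_derivative O g h ->
  [/\ {ae mu, forall x, O x -> weak_derivative O f x = g x},
      is_weak_derivative O (weak_derivative O f) h &
      {ae mu, forall x, O x -> weak_derivative O (weak_derivative O f) x = h x}].
Proof.
move=> [oO ex] W1 W2; have W1' := weak_derivP _ _ _ W1.
have E1 : {ae mu, forall x, O x -> weak_derivative O f x = g x}.
  apply: ex => x y xy S; apply: (weak_uniq _ _ _ _ _ _ _ xy S W1' W1); exact: aeW.
have W2' : is_weak_derivative O (weak_derivative O f) h.
  have [_ l _] := W1'.
  by apply: is_weak_ae W2 l _; apply: ae_imp E1 => x H Ox; rewrite H.
split => //; apply: ex => x y xy S.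
apply: (weak_uniq _ _ _ _ _ _ _ xy S (weak_derivP _ _ _ W2') W2'); exact: aeW.
Qed.

Lemma L2_ae O u1 u2 : measurable O -> L2 O u1 -> measurable_fun O u2 ->
  {ae mu, forall x, O x -> u2 x = u1 x} -> L2 O u2.
Proof.
move=> mO [m1 s] m2 E; split=> //; apply: le_lt_trans s; rewrite le_eqVlt.
apply/orP; left; apply/eqP; apply: ge0_ae_eq_integral => //.
- by apply/measurable_EFinP; exact: measurable_funX.
- by apply/measurable_EFinP; exact: measurable_funX.
- by move=> x _; rewrite lee_fin sqr_ge0.
- by move=> x _; rewrite lee_fin sqr_ge0.
- by apply: ae_imp E => x /= H Ox; rewrite H.
Qed.

Lemma cont_L2 p q f : {within `[p, q], continuous f} -> L2 `]p, q[ f.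
Proof.
by move=> cf; apply: itg_L2; [exact: itg_cont|exact: (itg_Mc _ _ _ _ (itg_cont _ _ _ cf) cf)].
Qed.

Lemma H2_W22 p q f g h : p < q -> H2 p q f g h ->
  [/\ W22 `]p, q[ f,
      {ae mu, forall x, x \in `]p, q[ -> weak_derivative `]p, q[ f x = g x} &
      {ae mu, forall x, x \in `]p, q[ ->
         weak_derivative `]p, q[ (weak_derivative `]p, q[ f) x = h x}].
Proof.
move=> pq [Pf Pg ih2].
have [E1 W2 E2] := weak_derivative_iter _ _ _ _ (exhaustible_oo p q) (prim_weak _ _ _ _ pq Pf) (prim_weak _ _ _ _ pq Pg).
have Lf := cont_L2 _ _ _ (prim_cont _ _ _ _ Pf).
have Lg := cont_L2 _ _ _ (prim_cont _ _ _ _ Pg).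
have Lh : L2 `]p, q[ h by case: Pg => i _; exact: itg_L2.
split=> //; split; first by split => //; exists g; split=> //; exact: prim_weak.
split; last by exists h.
by apply: (L2_ae _ g) => //; have [[m _ _] _ _] := W2.
Qed.

Lemma compact_sub_oo (K : set R) : compact K ->
  exists2 B : R, 0 < B & K `<=` `]- B, B[%classic.
Proof.
move=> cK; have [M [_ HM]] := compact_bounded cK.
have B0 : 0 < `|M| + 1 by rewrite ltr_wpDl.
exists (`|M| + 1 + 1); first by rewrite addr_gt0.
move=> x Kx; rewrite /= in_itv /= -ltr_norml; apply: (@le_lt_trans _ _ (`|M| + 1)).
  by apply: (HM (`|M| + 1)) => //; rewrite (le_lt_trans (ler_norm _)) // ltrDl.
by rewrite ltrDl.
Qed.

Lemma locally_integrableT u : (forall x y, x < y -> itg x y u) -> locally_integrable setT u.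
Proof.
move=> H; split; last 2 first.
- exact: openT.
- move=> K _ cK; have [B B0 KB'] := compact_sub_oo _ cK.
  have KB := subset_trans KB' (@subset_itv_oo_cc _ _ _ _).
  have /integrableP[m i] := H (- B) B ltac:(by rewrite gtrN).
  apply: le_lt_trans i; apply: ge0_subset_integral => //.
  + exact: compact_measurable.
  + apply/measurable_EFinP; apply: measurableT_comp => //; exact/measurable_EFinP.
- rewrite (_ : setT = \bigcup_n `[- (n.+1%:R : R), n.+1%:R]%classic); last first.
    apply/seteqP; split=> // x _; exists (Num.truncn `|x|) => //=.
    by rewrite in_itv /= -ler_norml ltW // truncnS_gt.
  apply/measurable_fun_bigcup => // n.
  have /integrableP[/measurable_EFinP m _] := H (- n.+1%:R) n.+1%:R ltac:(by rewrite gtrN).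
  exact: m.
Qed.

Lemma prim_weakT f v : (forall x y, x < y -> prim x y f v) -> is_weak_derivative setT f v.
Proof.
move=> P; split.
- by apply: locally_integrableT => x y xy; apply: itg_cont; exact: prim_cont (P _ _ xy).
- by apply: locally_integrableT => x y xy; case: (P _ _ xy).
- move=> phi T; have [d c [K [cK _ HK]]] := T.
  have [C C0 KB] := compact_sub_oo _ cK.
  have T' : test_function `]- C, C[ phi by split=> //; exists K.
  have CC : - C < C by rewrite gtrN.
  have [_ _] := prim_weak _ _ _ _ CC (P _ _ CC); move=> /(_ _ T').
  rewrite (int_restrict setT (- C) C (fun x => f x * derive1 phi x)) //; last first.
    by move=> x /(test_out _ _ _ T')[_ ->]; rewrite mulr0.
  rewrite (int_restrict setT (- C) C (fun x => v x * phi x)) // => x /(test_out _ _ _ T')[-> _].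
  by rewrite mulr0.
Qed.

Lemma prim_cst p q c : prim p q (fun=> c) (fun=> 0).
Proof.
split; first exact: itg_cst.
by move=> x /andP[px _]; rewrite I_cst // mul0r addr0.
Qed.

Lemma H2_cst p q c : H2 p q (fun=> c) (fun=> 0) (fun=> 0).
Proof.
split; [exact: prim_cst|exact: prim_cst|].
by apply: (itg_ext _ _ (fun=> 0)) => [x _|]; [rewrite expr0n|exact: itg_cst].
Qed.

Lemma L2loc_line u : (forall x y, x < y -> L2 `]x, y[ u) -> L2loc setT u.
Proof.
move=> H K cK _; have [B B0 KB] := compact_sub_oo _ cK.
have [m s] := H (- B) B ltac:(by rewrite gtrN).
have mK := compact_measurable cK.
split; first by apply: measurable_funS m.
apply: le_lt_trans s; apply: ge0_subset_integral => //.
- by apply/measurable_EFinP; exact: measurable_funX.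
- by move=> x _; rewrite lee_fin sqr_ge0.
Qed.

Lemma L2loc_oo u p q : L2loc setT u -> L2 `]p, q[ u.
Proof.
move=> H; have [m s] := H _ (@segment_compact R p q) (@subsetT _ _).
have S : `]p, q[ `<=` `[p, q]%classic by exact: subset_itv_oo_cc.
split; first exact: measurable_funS m.
apply: le_lt_trans s; apply: ge0_subset_integral => //.
- by apply/measurable_EFinP; exact: measurable_funX.
- by move=> x _; rewrite lee_fin sqr_ge0.
Qed.

End Sobolev.

(** * The energy of a triple; profiles and connections *)

Section Energy.
Context {R : realType}.
Implicit Types (p q r x y c l z e : R) (f g h u v w phi : R -> R) (O : set R).
Local Notation mu := (@lebesgue_measure R).
Context (W : R -> R) (cW : continuous W) (W_ge0 : forall s, 0 <= W s) (k : R).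

Lemma comp_cont (V : R -> R) p q f : continuous V -> {within `[p, q], continuous f} ->
  {within `[p, q], continuous (fun x => V (f x))}.
Proof. by move=> cV cf x; apply: continuous_comp; [exact: cf|exact: cV]. Qed.

Lemma H2_itg p q f g h : H2 p q f g h ->
  [/\ itg p q (fun x => W (f x)), itg p q (fun x => g x ^+ 2) & itg p q (fun x => h x ^+ 2)].
Proof.
move=> [Pf Pg ih]; split=> //; apply: itg_cont.
- exact: comp_cont cW (prim_cont _ _ _ _ Pf).
- exact: (comp_cont (fun y => y ^+ 2) _ _ _ (@exprn_continuous _ 2) (prim_cont _ _ _ _ Pg)).
Qed.

Definition energy_density e f g h x : R := W (f x) / e - k * e * g x ^+ 2 + e ^+ 3 * h x ^+ 2.
Definition energy e p q f g h : R := I p q (energy_density e f g h).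

Lemma itg_energy_density e p q f g h : H2 p q f g h -> itg p q (energy_density e f g h).
Proof.
move=> /H2_itg[i1 i2 i3]; apply: itg_D; last exact: itg_Z.
apply: itg_B; last exact: itg_Z.
by apply: (itg_ext _ _ (fun x => e^-1 * W (f x))) => [x _|]; [rewrite mulrC|exact: itg_Z].
Qed.

Lemma energyE e p q f g h : H2 p q f g h -> energy e p q f g h =
  I p q (fun x => W (f x)) / e - k * e * I p q (fun x => g x ^+ 2) +
  e ^+ 3 * I p q (fun x => h x ^+ 2).
Proof.
move=> /H2_itg[i1 i2 i3].
have i1' : itg p q (fun x => W (f x) / e).
  by apply: (itg_ext _ _ (fun x => e^-1 * W (f x))) => [x _|]; [rewrite mulrC|exact: itg_Z].
rewrite /energy /energy_density I_D; [|apply: itg_B => //; exact: itg_Z|exact: itg_Z].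
rewrite I_B //; last exact: itg_Z.
rewrite !I_Z //; congr (_ - _ + _).
by rewrite (I_ext _ _ _ (fun x => e^-1 * W (f x))) => [|x _]; rewrite ?I_Z 1?mulrC.
Qed.

Lemma energy_cat e p q r f g h : p <= q -> q <= r -> H2 p r f g h ->
  energy e p r f g h = energy e p q f g h + energy e q r f g h.
Proof. by move=> pq qr H; apply: I_chasles => //; exact: itg_energy_density. Qed.

Lemma int_oo_ae p q (E1 E2 : R -> R) : measurable_fun `]p, q[ E1 -> itg p q E2 ->
  {ae mu, forall x, x \in `]p, q[ -> E1 x = E2 x} ->
  (\int[mu]_(x in `]p, q[) (E1 x)%:E = (I p q E2)%:E)%E.
Proof.
move=> m1 i2 E.
have i1 : itg p q E1.
  by apply: itg_ae i2 _ _ => //; apply: ae_imp E => x H /H ->.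
rewrite int_oo_cc; last exact/measurable_EFinP.
by rewrite EFin_I // (I_ae _ _ _ _ i1 i2 E).
Qed.

Lemma ae_imp3 (P1 P2 P3 Q : R -> Prop) : (forall x, P1 x -> P2 x -> P3 x -> Q x) ->
  {ae mu, forall x, P1 x} -> {ae mu, forall x, P2 x} -> {ae mu, forall x, P3 x} ->
  {ae mu, forall x, Q x}.
Proof.
move=> PQ H1 H2 H3.
have H12 : {ae mu, forall x, P1 x /\ P2 x} by apply: ae_imp2 H1 H2 => x a b; split.
by apply: ae_imp2 H12 H3 => x [a b] c; exact: PQ.
Qed.

Lemma ae_oo_3 p q (P1 P2 P3 Q : R -> Prop) : (forall x, P1 x -> P2 x -> P3 x -> Q x) ->
  {ae mu, forall x, x \in `]p, q[ -> P1 x} ->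
  {ae mu, forall x, x \in `]p, q[ -> P2 x} ->
  {ae mu, forall x, x \in `]p, q[ -> P3 x} ->
  {ae mu, forall x, x \in `]p, q[ -> Q x}.
Proof.
move=> PQ H1 H2 H3.
by apply: ae_imp3 H1 H2 H3 => x a b c xpq; apply: PQ; [exact: a|exact: b|exact: c].
Qed.

Lemma W22_measurable p q u : W22 `]p, q[ u -> [/\ measurable_fun `]p, q[ u,
  measurable_fun `]p, q[ (weak_derivative `]p, q[ u) &
  measurable_fun `]p, q[ (weak_derivative `]p, q[ (weak_derivative `]p, q[ u))].
Proof.
move=> [[[m1 _] _] [[m2 _] [w [_ Ww]]]]; split=> //.
by have [_ [m3 _ _] _] := weak_derivP _ _ _ Ww.
Qed.

Lemma W_measurable : measurable_fun setT W.
Proof. exact: continuous_measurable_fun. Qed.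

Lemma F_eps_H2 e p q u : p < q -> W22 `]p, q[ u -> exists f g h, [/\ H2 p q f g h,
   {ae mu, forall x, x \in `]p, q[ -> u x = f x} &
   F_eps W `]p, q[ k e u = (energy e p q f g h)%:E].
Proof.
move=> pq Wu; have [f [g [h [H E1 E2 E3]]]] := W22_H2 _ _ _ pq Wu.
exists f, g, h; split=> //; rewrite /F_eps asboolT //.
have [m1 m2 m3] := W22_measurable _ _ _ Wu.
apply: int_oo_ae; [|exact: itg_energy_density|].
- apply: measurable_funD; last by apply: measurable_funM => //; exact: measurable_funX.
  apply: measurable_funB; last by apply: measurable_funM => //; exact: measurable_funX.
  by apply: measurable_funM => //; apply: measurableT_comp => //; exact: W_measurable.
- by apply: ae_oo_3 E1 E2 E3 => x -> -> ->.
Qed.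

Lemma F_eps_of_H2 e p q f g h : p < q -> H2 p q f g h ->
  F_eps W `]p, q[ k e f = (energy e p q f g h)%:E.
Proof.
move=> pq H; have [Wf E2 E3] := H2_W22 _ _ _ _ _ pq H.
rewrite /F_eps asboolT //.
have [m1 m2 m3] := W22_measurable _ _ _ Wf.
apply: int_oo_ae; [|exact: itg_energy_density|].
- apply: measurable_funD; last by apply: measurable_funM => //; exact: measurable_funX.
  apply: measurable_funB; last by apply: measurable_funM => //; exact: measurable_funX.
  by apply: measurable_funM => //; apply: measurableT_comp => //; exact: W_measurable.
- by apply: ae_imp2 E2 E3 => x a b xpq; rewrite a // b.
Qed.

Lemma interpolation_H2 k0 p q f g h : nonlinear_interpolation W k0 -> p < q -> H2 p q f g h ->
  k0 * I p q (fun x => g x ^+ 2) <=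
  ((q - p) ^+ 2)^-1 * I p q (fun x => W (f x)) + (q - p) ^+ 2 * I p q (fun x => h x ^+ 2).
Proof.
move=> hN pq H; have [Wf E2 E3] := H2_W22 _ _ _ _ _ pq H.
have [m1 m2 m3] := W22_measurable _ _ _ Wf; have [i1 i2 i3] := H2_itg _ _ _ _ _ H.
have := hN p q f pq Wf => /=.
rewrite (int_oo_ae p q _ (fun x => g x ^+ 2)) //; first last.
- by apply: ae_imp E2 => x Hx xpq; rewrite Hx.
- exact: measurable_funX.
rewrite (int_oo_ae p q _ (fun x => W (f x))) //; first last.
- exact: aeW.
- by apply: measurableT_comp => //; exact: W_measurable.
rewrite (int_oo_ae p q _ (fun x => h x ^+ 2)) //; first last.
- by apply: ae_imp E3 => x Hx xpq; rewrite Hx.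
- exact: measurable_funX.
Qed.

(** The slopes vanish at both ends so that the constants -1 and 1 extend the triple
    to a profile on the line without further energy. *)
Definition connection p q f g h :=
  p < q /\ [/\ H2 p q f g h, f p = -1, g p = 0, f q = 1 & g q = 0].

Lemma int_line (E : R -> R) p q (D : R -> R) : measurable_fun setT E -> itg p q D ->
  {ae mu, forall x, x \in `]p, q[ -> E x = D x} ->
  {ae mu, forall x, x < p \/ q < x -> E x = 0} ->
  (\int[mu]_x (E x)%:E = (I p q D)%:E)%E.
Proof.
move=> mE iD E1 E2.
have mEo : measurable_fun `]p, q[ E by apply: measurable_funTS.
rewrite -(int_oo_ae p q E D) // [RHS]integral_mkcond.
apply: ae_eq_integral => //.
- exact/measurable_EFinP.
- apply/(measurable_restrictT _ _).1 => //; exact/measurable_EFinP.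
have N : {ae mu, forall x, x != p /\ x != q}.
  have N : mu.-negligible ([set p] `|` [set q]).
    by apply: negligibleU; exact: negligible_set1.
  apply: negligibleS N => x /= /not_andP[] /negP/negPn/eqP ->; [by left|by right].
apply: ae_imp2 E2 N => x H [xp xq] _ /=; rewrite patchE; case: ifPn => // /negP xpq.
rewrite H //; move: xpq; rewrite inE /= in_itv /= => /negP.
rewrite negb_and -!leNgt => /orP[] ?; [left|right]; rewrite lt_neqAle ?xp //.
by rewrite eq_sym xq.
Qed.

Lemma profile_measurable f : profiles f ->
  measurable_fun setT (fun x => W (f x) - k * (weak_derivative setT f x) ^+ 2 +
    (weak_derivative setT (weak_derivative setT f) x) ^+ 2).
Proof.
move=> [[[_ [v [_ Wv]]] [_ [w [_ Ww]]]] _].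
have [[m1 _ _] [m2 _ _] _] := weak_derivP _ _ _ Wv.
have [_ [m3 _ _] _] := weak_derivP _ _ _ Ww.
apply: measurable_funD; last exact: measurable_funX.
apply: measurable_funB; last by apply: measurable_funM => //; exact: measurable_funX.
by apply: measurableT_comp => //; exact: W_measurable.
Qed.

Lemma energy_densityE1 f g h x : energy_density 1 f g h x = W (f x) - k * g x ^+ 2 + h x ^+ 2.
Proof. by rewrite /energy_density divr1 mulr1 expr1n mul1r. Qed.

Context (W1 : W 1 = 0) (WN1 : W (-1) = 0).
Local Tactic Notation "lra_from" hyp_list(l) :=
  revert l; clear -W cW W_ge0 k W1 WN1; lra.

(** Where a profile is constant its derivatives vanish only almost everywhere, as
    they are arbitrary representatives of the weak derivatives. *)
Lemma profile_tail f x y c : profiles f -> x < y ->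
  (forall t, x < t < y -> f t = c) ->
  {ae mu, forall t, t \in `]x, y[ -> weak_derivative setT f t = 0 /\
     weak_derivative setT (weak_derivative setT f) t = 0}.
Proof.
move=> [[[_ [v [_ Wv]]] [_ [w [_ Ww]]]] _] xy fc.
have Wv' := weak_derivP _ _ _ Wv; have Ww' := weak_derivP _ _ _ Ww.
have Wc c' : is_weak_derivative setT (fun=> c') (fun=> 0 : R).
  by apply: prim_weakT => s t _; exact: prim_cst.
have E1 : {ae mu, forall t, t \in `]x, y[ -> weak_derivative setT f t = 0}.
  apply: (weak_uniq setT f (fun=> c) _ _ _ _ xy _ Wv' (Wc _)) => //.
  by apply: aeW => t; rewrite in_itv /=; exact: fc.
have E2 : {ae mu, forall t, t \in `]x, y[ -> weak_derivative setT (weak_derivative setT f) t = 0}.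
  exact: (weak_uniq setT _ (fun=> 0) _ _ _ _ xy _ Ww' (Wc 0)).
by apply: ae_imp2 E1 E2 => t a b tt; split; [exact: a|exact: b].
Qed.

Lemma ae_tails (P : R -> Prop) T :
  (forall x y, x < y -> y < - T -> {ae mu, forall t, t \in `]x, y[ -> P t}) ->
  (forall x y, T < x -> x < y -> {ae mu, forall t, t \in `]x, y[ -> P t}) ->
  {ae mu, forall t, t < - T \/ T < t -> P t}.
Proof.
move=> H1 H2.
have E1 n : {ae mu, forall t, t \in `](- T - n%:R), (- T)[ -> P t}.
  by apply: ae_exhaust => x y _; exact: H1.
have E2 n : {ae mu, forall t, t \in `]T, (T + n%:R)[ -> P t}.
  by apply: ae_exhaust => x y Tx xy _; exact: H2.
have E1' : {ae mu, forall t (n : nat), t \in `](- T - n%:R), (- T)[ -> P t} by exact/ae_foralln.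
have E2' : {ae mu, forall t (n : nat), t \in `]T, (T + n%:R)[ -> P t} by exact/ae_foralln.
apply: ae_imp2 E1' E2' => t a b [tT|Tt].
- apply: (a (Num.truncn (- T - t)).+1); rewrite in_itv /= tT andbT.
  by have := truncnS_gt (- T - t); lra.
- apply: (b (Num.truncn (t - T)).+1); rewrite in_itv /= Tt /=.
  by have := truncnS_gt (t - T); lra.
Qed.

(** The ends [p] and [q] are taken where the profile is already constant, which
    makes the slopes vanish and leaves no energy outside. *)
Lemma profile_connection f : profiles f -> exists p q F G H,
  connection p q F G H /\ profile_energy W k f = (energy 1 p q F G H)%:E.
Proof.
move=> pf; have [[[L1f [v [_ Wv]]] [L2f [w [Lw Ww]]]] [T [T0 fT fNT]]] := pf.
have Wv' := weak_derivP _ _ _ Wv; have Ww' := weak_derivP _ _ _ Ww.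
(* The profile is constant outside [-T, T]: this leaves room in [-C, C] for the
   endpoints of the connection. *)
pose C := T + 1; have CC : - C < C by rewrite gtrN // addr_gt0.
have [i1 _] := L2_itg _ _ _ (L2loc_oo _ (- C) C L1f).
have [i2 _] := L2_itg _ _ _ (L2loc_oo _ (- C) C L2f).
have [i3 i3'] := L2_itg _ _ _ (L2loc_oo _ (- C) C Lw).
have [F [G [H E1 E2]]] := weak_H2 _ _ _ _ _ CC i1 i2 i3 i3'
  (weak_restrict _ _ _ _ _ (@subsetT _ _) Wv') (weak_restrict _ _ _ _ _ (@subsetT _ _) Ww).
have E3 : {ae mu, forall t, t \in `]- C, C[ -> weak_derivative setT (weak_derivative setT f) t = w t}.
  by apply: (weak_uniq _ _ _ _ _ _ _ CC (@subsetT _ _) Ww' Ww); exact: aeW.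
have tl x y : x < y -> y < - T -> {ae mu, forall t, t \in `]x, y[ -> weak_derivative setT f t = 0 /\
     weak_derivative setT (weak_derivative setT f) t = 0}.
  move=> xy yT; apply: (profile_tail _ _ _ (-1) pf xy) => t /andP[_ ty].
  by apply: fNT; exact: lt_trans ty yT.
have tr x y : T < x -> x < y -> {ae mu, forall t, t \in `]x, y[ -> weak_derivative setT f t = 0 /\
     weak_derivative setT (weak_derivative setT f) t = 0}.
  move=> Tx xy; apply: (profile_tail _ _ _ 1 pf xy) => t /andP[xt _].
  by apply: fT; exact: lt_trans Tx xt.
have [p /andP[Cp pT] [Fp Gp]] : exists2 p, - C < p < - T - 1 / 2 & F p = -1 /\ G p = 0.
  apply: ae_exists_oo; first by rewrite /C; lra.
  have tp := tl (- C) (- T - 1 / 2) ltac:(rewrite /C; lra) ltac:(lra).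
  apply: ae_imp3 E1 E2 tp => x a b c; rewrite in_itv /= => /andP[x1 x2].
  have xC : x \in `]- C, C[ by rewrite in_itv /= /C; move: x1; rewrite /C => x1; apply/andP; split; lra_from x1 x2 T0.
  rewrite -a // -b // fNT; last by lra_from x2.
  by split=> //; case: c; rewrite // in_itv /= x1.
have [q /andP[Tq qC] [Fq Gq]] : exists2 q, T + 1 / 2 < q < C & F q = 1 /\ G q = 0.
  apply: ae_exists_oo; first by rewrite /C; lra.
  have tp := tr (T + 1 / 2) C ltac:(lra) ltac:(rewrite /C; lra).
  apply: ae_imp3 E1 E2 tp => x a b c; rewrite in_itv /= => /andP[x1 x2].
  have xC : x \in `]- C, C[ by rewrite in_itv /= /C; move: x2; rewrite /C => x2; apply/andP; split; lra_from x1 x2 T0.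
  rewrite -a // -b // fT; last by lra_from x1.
  by split=> //; case: c; rewrite // in_itv /= x1.
have Hpq : H2 p q F G w by apply: H2_sub H; apply: ltW.
exists p, q, F, G, w; split; first by split; [lra_from pT Tq T0|].
rewrite /profile_energy; apply: int_line.
- exact: profile_measurable.
- exact: itg_energy_density.
- apply: ae_imp3 E1 E2 E3 => x a b c xpq.
  have xC : x \in `]- C, C[.
    move: xpq; rewrite !in_itv /= => /andP[h1 h2].
    by apply/andP; split; lra_from Cp qC h1 h2.
  by rewrite energy_densityE1 -a // -b // -c.
- have := ae_tails _ _ tl tr; apply: ae_imp => x Hx xpq.
  have xT : x < - T \/ T < x by case: xpq => h; [left|right]; lra_from h pT Tq.
  have [-> ->] := Hx xT; rewrite expr0n mulr0 subr0 addr0.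
  by case: xT => [/fNT|/fT] ->.
Qed.

(** Extension by the constants -1 and 1. *)
Lemma connection_profile p q f g h : connection p q f g h ->
  exists2 F, profiles F & profile_energy W k F = (energy 1 p q f g h)%:E.
Proof.
move=> [pq [H fp gp fq gq]].
pose ext a b u := splice p (fun=> a) (splice q u (fun=> b)) : R -> R.
pose F := ext (-1) 1 f; pose G := ext 0 0 g; pose H' := ext 0 0 h.
have HR A B : A < p -> q < B -> H2 A B F G H'.
  move=> Ap qB.
  have Hin : H2 p B (splice q f (fun=> 1)) (splice q g (fun=> 0)) (splice q h (fun=> 0)).
    by apply: H2_splice H (H2_cst _ _ _) => //; exact: ltW.
  apply: H2_splice (H2_cst _ _ _) Hin => //; [exact: ltW|lra| |].
  - by rewrite splice_l // ltW.
  - by rewrite splice_l // ltW.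
have HR' x y : x < y -> H2 x y F G H'.
  move=> xy; have := HR (Num.min x p - 1) (Num.max y q + 1).
  move=> HH; apply: H2_sub (HH _ _).
  - by case: (leP x p) => ?; lra.
  - by case: (leP y q) => ?; lra.
  - by case: (leP x p) => ?; lra.
  - by case: (leP y q) => ?; lra.
have W1' : is_weak_derivative setT F G by apply: prim_weakT => x y /HR'[].
have W2' : is_weak_derivative setT G H' by apply: prim_weakT => x y /HR'[].
have [E1 W3 E2] := weak_derivative_iter _ _ _ _ exhaustibleT W1' W2'.
have pF : profiles F.
  split; first split; first split.
  - by apply: L2loc_line => x y /HR'[/prim_cont/cont_L2].
  - by exists G; split=> //; apply: L2loc_line => x y /HR'[_ /prim_cont/cont_L2].
  - split.
      have [[m _ _] _ _] := W3.
      apply: L2loc_line => x y /HR'[_ /prim_cont/cont_L2 L _].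
      apply: (L2_ae _ _ _ _ L) => //; first by apply: measurable_funTS.
      by apply: ae_imp E1 => t a _; exact: a.
    by exists H'; split=> //; apply: L2loc_line => x y /HR'[_ [i _] i2]; exact: itg_L2.
  - exists (`|p| + `|q| + 1); split; first by rewrite ltr_wpDl.
    + move=> x Hx; have := ler_norm p; have := ler_norm q; have := normr_ge0 p; have := normr_ge0 q.
      move=> *; rewrite /F /ext /splice ifF; last by apply/negbTE; rewrite -leNgt; lra.
      by rewrite ifF //; apply/negbTE; rewrite -leNgt; lra.
    + move=> x Hx; have := ler_norm (- p); rewrite normrN; have := normr_ge0 q; move=> *.
      by rewrite /F /ext /splice ifT //; lra.
exists F => //; rewrite /profile_energy.
have Ein x : p < x < q -> [/\ F x = f x, G x = g x & H' x = h x].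
  move=> /andP[px xq]; rewrite /F /G /H' /ext /splice.
  by rewrite ltNge (ltW px) /= xq.
apply: int_line.
- exact: profile_measurable.
- exact: itg_energy_density.
- apply: ae_imp2 E1 E2 => x a b; rewrite in_itv /= => /Ein[e1 e2 e3].
  by rewrite energy_densityE1 a // b // e1 e2 e3.
- apply: ae_imp2 E1 E2 => x a b xpq; rewrite a // b //.
  have [Fx -> ->] : [/\ F x = -1 \/ F x = 1, G x = 0 & H' x = 0].
    rewrite /F /G /H' /ext /splice; case: xpq => [xp|qx]; first by rewrite xp; split=> //; left.
    have -> : (x < p) = false by apply/negbTE; rewrite -leNgt; lra.
    by have -> : (x < q) = false by [apply/negbTE; rewrite -leNgt; lra]; split=> //; right.
  rewrite expr0n mulr0 subr0 addr0.
  by case: Fx => ->.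
Qed.
End Energy.

(** * Coercivity and rescaling of the energy *)

Section Coercivity.
Context {R : realType}.
Implicit Types (p q r x y c l z e d : R) (f g h u v w phi : R -> R).
Local Notation mu := (@lebesgue_measure R).
Context (W : R -> R) (cW : continuous W) (W_ge0 : forall s, 0 <= W s) (k k0 : R).
Context (k0_gt0 : 0 < k0) (hN : nonlinear_interpolation W k0).
Context (k_gt0 : 0 < k) (kk0 : k < k0).
Local Tactic Notation "lra_from" hyp_list(l) :=
  revert l; clear -W cW W_ge0 k k0 k0_gt0 hN k_gt0 kk0; lra.

Local Notation IW p q f := (I p q (fun x => W (f x))).
Local Notation I2 p q g := (I p q (fun x => g x ^+ 2)).
Local Notation energy := (energy W k).

Lemma I2_ge0 p q g : 0 <= I2 p q g.
Proof. by apply: I_ge0 => x _; rewrite sqr_ge0. Qed.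

Lemma IW_ge0 p q f : 0 <= IW p q f.
Proof. by apply: I_ge0 => x _. Qed.

(** The inequality on [n] consecutive pieces of length [l], summed. *)
Lemma interpolation_n n p l f g h : 0 < l -> H2 p (p + n%:R * l) f g h ->
  k0 * I2 p (p + n%:R * l) g <=
  (l ^+ 2)^-1 * IW p (p + n%:R * l) f + l ^+ 2 * I2 p (p + n%:R * l) h.
Proof.
move=> l0; elim: n => [|n IH] H; first by rewrite mul0r addr0 !I_pt !mulr0 addr0.
have nl : 0 <= n%:R * l by rewrite mulr_ge0 // ltW.
have E : p + n.+1%:R * l = p + n%:R * l + l by rewrite -natr1; ring.
have [a1 a2] : p <= p + n%:R * l /\ p + n%:R * l <= p + n.+1%:R * l by rewrite E; lra.
have [i1 i2 i3] := H2_itg W cW _ _ _ _ _ H.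
have {}IH := IH (H2_sub _ _ _ _ _ _ _ (lexx _) a2 H).
have lt12 : p + n%:R * l < p + n.+1%:R * l by rewrite E ltrDl.
have := interpolation_H2 W cW k0 _ _ f g h hN lt12 (H2_sub _ _ _ _ _ _ _ a1 (lexx _) H).
rewrite (_ : p + n.+1%:R * l - (p + n%:R * l) = l); last by rewrite E; ring.
rewrite (I_chasles p _ _ _ a1 a2 i1) (I_chasles p _ _ _ a1 a2 i2) (I_chasles p _ _ _ a1 a2 i3).
by rewrite !mulrDr; lra_from IH.
Qed.

(** An interval longer than [L0 * e] can be cut into pieces of length [l] with
    [e <= l] and [l^2 <= th * e^2], for a prescribed [th > 1].  With
    [k = kap * k0] and [kap * th < 1] the summed interpolation inequality leaves
    a fixed fraction of each term. *)
Lemma coercivity : exists L0 eta : R, [/\ 0 < L0, 0 < eta &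
  forall e p q f g h, 0 < e -> L0 * e <= q - p -> H2 p q f g h ->
  eta * (IW p q f / e + e * I2 p q g + e ^+ 3 * I2 p q h) <= energy e p q f g h].
Proof.
(* kap = k / k0 is less than 1, and th is chosen with kap * th halfway
   between kap and 1. *)
have [kap [kap0 kap1 kk]] : exists kap, [/\ 0 < kap, kap < 1 & kap * k0 = k].
  exists (k / k0); split; [exact: divr_gt0|by rewrite ltr_pdivrMr // mul1r|].
  by rewrite mulfVK // gt_eqF.
have [th th1 kth] : exists2 th, 1 < th & kap * th = (1 + kap) / 2.
  exists ((1 + kap) / (2 * kap)); last by field; rewrite gt_eqF.
  have k2 : 0 < 2 * kap by rewrite mulr_gt0.
  by rewrite ltr_pdivlMr //; lra.
(* With n > N pieces, l <= (1 + 1/n) * e and (1 + 1/n)^2 <= 1 + 3/n <= th. *)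
pose N := Num.truncn (3 / (th - 1)).
have th_gt0 : 0 < th by lra.
have th10 : 0 < th - 1 by lra.
have HN : 3 <= (th - 1) * N.+1%:R.
  by rewrite mulrC -ler_pdivrMr //; apply: ltW; exact: truncnS_gt.
pose eta := Num.min ((1 - kap) / 4) ((1 - kap) * k0 / (4 * th)).
have eta0 : 0 < eta.
  by rewrite lt_min !divr_gt0 ?mulr_gt0 ?subr_gt0.
exists N.+1%:R, eta; split => // e p q f g h e0 Le H.
pose n := Num.truncn ((q - p) / e).
have qp0 : 0 < q - p by apply: lt_le_trans Le; rewrite mulr_gt0.
have nq : n%:R * e <= q - p.
  by rewrite -ler_pdivlMr // truncn_le // divr_ge0 // ltW.
have qn : q - p < n.+1%:R * e by rewrite -ltr_pdivrMr // truncnS_gt.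
have Nn : (N.+1 <= n)%N.
  by rewrite -ltnS -(ltr_nat R) -(ltr_pM2r e0) (le_lt_trans Le).
have n0 : 0 < n%:R :> R by rewrite ltr0n (leq_trans _ Nn).
pose l := (q - p) / n%:R.
have l0 : 0 < l by rewrite divr_gt0.
have nl : p + n%:R * l = q by rewrite /l mulrC mulfVK ?gt_eqF //; ring.
have el : e <= l by rewrite ler_pdivlMr // mulrC.
have le2 : l ^+ 2 <= th * e ^+ 2.
  have ln : l * n%:R <= (n%:R + 1) * e by rewrite /l mulfVK ?gt_eqF // natr1 ltW.
  have n1 : 1 <= n%:R :> R by rewrite ler1n (leq_trans _ Nn).
  have HN' : 3 <= (th - 1) * n%:R.
    by apply: le_trans HN _; rewrite (ler_wpM2l (ltW th10)) // ler_nat.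
  have S : (l * n%:R) ^+ 2 <= ((n%:R + 1) * e) ^+ 2.
    have G1 : 0 <= l * n%:R by rewrite mulr_ge0 // ltW.
    have G2 : 0 <= (n%:R + 1) * e by rewrite mulr_ge0 ?addr_ge0 // ltW.
    by rewrite ler_sqr ?nnegrE.
  rewrite -(ler_pM2r (exprn_gt0 2 n0)) -exprMn; apply: le_trans S _.
  rewrite (_ : _ * _ * _ = th * n%:R ^+ 2 * e ^+ 2); last by ring.
  rewrite exprMn ler_pM2r ?exprn_gt0 //.
  have : (th - 1) * n%:R * n%:R >= 3 * n%:R by rewrite ler_pM2r.
  by rewrite !expr2; nra.
have := interpolation_n n p l f g h l0; rewrite nl => /(_ H) B.
rewrite energyE //.
set a := IW p q f in B *; set b := I2 p q g in B *; set c := I2 p q h in B *.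
have a0 : 0 <= a := IW_ge0 _ _ _.
have b0 : 0 <= b := I2_ge0 _ _ _.
have c0 : 0 <= c := I2_ge0 _ _ _.
have B2 : k0 * (e * b) <= a / e + th * (e ^+ 3 * c).
  have -> : a / e + th * (e ^+ 3 * c) = e * ((e ^+ 2)^-1 * a + th * e ^+ 2 * c).
    by field; rewrite gt_eqF.
  rewrite mulrCA ler_pM2l //; apply: le_trans B _; apply: lerD; apply: ler_wpM2r => //.
  by rewrite lef_pV2 ?posrE ?exprn_gt0 // ler_sqr ?nnegrE // ltW.
have A0 : 0 <= a / e by rewrite divr_ge0 // ltW.
have C0 : 0 <= e ^+ 3 * c by rewrite mulr_ge0 // exprn_ge0 // ltW.
have BB0 : 0 <= e * b by rewrite mulr_ge0 // ltW.
rewrite -[k * e * b]mulrA.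
move: (a / e) (e ^+ 3 * c) (e * b) A0 C0 BB0 B2 => A C BB A0 C0 BB0 B2.
have E1 : eta <= (1 - kap) / 4 by rewrite ge_min lexx.
have E2 : eta <= (1 - kap) * k0 / (4 * th) by rewrite ge_min lexx orbT.
have kB : k * BB <= (1 + kap) / 2 * (A + C).
  have -> : k * BB = kap * (k0 * BB) by rewrite [RHS]mulrA kk.
  apply: (@le_trans _ _ (kap * (A + th * C))); first by rewrite ler_pM2l.
  rewrite mulrDr mulrA kth mulrDr lerD2r ler_wpM2r //; lra.
have B3 : k0 * BB <= th * (A + C).
  by apply: le_trans B2 _; rewrite mulrDr lerD2r ler_peMl // (ltW th1).
have E3 : eta * BB <= (1 - kap) / 4 * (A + C).
  apply: (@le_trans _ _ ((1 - kap) * k0 / (4 * th) * BB)); first exact: ler_wpM2r.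
  have -> : (1 - kap) * k0 / (4 * th) * BB = (1 - kap) / 4 * (k0 * BB / th).
    by field; rewrite gt_eqF.
  by rewrite ler_pM2l ?divr_gt0 ?subr_gt0 // ler_pdivrMr // [leRHS]mulrC.
have E4 : eta * (A + C) <= (1 - kap) / 4 * (A + C) by rewrite ler_wpM2r // addr_ge0.
lra_from kB E3 E4.
Qed.

Lemma prim_affine p q c l f g : 0 < l -> p <= q -> prim (c + l * p) (c + l * q) f g ->
  prim p q (fun t => f (c + l * t)) (fun t => l * g (c + l * t)).
Proof.
move=> l0 pq P; have [i e] := P; have [j _] := I_affine p q c l g l0 i.
split; first exact: itg_Z.
move=> x /andP[px xq]; have xb : c + l * p <= c + l * x <= c + l * q.
  by rewrite !lerD2l !ler_pM2l // px.
have j' : itg p x (fun t => g (c + l * t)) by apply: itg_sub j.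
have i' : itg (c + l * p) (c + l * x) g by apply: itg_sub i => //; case/andP: xb.
by rewrite e // I_Z //; have [_ ->] := I_affine p x c l g l0 i'.
Qed.

Lemma prim_affineN p q c l f g : l < 0 -> p <= q -> prim (c + l * q) (c + l * p) f g ->
  prim p q (fun t => f (c + l * t)) (fun t => l * g (c + l * t)).
Proof.
move=> l0 pq P; have [i e] := P; have [j _] := I_affineN p q c l g l0 i.
split; first exact: itg_Z.
move=> x /andP[px xq]; have /andP[xb1 xb2] : c + l * q <= c + l * x <= c + l * p.
  by rewrite !lerD2l !ler_nM2l // px xq.
have j' : itg p x (fun t => g (c + l * t)) by apply: itg_sub j.
have i' : itg (c + l * x) (c + l * p) g by apply: itg_sub i.
have := primB _ _ (c + l * x) (c + l * p) _ _ P xb1 xb2 (lexx _).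
rewrite I_Z //; have [_ ->] := I_affineN p x c l g l0 i'; lra.
Qed.

(** The energy scales exactly: [t |-> c + l * t] multiplies the scale by [l]. *)
Lemma H2_affine e p q c l f g h : 0 < l -> p <= q -> H2 (c + l * p) (c + l * q) f g h ->
  H2 p q (fun t => f (c + l * t)) (fun t => l * g (c + l * t)) (fun t => l ^+ 2 * h (c + l * t)) /\
  (0 < e -> energy (l * e) (c + l * p) (c + l * q) f g h =
  energy e p q (fun t => f (c + l * t)) (fun t => l * g (c + l * t)) (fun t => l ^+ 2 * h (c + l * t))).
Proof.
move=> l0 pq H; have [Pf Pg i2] := H.
have H' : H2 p q (fun t => f (c + l * t)) (fun t => l * g (c + l * t)) (fun t => l ^+ 2 * h (c + l * t)).
  split; first exact: prim_affine.
  - have [i e'] := prim_affine p q c l g h l0 pq Pg.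
    split; first by apply: (itg_ext _ _ (fun t => l * (l * h (c + l * t)))) => [x _|]; [ring|exact: itg_Z].
    move=> x /andP[px xq]; rewrite e' ?px // mulrDr; congr +%R.
    rewrite -I_Z; last by apply: itg_sub i.
    by apply: I_ext => t _; ring.
  - have [i _] := I_affine p q c l _ l0 i2.
    by apply: (itg_ext _ _ (fun t => l ^+ 4 * h (c + l * t) ^+ 2)) => [x _|]; [ring|exact: itg_Z].
split=> // e0; rewrite /energy.
have [_ ->] := I_affine p q c l _ l0 (itg_energy_density W cW k (l * e) _ _ _ _ _ H).
rewrite -I_Z; first by apply: I_ext => t _; rewrite /energy_density; field; rewrite !gt_eqF.
by have [] := I_affine p q c l _ l0 (itg_energy_density W cW k (l * e) _ _ _ _ _ H).
Qed.

(** The orientation is reversed, which exchanges the roles of the two wells. *)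
Lemma H2_affineN e p q c l f g h : l < 0 -> p <= q -> H2 (c + l * q) (c + l * p) f g h ->
  H2 p q (fun t => f (c + l * t)) (fun t => l * g (c + l * t)) (fun t => l ^+ 2 * h (c + l * t)) /\
  (0 < e -> energy (- l * e) (c + l * q) (c + l * p) f g h =
  energy e p q (fun t => f (c + l * t)) (fun t => l * g (c + l * t)) (fun t => l ^+ 2 * h (c + l * t))).
Proof.
move=> l0 pq H; have [Pf Pg i2] := H.
have H' : H2 p q (fun t => f (c + l * t)) (fun t => l * g (c + l * t)) (fun t => l ^+ 2 * h (c + l * t)).
  split; first exact: prim_affineN.
  - have [i e'] := prim_affineN p q c l g h l0 pq Pg.
    split; first by apply: (itg_ext _ _ (fun t => l * (l * h (c + l * t)))) => [x _|]; [ring|exact: itg_Z].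
    move=> x /andP[px xq]; rewrite e' ?px // mulrDr; congr +%R.
    rewrite -I_Z; last by apply: itg_sub i.
    by apply: I_ext => t _; ring.
  - have [i _] := I_affineN p q c l _ l0 i2.
    by apply: (itg_ext _ _ (fun t => l ^+ 4 * h (c + l * t) ^+ 2)) => [x _|]; [ring|exact: itg_Z].
split=> // e0; rewrite /energy.
have [_ ->] := I_affineN p q c l _ l0 (itg_energy_density W cW k (- l * e) _ _ _ _ _ H).
rewrite -I_Z; first by apply: I_ext => t _; rewrite /energy_density; field; rewrite gt_eqF // lt_eqF.
by have [] := I_affineN p q c l _ l0 (itg_energy_density W cW k (- l * e) _ _ _ _ _ H).
Qed.

Lemma energy_splice e p q r f1 f2 g1 g2 h1 h2 : p <= q -> q <= r ->
  H2 p q f1 g1 h1 -> H2 q r f2 g2 h2 ->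
  energy e p r (splice q f1 f2) (splice q g1 g2) (splice q h1 h2) =
  energy e p q f1 g1 h1 + energy e q r f2 g2 h2.
Proof.
move=> pq qr H1 H3.
have [_ <-] := itg_splice p q r _ _ pq qr (itg_energy_density W cW k e _ _ _ _ _ H1) (itg_energy_density W cW k e _ _ _ _ _ H3).
by apply: I_ext => x _; rewrite /energy_density /splice; case: ifP.
Qed.

End Coercivity.

(** * Energy between points close to opposite wells *)

Section Transition.
Context {R : realType}.
Implicit Types (p q r x y c l z e d s t : R) (f g h u v w phi : R -> R).
Local Notation mu := (@lebesgue_measure R).
Context (W : R -> R) (cW : continuous W) (W_ge0 : forall s, 0 <= W s) (k k0 : R).
Context (k0_gt0 : 0 < k0) (hN : nonlinear_interpolation W k0).
Context (k_gt0 : 0 < k) (kk0 : k < k0).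
Context (W1 : W 1 = 0) (WN1 : W (-1) = 0).
Local Tactic Notation "lra_from" hyp_list(l) :=
  revert l; clear -W cW W_ge0 k k0 k0_gt0 hN k_gt0 kk0 W1 WN1; lra.
Local Notation IW p q f := (I p q (fun x => W (f x))).
Local Notation I2 p q g := (I p q (fun x => g x ^+ 2)).
Local Notation energy := (energy W k).

Lemma is_derive_cubic (a b c d : R) x :
  is_derive x 1 (fun s : R => a * s ^+ 3 + b * s ^+ 2 + c * s + d) (3 * a * x ^+ 2 + 2 * b * x + c).
Proof.
apply: (is_derive_quad _ _ _ (`|3 * a * x + b| + `|a|)) => t t1.
rewrite (_ : _ - _ - _ = t ^+ 2 * (3 * a * x + b + a * t)); last by ring.
rewrite normrM ger0_norm ?sqr_ge0 // mulrC ler_wpM2r ?sqr_ge0 //.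
apply: le_trans (ler_normD _ _) _; rewrite lerD2l normrM ler_piMr //.
Qed.

Lemma cubic_cont (a b c d : R) : continuous (fun s : R => a * s ^+ 3 + b * s ^+ 2 + c * s + d).
Proof.
move=> x; apply: differentiable_continuous; apply/derivable1_diffP.
by case: (is_derive_cubic a b c d x).
Qed.

Lemma ext_cont (f g : R -> R) : f =1 g -> continuous f -> continuous g.
Proof. by move=> /funext ->. Qed.

Lemma H2_cubic p q (a b c d : R) : p <= q ->
  H2 p q (fun s => a * s ^+ 3 + b * s ^+ 2 + c * s + d)
         (fun s => 3 * a * s ^+ 2 + 2 * b * s + c) (fun s => 6 * a * s + 2 * b).
Proof.
move=> pq; split.
- apply: prim_C1 => //; first by move=> x; exact: is_derive_cubic.
  by apply: (ext_cont _ _ _ (cubic_cont 0 (3 * a) (2 * b) c)) => x; ring.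
- apply: prim_C1 => //.
    move=> x; have := is_derive_cubic 0 (3 * a) (2 * b) c x.
    rewrite (_ : (fun s => 0 * s ^+ 3 + 3 * a * s ^+ 2 + 2 * b * s + c) = (fun s => 3 * a * s ^+ 2 + 2 * b * s + c)); last first.
      by apply/funext => s; ring.
    by rewrite (_ : 3 * 0 * _ + _ + _ = 6 * a * x + 2 * b) //; ring.
  by apply: (ext_cont _ _ _ (cubic_cont 0 0 (6 * a) (2 * b))) => x; ring.
- apply: itg_cont; apply: within_cont.
  by apply: (ext_cont _ _ _ (cubic_cont 0 (36 * a ^+ 2) (24 * a * b) (4 * b ^+ 2))) => x; ring.
Qed.

(** The cubic arc that starts at the well [a] with slope 0 and ends at value
    [a + A] with slope [B]; its coefficients are linear in [A] and [B], so it is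
    close to the constant [a] in C2. *)
Lemma hermite_cap (a : R) d : W a = 0 -> 0 < d -> exists2 rho, 0 < rho &
  forall A B : R, `|A| <= rho -> `|B| <= rho -> exists f g h,
    [/\ H2 0 1 f g h, energy 1 0 1 f g h <= d,
        f 0 = a /\ g 0 = 0 & f 1 = a + A /\ g 1 = B].
Proof.
move=> Wa d0.
have [r r0 Hr] : exists2 r, 0 < r & forall z, `|z - a| <= r -> W z <= d / 2.
  have := cW a; move=> /cvgrPdist_le /(_ (d / 2)); rewrite divr_gt0 // => /(_ isT).
  move=> -[r /= r0 Hr]; exists (r / 2); first by rewrite divr_gt0.
  move=> z zv; have : `|W a - W z| <= d / 2.
    by apply: Hr; rewrite /ball_ /= distrC (le_lt_trans zv) // ltr_pdivrMr // ltr_pMr // ltr1n.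
  by rewrite Wa sub0r normrN ger0_norm.
have [rho [rho0 rho1 rho2 rho3]] : exists rho, [/\ 0 < rho, rho <= r / 2, rho <= d / 200 & rho <= 1].
  exists (Num.min (r / 2) (Num.min (d / 200) 1)); split.
  - by rewrite !lt_min ltr01 !divr_gt0.
  - by rewrite ge_min lexx.
  - by rewrite !ge_min lexx orbT.
  - by rewrite !ge_min lexx !orbT.
exists rho => // A B HA HB.
have H := H2_cubic 0 1 (B - 2 * A) (3 * A - B) 0 a ler01.
exists (fun s => (B - 2 * A) * s ^+ 3 + (3 * A - B) * s ^+ 2 + 0 * s + a).
exists (fun s => 3 * (B - 2 * A) * s ^+ 2 + 2 * (3 * A - B) * s + 0).
exists (fun s => 6 * (B - 2 * A) * s + 2 * (3 * A - B)).
split=> //; last 2 first.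
- by split; ring.
- by split; ring.
have := I_cst 0 1 d ler01; rewrite subr0 mulr1 => <-; apply: I_le.
- exact: itg_energy_density.
- exact: itg_cst.
move=> s /andP[s0 s1]; rewrite energy_densityE1.
set F := (_ + a); set G := (_ + 0); set H' := (_ + _ * (3 * A - B)).
have bnd (x y M : R) : `|y| <= M -> 0 <= M -> `|x| <= rho -> `|x * y| <= M * rho.
  by move=> yM M0 xr; rewrite normrM mulrC ler_pM.
have WF : W F <= d / 2.
  apply: Hr; rewrite /F.
  have -> : (B - 2 * A) * s ^+ 3 + (3 * A - B) * s ^+ 2 + 0 * s + a - a =
    A * (s ^+ 2 * (3 - 2 * s)) - B * (s ^+ 2 * (1 - s)) by ring.
  have P1 : `|s ^+ 2 * (3 - 2 * s)| <= 1.
    have E1 : 0 <= (1 - s) ^+ 2 * (1 + 2 * s) by rewrite mulr_ge0 ?sqr_ge0 //; lra_from s0.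
    have E2 : 0 <= s ^+ 2 * (3 - 2 * s) by rewrite mulr_ge0 ?sqr_ge0 //; lra_from s1.
    rewrite ger0_norm // -subr_ge0; apply: le_trans E1 _.
    by rewrite le_eqVlt; apply/orP; left; apply/eqP; ring.
  have P2 : `|s ^+ 2 * (1 - s)| <= 1.
    have E0 : 0 <= 1 - s by rewrite subr_ge0.
    have E1 : 0 <= s ^+ 2 * (1 - s) by rewrite mulr_ge0 ?sqr_ge0.
    by rewrite ger0_norm // mulr_ile1 ?sqr_ge0 ?expr_le1 //; lra.
  apply: le_trans (ler_normB _ _) _.
  have := bnd _ _ _ P1 ler01 HA; have := bnd _ _ _ P2 ler01 HB; lra_from rho1.
have HH : H' ^+ 2 <= d / 2.
  have -> : H' = A * (6 - 12 * s) + B * (6 * s - 2) by rewrite /H'; ring.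
  have P1 : `|6 - 12 * s| <= 6 by rewrite ler_norml; apply/andP; split; lra_from s0 s1.
  have P2 : `|6 * s - 2| <= 4 by rewrite ler_norml; apply/andP; split; lra_from s0 s1.
  have := bnd _ _ _ P1 (ler0n _ _) HA; have := bnd _ _ _ P2 (ler0n _ _) HB.
  move: (A * _) (B * _) => X Y HY HX.
  have : `|X + Y| <= 10 * rho by apply: le_trans (ler_normD _ _) _; lra_from HX HY.
  move=> HXY; rewrite -real_normK ?num_real //.
  apply: (@le_trans _ _ ((10 * rho) ^+ 2)); first by rewrite ler_sqr ?nnegrE ?mulr_ge0 // ltW.
  have : rho ^+ 2 <= rho by rewrite expr2 ler_piMr // ltW.
  by rewrite exprMn => h; lra_from h rho2.
have : 0 <= k * G ^+ 2 by rewrite mulr_ge0 ?sqr_ge0 // ltW.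
lra_from WF HH.
Qed.

Lemma H2_affine_eq e p q p' q' c l f g h : 0 < l -> p <= q -> c + l * p = p' -> c + l * q = q' ->
  H2 p' q' f g h ->
  H2 p q (fun t => f (c + l * t)) (fun t => l * g (c + l * t)) (fun t => l ^+ 2 * h (c + l * t)) /\
  (0 < e -> energy (l * e) p' q' f g h =
  energy e p q (fun t => f (c + l * t)) (fun t => l * g (c + l * t)) (fun t => l ^+ 2 * h (c + l * t))).
Proof. by move=> l0 pq <- <-; exact: H2_affine. Qed.

Lemma H2_affineN_eq e p q p' q' c l f g h : l < 0 -> p <= q -> c + l * q = p' -> c + l * p = q' ->
  H2 p' q' f g h ->
  H2 p q (fun t => f (c + l * t)) (fun t => l * g (c + l * t)) (fun t => l ^+ 2 * h (c + l * t)) /\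
  (0 < e -> energy (- l * e) p' q' f g h =
  energy e p q (fun t => f (c + l * t)) (fun t => l * g (c + l * t)) (fun t => l ^+ 2 * h (c + l * t))).
Proof. by move=> l0 pq <- <-; exact: H2_affineN. Qed.

(** Lower bounds are passed around in place of the infimum, which is an extended
    real. *)
Definition connection_bound (m : R) := forall p q f g h, connection p q f g h -> m <= energy 1 p q f g h.

(** Caps of length 1 and energy at most [d / 2] at both ends complete the triple to
    a connection. *)
Lemma near_connection m d : connection_bound m -> 0 < d -> exists2 rho, 0 < rho &
  forall p q f g h, p < q -> H2 p q f g h ->
   `|f p + 1| <= rho -> `|g p| <= rho -> `|f q - 1| <= rho -> `|g q| <= rho ->
   m - d <= energy 1 p q f g h.
Proof.
move=> hm d0; have d2 : 0 < d / 2 by rewrite divr_gt0.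
have [r1 r10 C1] := hermite_cap _ _ WN1 d2.
have [r2 r20 C2] := hermite_cap _ _ W1 d2.
exists (Num.min r1 r2); first by rewrite lt_min r10.
move=> p q f g h pq H; rewrite !le_min => /andP[a1 _] /andP[b1 _] /andP[_ a2] /andP[_ b2].
have b2' : `|- g q| <= r2 by rewrite normrN.
have [f1 [g1 [h1 [H1 E1 [fa ga] [fb gb]]]]] := C1 _ _ a1 b1.
have [f2 [g2 [h2 [H3 E2 [fc gc] [fd gd]]]]] := C2 _ _ a2 b2'.
have [A1 e1] : H2 (p - 1) p (fun t => f1 (1 - p + 1 * t)) (fun t => 1 * g1 (1 - p + 1 * t))
    (fun t => 1 ^+ 2 * h1 (1 - p + 1 * t)) /\
  energy 1 (p - 1) p (fun t => f1 (1 - p + 1 * t)) (fun t => 1 * g1 (1 - p + 1 * t))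
    (fun t => 1 ^+ 2 * h1 (1 - p + 1 * t)) <= d / 2.
  have c0 : 1 - p + 1 * (p - 1) = 0 by ring.
  have c1 : 1 - p + 1 * p = 1 by ring.
  have [|HH] := H2_affine_eq 1 (p - 1) p 0 1 (1 - p) 1 f1 g1 h1 ltr01 _ c0 c1 H1.
    by rewrite gerBl.
  by rewrite mul1r => /(_ ltr01) <-.
have [A2 e2] : H2 q (q + 1) (fun t => f2 (1 + q + -1 * t)) (fun t => -1 * g2 (1 + q + -1 * t))
    (fun t => (-1) ^+ 2 * h2 (1 + q + -1 * t)) /\
  energy 1 q (q + 1) (fun t => f2 (1 + q + -1 * t)) (fun t => -1 * g2 (1 + q + -1 * t))
    (fun t => (-1) ^+ 2 * h2 (1 + q + -1 * t)) <= d / 2.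
  have c0 : 1 + q + -1 * (q + 1) = 0 by ring.
  have c1 : 1 + q + -1 * q = 1 by ring.
  have [|HH] := H2_affineN_eq 1 q (q + 1) 0 1 (1 + q) (-1) f2 g2 h2 (ltrN10 _) _ c0 c1 H3.
    by rewrite lerDl.
  by rewrite opprK mul1r => /(_ ltr01) <-.
move: A1 e1; set u1 := fun t => f1 _; set v1 := fun t => _ * g1 _; set w1 := fun t => _ * h1 _ => A1 e1.
move: A2 e2; set u2 := fun t => f2 _; set v2 := fun t => _ * g2 _; set w2 := fun t => _ * h2 _ => A2 e2.
have pq' := ltW pq.
have p1 : p - 1 <= p by rewrite gerBl.
have q1 : q <= q + 1 by rewrite lerDl.
have p2 : p - 1 <= q by apply: le_trans pq'.
have m1 : u1 p = f p /\ v1 p = g p.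
  rewrite /u1 /v1 (_ : 1 - p + 1 * p = 1); last by ring.
  by rewrite fb gb; split; ring.
have m0 : u1 (p - 1) = -1 /\ v1 (p - 1) = 0.
  rewrite /u1 /v1 (_ : 1 - p + 1 * (p - 1) = 0); last by ring.
  by rewrite fa ga; split; ring.
have m2 : u2 q = f q /\ v2 q = g q.
  rewrite /u2 /v2 (_ : 1 + q + -1 * q = 1); last by ring.
  by rewrite fd gd; split; ring.
have m3 : u2 (q + 1) = 1 /\ v2 (q + 1) = 0.
  rewrite /u2 /v2 (_ : 1 + q + -1 * (q + 1) = 0); last by ring.
  by rewrite fc gc; split; ring.
have B1 := H2_splice _ _ _ _ _ _ _ _ _ p1 pq' m1.1 m1.2 A1 H.
have sf : splice p u1 f q = u2 q by rewrite splice_r // m2.1.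
have sg : splice p v1 g q = v2 q by rewrite splice_r // m2.2.
have B2 := H2_splice _ _ _ _ _ _ _ _ _ p2 q1 sf sg B1 A2.
have /hm : connection (p - 1) (q + 1) (splice q (splice p u1 f) u2) (splice q (splice p v1 g) v2)
   (splice q (splice p w1 h) w2).
  split; first by lra_from pq.
  split=> //.
  - by rewrite (splice_l _ _ _ _ sf p2) splice_l ?m0.1 ?m1.1.
  - by rewrite (splice_l _ _ _ _ sg p2) splice_l ?m0.2 ?m1.2.
  - by rewrite splice_r // m3.1.
  - by rewrite splice_r // m3.2.
rewrite (energy_splice W cW k) // (energy_splice W cW k) // => hM.
lra_from e1 e2 hM.
Qed.

(** [near_connection] after rescaling by [e]; for [s = -1] the triple goes from 1
    to -1 and is read backwards. *)
Lemma near_transition m d : connection_bound m -> 0 < d -> exists2 rho, 0 < rho &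
  forall e s p q f g h, 0 < e -> s = 1 \/ s = -1 -> p < q -> H2 p q f g h ->
   `|f p + s| <= rho -> `|e * g p| <= rho -> `|f q - s| <= rho -> `|e * g q| <= rho ->
   m - d <= energy e p q f g h.
Proof.
move=> hm d0; have [rho rho0 Hrho] := near_connection m d hm d0.
exists rho => // e s p q f g h e0 hs pq H fp gp fq gq.
have E1 y : 0 + e * (y / e) = y by field; rewrite gt_eqF.
have E2 y : 0 + - e * (- y / e) = y by field; rewrite gt_eqF.
case: hs => s1; rewrite {}s1 in fp fq.
- have pqe : p / e < q / e by rewrite ltr_pM2r ?invr_gt0.
  have [H'] := H2_affine_eq 1 (p / e) (q / e) p q 0 e f g h e0 (ltW pqe) (E1 _) (E1 _) H.
  move=> /(_ ltr01); rewrite mulr1 => ->.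
  by apply: Hrho => //; rewrite ?E1.
- have pqe : - q / e < - p / e by rewrite ltr_pM2r ?invr_gt0 // ltrN2.
  have ne : - e < 0 by rewrite oppr_lt0.
  have [H'] := H2_affineN_eq 1 (- q / e) (- p / e) p q 0 (- e) f g h ne (ltW pqe) (E2 _) (E2 _) H.
  move=> /(_ ltr01); rewrite opprK mulr1 => ->.
  apply: Hrho => //; rewrite ?E2 ?mulNr ?normrN //.
  + by rewrite -[1]opprK.
Qed.

End Transition.

(** * Each alternation between the wells costs the optimal constant *)

Section LowerBound.
Context {R : realType}.
Implicit Types (a b p q r x y c l z e d s t : R) (f g h u v w phi : R -> R).
Local Notation mu := (@lebesgue_measure R).
Context (W : R -> R) (cW : continuous W) (W_ge0 : forall s, 0 <= W s) (k k0 : R).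
Context (k0_gt0 : 0 < k0) (hN : nonlinear_interpolation W k0).
Context (k_gt0 : 0 < k) (kk0 : k < k0).
Context (W1 : W 1 = 0) (WN1 : W (-1) = 0).
Context (cw : R) (cw_gt0 : 0 < cw) (Wcw : forall s, cw * (`|s| - 1) ^+ 2 <= W s).
Local Tactic Notation "lra_from" hyp_list(l) :=
  revert l; clear -W cW W_ge0 k k0 k0_gt0 hN k_gt0 kk0 W1 WN1 cw cw_gt0 Wcw; lra.
Local Notation IW p q f := (I p q (fun x => W (f x))).
Local Notation I2 p q g := (I p q (fun x => g x ^+ 2)).
Local Notation energy := (energy W k).

Lemma energy_cst e p q c : p <= q -> W c = 0 -> energy e p q (fun=> c) (fun=> 0) (fun=> 0) = 0.
Proof.
move=> pq Wc; rewrite /energy (I_ext _ _ _ (fun=> 0)) => [|x _]; first by rewrite I_cst // mul0r.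
by rewrite /energy_density Wc expr0n !mulr0 mul0r subr0 addr0.
Qed.

(** If the sum is less than 1/4, then starting from a zero of [f] the
    inequality [|g| <= g^2 + 1/4] keeps [|f|] below 1/2 over a unit length, where
    [W(f)] is at least [cw / 4]. *)
Lemma transition_cost p q f g h : p < q -> H2 p q f g h -> f p = -1 -> f q = 1 ->
  Num.min (1 / 4) (cw / 4) <= IW p q f + I2 p q g.
Proof.
move=> pq H fp fq; have [Pf Pg _] := H; have [i1 i2 _] := H2_itg W cW _ _ _ _ _ H.
have [x0 + fx0] : exists2 x0, x0 \in `[p, q] & f x0 = 0.
  apply: IVT; [exact: ltW|exact: prim_cont Pf|].
  by rewrite fp fq ge_min le_max ler01 orbT lerN10.
rewrite in_itv /= => /andP[px0 x0q].
set D := _ + _; have [D4|D4] := leP (1 / 4) D; first by rewrite ge_min D4.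
have IW0 x y : 0 <= IW x y f by exact: IW_ge0.
have I20 x y : 0 <= I2 x y g by exact: I2_ge0.
have gD x : x0 <= x -> x <= q -> x <= x0 + 1 -> `|f x| <= 1 / 2.
  move=> xx xq x1.
  have ig2 : itg x0 x (fun x => g x ^+ 2) by apply: itg_sub i2.
  have ig : itg x0 x g by case: Pf => i _; apply: itg_sub i.
  have -> : f x = f x - f x0 by rewrite fx0 subr0.
  rewrite (primB _ _ _ _ _ _ Pf) //; apply: le_trans (I_abs _ _ _ ig) _.
  apply: (@le_trans _ _ (I x0 x (fun y => g y ^+ 2 + 1 / 4))).
    apply: I_le; [exact: itg_abs|by apply: itg_D => //; exact: itg_cst|].
    move=> y _; have := sqr_ge0 (`|g y| - 1 / 2); rewrite sqrrB real_normK ?num_real //; lra.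
  rewrite I_D //; last exact: itg_cst.
  rewrite I_cst //.
  have : I2 x0 x g <= D.
    have i2' : itg x0 q (fun x => g x ^+ 2) by apply: itg_sub i2.
    rewrite /D (I_chasles _ _ _ _ px0 x0q i2) (I_chasles _ _ _ _ xx xq i2').
    have := IW0 p q; have := I20 p x0; have := I20 x q; lra_from D4.
  lra.
have q1 : x0 + 1 < q.
  rewrite ltNge; apply/negP => qx; have := gD q x0q (lexx _) qx; rewrite fq normr1; lra.
have W4 : cw / 4 <= IW x0 (x0 + 1) f.
  have -> : cw / 4 = I x0 (x0 + 1) (fun=> cw / 4) by rewrite I_cst ?lerDl //; ring.
  apply: I_le; [exact: itg_cst|by apply: itg_sub i1 => //; exact: ltW|].
  move=> y /andP[y0 y1]; apply: le_trans (Wcw _).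
  have := gD y y0 (le_trans y1 (ltW q1)) y1 => fy.
  rewrite ler_pM2l // -sqrrN opprB.
  have : (1 / 2) ^+ 2 <= (1 - `|f y|) ^+ 2 by rewrite ler_sqr ?nnegrE; lra.
  by rewrite expr_div_n expr1n; lra.
rewrite ge_min; apply/orP; right; apply: le_trans W4 _.
have x01 : x0 <= x0 + 1 by rewrite lerDl.
have := IW0 p x0; have := IW0 (x0 + 1) q; have := I20 p q.
have i1' : itg x0 q (fun x => W (f x)) by apply: itg_sub i1.
rewrite /D (I_chasles _ _ _ _ px0 x0q i1) (I_chasles _ _ _ _ x01 (ltW q1) i1').
lra_from D4.
Qed.

(** Coercivity needs a long interval, so the connection is preceded by a constant
    piece, which costs nothing. *)
Lemma connection_bound_pos : exists2 m0, 0 < m0 & connection_bound W k m0.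
Proof.
have [L0 [eta [L00 eta0 C]]] := coercivity W cW W_ge0 k k0 k0_gt0 hN k_gt0 kk0.
exists (eta * Num.min (1 / 4) (cw / 4)).
  by rewrite mulr_gt0 // lt_min !divr_gt0.
move=> p q f g h [pq [H fp gp fq gq]].
have pL : p - L0 <= p by rewrite gerBl ltW.
have Hs := H2_splice _ _ _ _ _ _ _ _ _ pL (ltW pq) (esym fp) (esym gp) (H2_cst (p - L0) p (-1)) H.
have := C 1 _ _ _ _ _ ltr01 _ Hs; rewrite mulr1 => /(_ _)/=.
rewrite (energy_splice W cW k) // ?energy_cst // ?add0r; [|exact: ltW|exact: H2_cst].
move=> B; apply: le_trans (B _); last by lra.
rewrite ler_pM2l //; apply: le_trans (transition_cost _ _ _ _ _ pq H fp fq) _.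
have [i1 i2 _] := H2_itg W cW _ _ _ _ _ Hs.
rewrite divr1 mul1r expr1n mul1r.
rewrite (I_chasles _ _ _ _ pL (ltW pq) i1) (I_chasles _ _ _ _ pL (ltW pq) i2).
have e1 : IW p q (splice p (fun=> -1) f) = IW p q f.
  by apply: I_ext => x /andP[px _]; rewrite splice_r.
have e2 : I2 p q (splice p (fun=> 0) g) = I2 p q g.
  by apply: I_ext => x /andP[px _]; rewrite splice_r.
rewrite e1 e2.
have := IW_ge0 W W_ge0 (p - L0) p (splice p (fun=> -1) f).
have := I2_ge0 (p - L0) p (splice p (fun=> 0) g).
have := I2_ge0 (p - L0) q (splice p (fun=> 0) h).
lra_from L00.
Qed.

(** The cubic that joins -1 to 1 on [0, 1] with slope 0 at both ends. *)
Lemma connection_exists : exists p q f g h, @connection R p q f g h.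
Proof.
have H := H2_cubic 0 1 (-4 : R) 6 0 (-1) ler01.
exists 0, 1; do 3 eexists; split; first exact: ltr01.
split; first exact: H.
- by rewrite /=; ring.
- by rewrite /=; ring.
- by rewrite /=; ring.
- by rewrite /=; ring.
Qed.

(** Profiles and connections have the same energies; the infimum is finite because
    there is a connection, and positive by [connection_bound_pos]. *)
Lemma m_finite_pos : exists m, [/\ m_ W k = m%:E, 0 < m, connection_bound W k m &
  forall d, 0 < d -> exists p q f g h, connection p q f g h /\ energy 1 p q f g h <= m + d].
Proof.
have [m0 m00 B0] := connection_bound_pos.
have lb : (m0%:E <= m_ W k)%E.
  apply: le_ereal_inf_tmp => _ [f pf <-].
  have [p [q [F [G [H [Hc ->]]]]]] := profile_connection W cW k W1 WN1 f pf.
  by rewrite lee_fin; exact: B0.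
have cb p q f g h : connection p q f g h -> (m_ W k <= (energy 1 p q f g h)%:E)%E.
  move=> Hc; have [F pF <-] := connection_profile W cW k W1 WN1 _ _ _ _ _ Hc.
  by apply: ereal_inf_lbound; exists F.
have [p [q [f [g [h Hc]]]]] := connection_exists.
have mf : m_ W k \is a fin_num.
  rewrite fin_numE; apply/andP; split; apply/eqP => E.
    by move: lb; rewrite E leeNy_eq.
  by have := cb _ _ _ _ _ Hc; rewrite E leye_eq.
exists (fine (m_ W k)); rewrite fineK //; split=> //.
- by rewrite -lte_fin fineK //; apply: lt_le_trans lb; rewrite lte_fin.
- by move=> p' q' f' g' h' Hc'; rewrite -lee_fin fineK //; exact: cb.
- move=> d d0; have [_ [F pF <-]] := lb_ereal_inf_adherent d0 mf.
  have [p' [q' [F' [G' [H' [Hc' ->]]]]]] := profile_connection W cW k W1 WN1 F pF.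
  rewrite -[ereal_inf _]/(m_ W k) -(fineK mf) -EFinD lte_fin => /ltW ?.
  by exists p', q', F', G', H'.
Qed.

Definition level_set u s c q : set R := `]c, q[ `&` u @^-1` [set s].

(** [u] takes the values [s], [-s], [s], ... on [n + 1] sets of positive measure, read
    from right to left: the last one lies just before [q].  Measures replace the
    pointwise values of [u], which have no meaning. *)
Fixpoint alternates u s n a q : Prop := match n with
  | 0%N => (0 < mu (level_set u s a q))%E
  | n'.+1 => exists c, [/\ a < c, c < q, alternates u (- s) n' a c & (0 < mu (level_set u s c q))%E]
  end.

Lemma level_set_measurable u s a b c q : measurable_fun `]a, b[ u -> a <= c -> q <= b ->
  measurable (level_set u s c q).
Proof.
move=> mu_ ac qb; have -> : level_set u s c q = `]c, q[ `&` (`]a, b[ `&` u @^-1` [set s]).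
  apply/seteqP; split=> x /=; rewrite /level_set /= !in_itv /=.
    by move=> [/andP[? ?] ?]; split; [apply/andP|split=> //; apply/andP; split; lra].
  by move=> [? [_ ?]].
by apply: measurableI => //; apply: mu_.
Qed.

Lemma level_set_inner u s a b c q : measurable_fun `]a, b[ u -> a <= c -> q <= b ->
  (0 < mu (level_set u s c q))%E ->
  exists c' q', [/\ c < c', c' < q', q' < q & (0 < mu (level_set u s c' q'))%E].
Proof.
move=> mu_ ac qb H; apply/not_existsP => /= N.
pose d n : R := n.+1%:R^-1.
have Z n : mu (level_set u s (c + d n) (q - d n)) = 0%E.
  apply/eqP; rewrite eq_le measure_ge0 andbT leNgt; apply/negP => P.
  apply: (N (c + d n)); exists (q - d n).
  have d0 : 0 < d n by rewrite invr_gt0.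
  split=> //; rewrite ?ltrDl ?ltrBlDr ?ltrDl // ltNge; apply/negP => qc.
  move: P; rewrite /level_set set_itv_ge ?set0I ?measure0 ?ltxx // bnd_simp -leNgt //.
have : mu.-negligible (level_set u s c q).
  have S : level_set u s c q `<=` \bigcup_n level_set u s (c + d n) (q - d n).
    move=> x [] /=; rewrite in_itv /= => /andP[cx xq] ux.
    pose m := Num.min (x - c) (q - x); have m0 : 0 < m by rewrite lt_min !subr_gt0 cx.
    exists (Num.truncn m^-1) => //; split=> //=; rewrite in_itv /=.
    have : d (Num.truncn m^-1) < m.
      by rewrite /d -[ltRHS]invrK ltf_pV2 ?posrE ?invr_gt0 // truncnS_gt.
    by rewrite lt_min => /andP[? ?]; apply/andP; split; lra.
  apply: (@negligibleS _ (measurableTypeR R) R mu _ _ S); apply: negligible_bigcup => n.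
  have d0 : 0 < d n by rewrite invr_gt0.
  exists (level_set u s (c + d n) (q - d n)); split; [|exact: Z|by []].
  by apply: (level_set_measurable _ _ a b) => //; lra.
have m1 := level_set_measurable _ s _ _ _ _ mu_ ac qb.
move=> NL; have [|x _ []] := ae_exists _ (fun=> False) m1 H.
apply: (@negligibleS _ (measurableTypeR R) R mu _ _ _ NL) => x /=.
by apply: contra_notP => nA Ax; exact: nA.
Qed.

(** Continuity of the measure from below leaves room before [q], and in this room
    the energy is nonnegative for small [e]. *)
Lemma alternates_inner u s n a b q : measurable_fun `]a, b[ u -> q <= b -> alternates u s n a q ->
  exists2 q', a < q' < q & alternates u s n a q'.
Proof.
move=> mu_; case: n => [|n] qb /=.
  move=> /(level_set_inner _ _ _ _ _ _ mu_ (lexx _) qb)[c' [q' [ac' c'q' q'q P]]].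
  exists q'; first by rewrite (lt_trans ac' c'q').
  apply: lt_le_trans P _; apply: le_measure; rewrite ?inE.
  - by apply: (level_set_measurable _ _ a b) => //; [exact: ltW|lra].
  - by apply: (level_set_measurable _ _ a b) => //; lra.
  - by move=> x [] /=; rewrite !in_itv /= => /andP[? ?] ?; split=> //=; rewrite in_itv /=; apply/andP; split; lra.
move=> [c [ac cq A]] /(level_set_inner _ _ _ _ _ _ mu_ (ltW ac) qb)[c' [q' [cc' c'q' q'q P]]].
exists q'; first by apply/andP; split; lra.
exists c; split=> //; first by lra.
apply: lt_le_trans P _; apply: le_measure; rewrite ?inE.
- by apply: (level_set_measurable _ _ a b) => //; lra.
- by apply: (level_set_measurable _ _ a b) => //; lra.
- by move=> x [] /=; rewrite !in_itv /= => /andP[? ?] ?; split=> //=; rewrite in_itv /=; apply/andP; split; lra.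
Qed.

(** On the set where [u = s], a point violating one of the two bounds contributes
    at least 1 to [|f - u| / d + (e * g)^2 / d^2], whose integral is too small
    for this to happen on the whole set. *)
Lemma Chebyshev u s a b c q d : itg a b u -> a <= c -> q <= b -> 0 < d ->
  (0 < mu (level_set u s c q))%E -> exists2 rho, 0 < rho & forall e f g h, H2 a b f g h ->
  I a b (fun x => `|f x - u x|) <= rho -> e ^+ 2 * I2 a b g <= rho ->
  exists z, [/\ c < z, z < q, `|f z - s| <= d & `|e * g z| <= d].
Proof.
move=> iu ac qb d0 A0.
have mu_ : measurable_fun `]a, b[ u.
  by apply/measurable_EFinP; case/integrableP: ((itg_oo a b u).2 iu).
have mA := level_set_measurable _ s _ _ _ _ mu_ ac qb.
have Afin : mu (level_set u s c q) \is a fin_num.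
  rewrite ge0_fin_numE //; apply: (@le_lt_trans _ _ (mu `[c, q])).
    by apply: le_measure; rewrite ?inE // => x [] /=; rewrite !in_itv /= => /andP[/ltW -> /ltW ->].
  exact: compact_finite_measure (@segment_compact R c q).
pose kp := fine (mu (level_set u s c q)).
have kp0 : 0 < kp by rewrite -lte_fin fineK.
(* rho is chosen so that the integral of psi is at most half the measure of the
   level set. *)
pose C := d^-1 + (d ^+ 2)^-1.
have C0 : 0 < C by rewrite addr_gt0 ?invr_gt0 ?exprn_gt0.
exists (kp / (2 * C)); first by rewrite divr_gt0 // mulr_gt0.
move=> e f g h H E1 E2; have [Pf Pg _] := H; have [_ i2 _] := H2_itg W cW _ _ _ _ _ H.
apply/not_existsP => N.
pose psi x := d^-1 * `|f x - u x| + (d ^+ 2)^-1 * (e ^+ 2 * g x ^+ 2).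
have if_ : itg a b f by apply: itg_cont; exact: prim_cont Pf.
have iD : itg a b (fun x => `|f x - u x|) by apply: itg_abs; exact: itg_B.
have ipsi : itg a b psi.
  by apply: itg_D; apply: itg_Z => //; exact: itg_Z.
have dC : d^-1 * (kp / (2 * C)) + (d ^+ 2)^-1 * (kp / (2 * C)) = kp / 2.
  by rewrite -mulrDl -/C; field; rewrite gt_eqF.
have Ipsi : I a b psi <= kp / 2.
  have j1 : itg a b (fun x => e ^+ 2 * g x ^+ 2) by exact: itg_Z.
  rewrite /psi I_D; [|exact: itg_Z|exact: itg_Z].
  rewrite I_Z // (I_Z _ _ _ _ j1) I_Z // -dC.
  by apply: lerD; rewrite ler_pM2l ?invr_gt0 ?exprn_gt0.
have psi1 x : 0 <= d^-1 * `|f x - u x| by rewrite mulr_ge0 // invr_ge0 ltW.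
have psi2 x : 0 <= (d ^+ 2)^-1 * (e ^+ 2 * g x ^+ 2).
  apply: mulr_ge0; first by rewrite invr_ge0 sqr_ge0.
  by apply: mulr_ge0; exact: sqr_ge0.
have psi0 x : 0 <= psi x by exact: addr_ge0.
have : (mu (level_set u s c q) <= (I a b psi)%:E)%E.
  have S : level_set u s c q `<=` `[a, b]%classic.
    by move=> x [] /=; rewrite !in_itv /= => /andP[h1 h2] _; apply/andP; split; lra_from ac qb h1 h2.
  rewrite -EFin_I // -(setIidl S) -integral_indic //.
    apply: ge0_le_integral => //.
    - by apply/measurable_EFinP; exact: measurable_indic.
    - by case/integrableP: ipsi.
    - move=> x _; rewrite lee_fin indicE; case: (boolP (x \in _)) => // xA.
      have [] := set_mem xA; rewrite /= in_itv /= => /andP[cx xq] us.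
      suff : 1 <= psi x by [].
      rewrite leNgt; apply/negP => p1; apply: (N x).
      have P1 := psi1 x; have P2 := psi2 x.
      split=> //.
      + have : d^-1 * `|f x - u x| <= 1 by rewrite /psi in p1; lra_from p1 P1 P2.
        by rewrite us mulrC ler_pdivrMr // mul1r.
      + have : (d ^+ 2)^-1 * (e ^+ 2 * g x ^+ 2) <= 1 by rewrite /psi in p1; lra_from p1 P1 P2.
        rewrite mulrC ler_pdivrMr ?exprn_gt0 // mul1r -exprMn => E.
        by rewrite -ler_sqr ?nnegrE ?(ltW d0) // real_normK ?num_real.
rewrite -(fineK Afin) -/kp lee_fin => hI; lra_from hI Ipsi kp0.
Qed.

(** The scale is small compared with the length: on short intervals the energy may
    well be negative. *)
Lemma energy_ge0 : exists2 L0 : R, 0 < L0 & forall e p q f g h, 0 < e -> L0 * e <= q - p ->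
  H2 p q f g h -> 0 <= energy e p q f g h.
Proof.
have [L0 [eta [L00 eta0 C]]] := coercivity W cW W_ge0 k k0 k0_gt0 hN k_gt0 kk0.
exists L0 => // e p q f g h e0 Le H; apply: le_trans (C _ _ _ _ _ _ e0 Le H).
have ? := ltW e0; rewrite mulr_ge0 ?(ltW eta0) // !addr_ge0 ?mulr_ge0 ?invr_ge0 ?exprn_ge0 //.
- exact: IW_ge0.
- exact: I2_ge0.
- exact: I2_ge0.
Qed.

(** Induction on the number of alternations, keeping the last good point [z]: the
    interval between consecutive good points is a transition, and what precedes
    the first one is long and therefore of nonnegative energy. *)
Lemma transitions_cost m d d' u a b : connection_bound W k m -> 0 < d -> 0 < d' -> itg a b u ->
  (forall e s p q f g h, 0 < e -> s = 1 \/ s = -1 -> p < q -> H2 p q f g h ->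
   `|f p + s| <= d' -> `|e * g p| <= d' -> `|f q - s| <= d' -> `|e * g q| <= d' ->
   m - d <= energy e p q f g h) ->
  forall n s q, s = 1 \/ s = -1 -> q <= b -> alternates u s n a q ->
  exists2 rho, 0 < rho & forall e f g h, 0 < e -> e <= rho -> H2 a b f g h ->
  I a b (fun x => `|f x - u x|) <= rho -> e ^+ 2 * I2 a b g <= rho ->
  exists z, [/\ a < z < q, `|f z - s| <= d', `|e * g z| <= d' &
    n%:R * (m - d) <= energy e a z f g h].
Proof.
move=> hm d0 d'0 iu T; have [L0 L00 E0] := energy_ge0.
have mu_ : measurable_fun `]a, b[ u.
  by apply/measurable_EFinP; case/integrableP: ((itg_oo a b u).2 iu).
elim=> [|n IH] s q hs qb /=.
  move=> /(level_set_inner _ _ _ _ _ _ mu_ (lexx _) qb)[c [q' [ac cq q'q P]]].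
  have [||rho rho0 Ch] := Chebyshev _ _ _ _ _ _ d' iu _ _ d'0 P; [exact: ltW|lra|].
  exists (Num.min rho ((c - a) / L0)); first by rewrite lt_min rho0 divr_gt0 // subr_gt0.
  move=> e f g h e0; rewrite !le_min => /andP[er ec] H /andP[F1 _] /andP[F2 _].
  have [z [cz zq fz gz]] := Ch _ _ _ _ H F1 F2.
  exists z; split=> //; first by rewrite (lt_trans ac cz) (lt_trans zq q'q).
  rewrite mul0r; apply: E0 => //.
    by move: ec; rewrite ler_pdivlMr // mulrC => ec; lra_from ec cz.
  by apply: H2_sub H => //; lra_from zq q'q qb.
move=> [c [ac cq A P]].
have hs' : - s = 1 \/ - s = -1 by case: hs => ->; [right|left; rewrite opprK].
have [|r1 r10 {}IH] := IH _ c hs' _ A; first by lra.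
have [r2 r20 Ch] := Chebyshev _ _ _ _ _ _ d' iu (ltW ac) qb d'0 P.
exists (Num.min r1 r2); first by rewrite lt_min r10.
move=> e f g h e0; rewrite !le_min => /andP[er _] H /andP[F1 F1'] /andP[F2 F2'].
have [z [cz zq fz gz]] := Ch _ _ _ _ H F1' F2'.
have [z' [/andP[az' z'c] fz' gz' B]] := IH _ _ _ _ e0 er H F1 F2.
have zz : z' < z := lt_trans z'c cz.
have zb : z <= b := le_trans (ltW zq) qb.
exists z; split=> //; first by rewrite zq (lt_trans ac cz).
have Hz : H2 a z f g h := H2_sub _ _ _ _ _ _ _ (lexx _) zb H.
have Hz' : H2 z' z f g h := H2_sub _ _ _ _ _ _ _ (ltW az') zb H.
rewrite (energy_cat W cW k _ _ _ _ _ _ _ (ltW az') (ltW zz) Hz).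
rewrite opprK in fz'.
have := T _ _ _ _ _ _ _ e0 hs zz Hz' fz' gz' fz gz.
by move=> BT; rewrite -natr1 mulrDl mul1r; exact: lerD B BT.
Qed.

(** After the last good point there remains an interval of fixed length before [b],
    whose energy is nonnegative for small [e]. *)
Lemma lower_bound m d u s n a b : connection_bound W k m -> 0 < d -> itg a b u ->
  s = 1 \/ s = -1 -> alternates u s n a b ->
  exists2 rho, 0 < rho & forall e f g h, 0 < e -> e <= rho -> H2 a b f g h ->
  I a b (fun x => `|f x - u x|) <= rho -> e ^+ 2 * I2 a b g <= rho ->
  n%:R * (m - d) <= energy e a b f g h.
Proof.
move=> hm d0 iu hs A; have [L0 L00 E0] := energy_ge0.
have mu_ : measurable_fun `]a, b[ u.
  by apply/measurable_EFinP; case/integrableP: ((itg_oo a b u).2 iu).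
have [d' d'0 T] := near_transition W cW W_ge0 k k_gt0 W1 WN1 m d hm d0.
have [q /andP[aq qb] A'] := alternates_inner _ _ _ _ _ _ mu_ (lexx _) A.
have [r r0 B] := transitions_cost m d d' u a b hm d0 d'0 iu T n s q hs (ltW qb) A'.
exists (Num.min r ((b - q) / L0)); first by rewrite lt_min r0 divr_gt0 // subr_gt0.
move=> e f g h e0; rewrite !le_min => /andP[er eb] H /andP[F1 _] /andP[F2 _].
have [z [/andP[az zq] _ _ Bz]] := B _ _ _ _ e0 er H F1 F2.
have zb : z <= b := le_trans (ltW zq) (ltW qb).
rewrite (energy_cat W cW k _ _ _ _ _ _ _ (ltW az) zb H).
have : 0 <= energy e z b f g h.
  apply: E0 => //; first by move: eb; rewrite ler_pdivlMr // mulrC => eb; lra_from eb zq.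
  by apply: H2_sub H => //; exact: ltW.
lra_from Bz.
Qed.

Lemma energy_estimates M a b : a < b -> exists2 C : R, 0 < C &
  exists2 e0 : R, 0 < e0 & forall e f g h, 0 < e -> e <= e0 -> H2 a b f g h ->
  energy e a b f g h <= M -> IW a b f <= C * e /\ e ^+ 2 * I2 a b g <= C * e.
Proof.
move=> ab; have [L0 [eta [L00 eta0 C]]] := coercivity W cW W_ge0 k k0 k0_gt0 hN k_gt0 kk0.
exists ((`|M| + 1) / eta); first by rewrite divr_gt0 // ltr_wpDl.
exists ((b - a) / L0); first by rewrite divr_gt0 // subr_gt0.
move=> e f g h e0 ee H EM; have Le : L0 * e <= b - a by rewrite mulrC -ler_pdivlMr.
have B := C _ _ _ _ _ _ e0 Le H.
have B' : IW a b f / e + e * I2 a b g + e ^+ 3 * I2 a b h <= (`|M| + 1) / eta.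
  rewrite ler_pdivlMr // mulrC; apply: (le_trans B); apply: le_trans EM _.
  by apply: le_trans (ler_norm M) _; rewrite lerDl.
have P1 : 0 <= IW a b f / e by rewrite divr_ge0 ?(ltW e0) //; exact: IW_ge0.
have P2 : 0 <= e * I2 a b g by rewrite mulr_ge0 ?(ltW e0) //; exact: I2_ge0.
have P3 : 0 <= e ^+ 3 * I2 a b h by rewrite mulr_ge0 ?exprn_ge0 ?(ltW e0) //; exact: I2_ge0.
split; first by rewrite -ler_pdivrMr //; lra.
by rewrite expr2 -mulrA mulrC ler_pM2r //; lra.
Qed.

End LowerBound.

(** * Functions with finitely many alternations are step functions *)

Section Counting.
Import finmap.

Lemma counting_seq (R : realType) (xs : seq R) : uniq xs -> counting [set` xs] = (size xs)%:R%:E :> \bar R.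
Proof.
move=> U; rewrite /counting asboolT; last exact: finite_seq.
congr (_%:R%:E).
rewrite (_ : [set` xs] = [set` [fset x in xs]%fset]); last first.
  by apply/seteqP; split=> x /=; rewrite !inE.
by rewrite set_fsetK card_fseq undup_id.
Qed.

End Counting.

Section StepFunctions.
Context {R : realType}.
Implicit Types (a b p q r x y c l z e d s t : R) (f g h u v w phi : R -> R) (xs : seq R).
Local Notation mu := (@lebesgue_measure R).

(** The sign changes are listed from right to left, and [s] is the value on the last
    piece, in accordance with [alternates]. *)
Fixpoint step u s xs p q : Prop := match xs with
  | [::] => {ae mu, forall x, x \in `]p, q[ -> u x = s}
  | x :: xs' => [/\ p < x, x < q, step u (- s) xs' p x &
                   {ae mu, forall t, t \in `]x, q[ -> u t = s}]
  end.

Lemma level_set_gt0 u s a b c q : measurable_fun `]a, b[ u -> a <= c -> q <= b -> c < q ->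
  {ae mu, forall x, x \in `]c, q[ -> u x = s} -> (0 < mu (level_set u s c q))%E.
Proof.
move=> mu_ ac qb cq E; rewrite ltNge; apply/negP => N0.
have mA := level_set_measurable _ s _ _ _ _ mu_ ac qb.
have N : mu.-negligible (level_set u s c q).
  by exists (level_set u s c q); split=> //; apply/eqP; rewrite eq_le N0 measure_ge0.
have E2 : {ae mu, forall x, ~ level_set u s c q x}.
  apply: (@negligibleS _ (measurableTypeR R) R mu _ _ _ N) => x /=; exact: contrapT.
have [|x _ []] := ae_exists_oo c q (fun=> False) cq.
apply: ae_imp2 E E2 => x Hx nx xcq; apply: nx; split; first exact: xcq.
exact: Hx.
Qed.

Lemma ae_not_level u s a b c q : measurable_fun `]a, b[ u -> a <= c -> q <= b ->
  ~ (0 < mu (level_set u s c q))%E -> {ae mu, forall x, x \in `]c, q[ -> u x <> s}.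
Proof.
move=> mu_ ac qb /negP; rewrite -leNgt => N0.
have mA := level_set_measurable _ s _ _ _ _ mu_ ac qb.
have N : mu.-negligible (level_set u s c q).
  by exists (level_set u s c q); split=> //; apply/eqP; rewrite eq_le N0 measure_ge0.
apply: (@negligibleS _ (measurableTypeR R) R mu _ _ _ N) => x /= /not_implyP[xcq /contrapT us].
by split.
Qed.

Lemma step_alternates u a b : measurable_fun `]a, b[ u -> forall xs s q, a < q -> q <= b ->
  step u s xs a q -> alternates u s (size xs) a q.
Proof.
move=> mu_; elim=> [|x xs IH] s q aq qb /=; first exact: level_set_gt0 mu_ _ _ _.
move=> [ax xq S E]; exists x; split=> //; first by apply: IH => //; lra.
by apply: (level_set_gt0 _ _ a b) => //; exact: ltW.
Qed.

Lemma ae_join a b c (P : R -> Prop) : {ae mu, forall x, x \in `]a, c[ -> P x} ->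
  {ae mu, forall x, x \in `]c, b[ -> P x} -> {ae mu, forall x, x \in `]a, b[ -> P x}.
Proof.
move=> E1 E2.
have N : {ae mu, forall x, x <> c}.
  by apply: negligibleS (negligible_set1 c) => x /= /contrapT ->.
apply: ae_imp3 E1 E2 N => x H1 H2 xc; rewrite in_itv /= => /andP[ax xb].
have [lt|lt|//] := ltgtP x c; [apply: H1|apply: H2]; rewrite in_itv /=.
- by rewrite ax.
- by rewrite lt.
Qed.

Lemma step_extend u s xs a x q : x < q -> step u s xs a x ->
  {ae mu, forall t, t \in `]x, q[ -> u t = s} -> step u s xs a q.
Proof.
case: xs => [|y ys] xq /=; first by move=> E1 E2; exact: ae_join E1 E2.
move=> [ay yx S E1] E2; split=> //; first by lra.
exact: ae_join E1 E2.
Qed.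

Lemma wellN s : s = 1 \/ s = -1 -> - s = 1 \/ - s = -1.
Proof. by case=> ->; [right|left; rewrite opprK]. Qed.

(** Let [x0] be the infimum of the [x] such that [u] already alternates [n] times
    before [x].  After [x0] a further sign change would give [n + 1] alternations,
    so [u] is constant there; before [x0] there are fewer than [n], and the
    induction hypothesis applies. *)
Lemma no_alternation_step u a b : measurable_fun `]a, b[ u ->
  {ae mu, forall x, x \in `]a, b[ -> u x = -1 \/ u x = 1} ->
  forall n q, a < q -> q <= b -> (forall s, s = 1 \/ s = -1 -> ~ alternates u s n a q) ->
  exists s xs, (s = 1 \/ s = -1) /\ step u s xs a q.
Proof.
move=> mu_ pm; elim=> [|n IH] q aq qb N.
  have N1 := ae_not_level _ _ _ _ _ _ mu_ (lexx _) qb (N 1 (or_introl erefl)).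
  have N2 := ae_not_level _ _ _ _ _ _ mu_ (lexx _) qb (N (-1) (or_intror erefl)).
  have [|x _ []] := ae_exists_oo a q (fun=> False) aq.
  apply: ae_imp3 N1 N2 pm => x n1 n2 p xq.
  have xb : x \in `]a, b[ by move: xq; rewrite !in_itv /= => /andP[-> ?]; lra.
  by case: (p xb) => ux; [exact: n2|exact: n1].
have [[s0 [hs0 A0]]|N'] := pselect (exists s, (s = 1 \/ s = -1) /\ alternates u s n a q); last first.
  by apply: IH => // s hs A; apply: N'; exists s.
(* u alternates n times before each point of X, so a sign change after it would
   make one alternation more than the hypothesis allows. *)
pose X : set R := [set x | a < x /\ x <= q /\ exists s, (s = 1 \/ s = -1) /\ alternates u s n a x].
have [q' /andP[aq' q'q] A'] := alternates_inner _ _ _ _ _ _ mu_ qb A0.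
have Xq' : X q' by split=> //; split; [exact: ltW|exists s0].
have lbX : lbound X a by move=> x [/ltW].
have iX : has_inf X by split; [exists q'|exists a].
have cst x s : X x -> x < q -> (s = 1 \/ s = -1) -> alternates u s n a x ->
    {ae mu, forall t, t \in `]x, q[ -> u t = s}.
  move=> [ax [xq _]] xq' hs A.
  have Nx : ~ (0 < mu (level_set u (- s) x q))%E.
    by move=> P; apply: (N (- s) (wellN _ hs)); exists x; split=> //; rewrite opprK.
  have Nx' := ae_not_level _ _ _ _ _ _ mu_ (ltW ax) qb Nx.
  apply: ae_imp2 Nx' pm => t n1 p tx.
  have tb : t \in `]a, b[.
    by move: tx; rewrite !in_itv /= => /andP[? ?]; apply/andP; split; lra.
  have := n1 tx; case: (p tb) => ->; case: hs => ->; rewrite ?opprK //.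
have cst0 x : X x -> x < q -> {ae mu, forall t, t \in `]x, q[ -> u t = s0}.
  move=> Xx xq; have [ax [_ [s [hs A]]]] := Xx.
  have E := cst _ _ Xx xq hs A; have E0 := cst _ _ Xq' q'q hs0.
  have : alternates u s0 n a q' by []. move=> /E0 {}E0.
  have [t _ [e1 e2]] : exists2 t, Num.max x q' < t < q & u t = s /\ u t = s0.
    apply: ae_exists_oo; first by rewrite gt_max xq.
    apply: ae_imp2 E E0 => t H1 H2; rewrite in_itv /= gt_max => /andP[/andP[xt q't] tq].
    by split; [apply: H1|apply: H2]; rewrite in_itv /= ?xt ?q't.
  by rewrite -e2 e1.
pose x0 := inf X.
have ax0 : a <= x0 by apply: lb_le_inf => //; exists q'.
have x0q : x0 < q by apply: le_lt_trans q'q; apply: ge_inf => //; exists a.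
have E0 : {ae mu, forall t, t \in `]x0, q[ -> u t = s0}.
  apply: ae_exhaust => x y x0x xy yq.
  have [x1 Xx1 x1x] := inf_lt iX.1 x0x.
  have x1q : x1 < q by lra.
  apply: ae_imp (cst0 _ Xx1 x1q) => t Ht txy; apply: Ht.
  move: txy; rewrite !in_itv /= => /andP[h1 h2].
  by apply/andP; split; lra_from x1x yq h1 h2.
have [ax0'|x0a] := ltP a x0; last first.
  have ex0 : x0 = a by apply/eqP; rewrite eq_le x0a ax0.
  by exists s0, [::]; split => //=; rewrite -ex0.
have x0b : x0 <= b by lra.
have [s [xs [hs S]]] : exists s xs, (s = 1 \/ s = -1) /\ step u s xs a x0.
  apply: IH => // s hs A.
  have [q'' /andP[aq'' q''x] A''] := alternates_inner _ _ _ _ _ _ mu_ x0b A.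
  have Xq'' : X q'' by split=> //; split; [lra|exists s].
  have : x0 <= q'' by apply: ge_inf => //; exists a.
  by rewrite leNgt q''x.
have [es|es] : s = s0 \/ s = - s0.
  by case: hs => ->; case: hs0 => ->; rewrite ?opprK; auto.
- exists s0, xs; split=> //; apply: step_extend E0 => //.
  by rewrite -es.
- by exists s0, (x0 :: xs); split=> //=; split=> //; rewrite -es.
Qed.

Lemma step_mem u xs : forall s a q, a < q -> step u s xs a q ->
  (forall y, y \in xs -> a < y < q) /\ uniq xs.
Proof.
elim: xs => [|x xs IH] s a q aq //= [ax xq S _].
have [H U] := IH _ _ _ ax S.
split.
- move=> y; rewrite inE => /orP[/eqP ->|/H /andP[ay yx]]; first by rewrite ax.
  by rewrite ay (lt_trans yx).
- by rewrite U andbT; apply/negP => /H; rewrite ltxx andbF.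
Qed.

Lemma ae_sub_oo p q p' q' (P : R -> Prop) : p <= p' -> q' <= q ->
  {ae mu, forall x, x \in `]p, q[ -> P x} -> {ae mu, forall x, x \in `]p', q'[ -> P x}.
Proof.
move=> pp qq; apply: ae_imp => x H xpq; apply: H; move: xpq.
by rewrite !in_itv /= => /andP[? ?]; apply/andP; split; lra.
Qed.

Lemma step_left_end u xs : forall s a q, a < q -> step u s xs a q ->
  exists2 r, 0 < r & {ae mu, forall t, t \in `]q - r, q[ -> u t = s}.
Proof.
case: xs => [|x xs] s a q aq /= => [E|[ax xq _ E]].
- by exists (q - a); [rewrite subr_gt0|rewrite opprB addrC subrK].
- by exists (q - x); [rewrite subr_gt0|rewrite opprB addrC subrK].
Qed.

(** On both sides of every interior point [u] is constant for a while, and the two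
    constants differ exactly at the points of [xs]. *)
Lemma step_levels u xs : forall s a q, s = 1 \/ s = -1 -> a < q -> step u s xs a q ->
  forall x, a < x < q -> exists r sl sr, [/\ 0 < r, a <= x - r,
    {ae mu, forall t, t \in `]x - r, x[ -> u t = sl},
    {ae mu, forall t, t \in `]x, x + r[ -> u t = sr} & (sl != sr) = (x \in xs)].
Proof.
have sN s : s = 1 \/ s = -1 -> - s != s by case=> ->; apply/eqP; lra.
elim: xs => [|y xs IH] s a q hs aq /= => [E x /andP[ax xq]|[ay yq S E] x /andP[ax xq]].
  exists (Num.min (x - a) (q - x)), s, s; split.
  - by rewrite lt_min !subr_gt0 ax.
  - by rewrite lerBrDr -lerBrDl ge_min lexx.
  - apply: ae_sub_oo E; last by lra.
    by rewrite lerBrDr -lerBrDl ge_min lexx.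
  - apply: ae_sub_oo E; first by lra.
    by rewrite -lerBrDl ge_min lexx orbT.
  - by rewrite eqxx.
have [xy|yx|xy] := ltgtP x y.
- have [r [sl [sr [r0 ar E1 E2 e]]]] := IH _ _ _ (wellN _ hs) ay S x ltac:(by rewrite ax).
  exists r, sl, sr; split=> //; rewrite inE e.
  by rewrite (lt_eqF xy).
- exists (Num.min (x - y) (q - x)), s, s; split.
  - by rewrite lt_min !subr_gt0 yx.
  - have : Num.min (x - y) (q - x) <= x - y by rewrite ge_min lexx.
    lra.
  - apply: ae_sub_oo E; last by lra.
    by rewrite lerBrDr -lerBrDl ge_min lexx.
  - apply: ae_sub_oo E; first by lra.
    by rewrite -lerBrDl ge_min lexx orbT.
  - rewrite eqxx inE (gt_eqF yx) /=; apply/esym/negP => xxs.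
    have [H _] := step_mem _ _ _ _ _ ay S; have /andP[_ xy] := H _ xxs.
    by move: (lt_trans xy yx); rewrite ltxx.
- have [r r0 E1] := step_left_end _ _ _ _ _ ay S.
  exists (Num.min (Num.min r (x - a)) (q - x)), (- s), s; split.
  - by rewrite !lt_min r0 !subr_gt0 ax.
  - have : Num.min (Num.min r (x - a)) (q - x) <= x - a by rewrite !ge_min lexx orbT.
    lra.
  - rewrite xy; apply: ae_sub_oo E1; last by lra.
    by rewrite lerD2l lerN2 -xy !ge_min lexx.
  - rewrite xy; apply: ae_sub_oo E; first by lra.
    by rewrite -lerBrDl -xy !ge_min lexx !orbT.
  - by rewrite sN // inE xy eqxx.
Qed.

Lemma iavg_cst u s z p q : p < q -> measurable_fun `]p, q[ u ->
  {ae mu, forall t, t \in `]p, q[ -> u t = s} ->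
  iavg (fun y => u y - z) `]p, q[ = `|s - z|%:E.
Proof.
move=> pq mu_ E; rewrite /iavg lebesgue_measure_itv /= lte_fin pq -EFinB.
rewrite (_ : (\int[mu]_(y in _) _)%E = (\int[mu]_(y in `]p, q[) `|s - z|%:E)%E); last first.
  apply: ae_eq_integral => //.
  - by apply/measurable_EFinP; apply: measurableT_comp => //; exact: measurable_funB.
  - by apply: ae_imp E => t /= H tpq; rewrite H.
rewrite integral_cst //= lebesgue_measure_itv /= lte_fin pq -EFinB -EFinM.
rewrite inver ifF; last by rewrite subr_eq0 gt_eqF.
by rewrite -EFinM mulrCA mulVf ?mulr1 // subr_eq0 gt_eqF.
Qed.

(** Averages of a step function are eventually constant as the radius shrinks. *)
Lemma cvg_cst_near (F : R -> \bar R) (v : R) r : 0 < r ->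
  (forall e, 0 < e < r -> F e = v%:E) -> F e @[e --> 0^'+] --> 0%E <-> v = 0.
Proof.
move=> r0 H.
have C : F e @[e --> 0^'+] --> v%:E.
  apply: cvg_near_cst; near=> e; apply: H; apply/andP; split; near: e.
  - exact: nbhs_right_gt.
  - exact: nbhs_right_lt.
split=> [C0|v0]; last by rewrite v0 in C.
have E := cvg_unique (@ereal_hausdorff R) C0 C.
have {E}/esym[->] : (0 : \bar R) = v%:E by exact: E.
by [].
Unshelve. all: by end_near. Qed.

(** The one-sided approximate limits are the constants of [step_levels]. *)
Lemma step_jump_set u s xs a b : measurable_fun `]a, b[ u -> s = 1 \/ s = -1 -> a < b ->
  step u s xs a b -> jump_set `]a, b[ u = [set` xs].
Proof.
move=> mu_ hs ab S; have [Hxs _] := step_mem _ _ _ _ _ ab S.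
apply/seteqP; split=> x /=.
- move=> []; rewrite /= in_itv /= => axb [zl [zr [zlr Cl Cr]]].
  have [r [sl [sr [r0 ar E1 E2 <-]]]] := step_levels _ _ _ _ _ hs ab S x axb.
  have /andP[ax xb] := axb.
  pose r' := Num.min r (b - x); have r'0 : 0 < r' by rewrite lt_min r0 subr_gt0.
  have el : zl = sl.
    apply/eqP; rewrite eq_sym -subr_eq0 -normr_eq0; apply/eqP.
    apply: ((cvg_cst_near _ _ r' r'0 _).1 Cl) => e /andP[e0]; rewrite lt_min => /andP[er eb].
    apply: iavg_cst; first by rewrite ltrBlDr ltrDl.
      apply: measurable_funS mu_ => // t /=; rewrite !in_itv /= => /andP[h1 h2].
      by apply/andP; split; lra_from ax xb ar er eb h1 h2.
    by apply: ae_sub_oo E1; lra_from er.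
  have er : zr = sr.
    apply/eqP; rewrite eq_sym -subr_eq0 -normr_eq0; apply/eqP.
    apply: ((cvg_cst_near _ _ r' r'0 _).1 Cr) => e /andP[e0]; rewrite lt_min => /andP[er eb].
    apply: iavg_cst; first by rewrite ltrDl.
      apply: measurable_funS mu_ => // t /=; rewrite !in_itv /= => /andP[h1 h2].
      by apply/andP; split; lra_from ax xb ar er eb h1 h2.
    by apply: ae_sub_oo E2; lra_from er.
  by rewrite -el -er.
- move=> xxs; have axb := Hxs _ xxs; split; first by rewrite /= in_itv.
  have [r [sl [sr [r0 ar E1 E2 e]]]] := step_levels _ _ _ _ _ hs ab S x axb.
  have /andP[ax xb] := axb.
  pose r' := Num.min r (b - x); have r'0 : 0 < r' by rewrite lt_min r0 subr_gt0.
  exists sl, sr; split; first by rewrite e.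
  + apply: (cvg_cst_near _ `|sl - sl| r' r'0 _).2; last by rewrite subrr normr0.
    move=> e' /andP[e0]; rewrite lt_min => /andP[er eb].
    apply: iavg_cst; first by rewrite ltrBlDr ltrDl.
      apply: measurable_funS mu_ => // t /=; rewrite !in_itv /= => /andP[h1 h2].
      by apply/andP; split; lra_from ax xb ar er eb h1 h2.
    by apply: ae_sub_oo E1; lra_from er.
  + apply: (cvg_cst_near _ `|sr - sr| r' r'0 _).2; last by rewrite subrr normr0.
    move=> e' /andP[e0]; rewrite lt_min => /andP[er eb].
    apply: iavg_cst; first by rewrite ltrDl.
      apply: measurable_funS mu_ => // t /=; rewrite !in_itv /= => /andP[h1 h2].
      by apply/andP; split; lra_from ax xb ar er eb h1 h2.
    by apply: ae_sub_oo E2; lra_from er.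
Qed.

End StepFunctions.

(** * Functions of bounded variation with values in the wells *)

Section BVStep.
Context {R : realType}.
Implicit Types (a b p q r x y c l z e d s t : R) (f g h u v w phi psi : R -> R) (xs : seq R).
Local Notation mu := (@lebesgue_measure R).

Lemma piece_pairing a b u phi psi s x q : itg a b u -> a <= x -> x < q -> q <= b ->
  (forall t : R, is_derive t 1 phi (psi t)) -> continuous psi ->
  {ae mu, forall t, t \in `]x, q[ -> u t = s} ->
  I x q (fun t => u t * psi t) = s * (phi q - phi x).
Proof.
move=> iu ax xq qb D c E.
have iux : itg x q u by apply: itg_sub iu.
have cw : {within `[x, q], continuous psi} by exact: within_cont.
have ip : itg x q psi by exact: itg_cont.
rewrite (I_ae x q _ (fun t => s * psi t)).
- by rewrite I_Z // (primB _ _ _ _ _ _ (prim_C1 x q phi psi (ltW xq) D c)) // ltW.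
- exact: itg_Mc.
- exact: itg_Z.
- by apply: ae_imp E => t H tx; rewrite H.
Qed.

(** On each piece the integral of [u * phi'] is a difference of two values of [phi],
    hence at most 2. *)
Lemma step_pairing u a b phi psi : itg a b u ->
  (forall t : R, is_derive t 1 phi (psi t)) -> continuous psi -> (forall x, `|phi x| <= 1) ->
  forall xs s q, s = 1 \/ s = -1 -> a < q -> q <= b -> step u s xs a q ->
  `|I a q (fun t => u t * psi t)| <= 2 * (size xs).+1%:R.
Proof.
move=> iu D c b1.
have B s x q : s = 1 \/ s = -1 -> `|s * (phi q - phi x)| <= 2.
  move=> hs; rewrite normrM (_ : `|s| = 1) ?mul1r; last by case: hs => ->; rewrite ?normrN normr1.
  by apply: le_trans (ler_normB _ _) _; have := b1 q; have := b1 x; lra.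
elim=> [|x xs IH] s q hs aq qb /=.
  by move=> E; rewrite (piece_pairing a b u phi psi s) // mulr1; exact: B.
move=> [ax xq S E].
have i1 : itg a q (fun t => u t * psi t).
  by apply: itg_Mc; [apply: itg_sub iu|exact: within_cont].
rewrite (I_chasles _ _ _ _ (ltW ax) (ltW xq) i1).
rewrite [X in _ + X](piece_pairing a b u phi psi s) //; last exact: ltW.
apply: le_trans (ler_normD _ _) _.
have := IH _ x (wellN _ hs) ax (le_trans (ltW xq) qb) S; have := B s x q hs.
by rewrite -[X in _ -> _ -> _ <= 2 * X]natr1; lra.
Qed.

Lemma step_pm1 u xs : forall s a q, s = 1 \/ s = -1 -> step u s xs a q ->
  {ae mu, forall x, x \in `]a, q[ -> u x = -1 \/ u x = 1}.
Proof.
have B s p q : s = 1 \/ s = -1 -> {ae mu, forall x, x \in `]p, q[ -> u x = s} ->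
    {ae mu, forall x, x \in `]p, q[ -> u x = -1 \/ u x = 1}.
  by move=> hs; apply: ae_imp => x H /H ->; case: hs => ->; auto.
elim: xs => [|x xs IH] s a q hs /=; first exact: B.
move=> [ax xq S E]; apply: ae_join; last exact: (B _ _ _ hs E).
exact: IH (wellN _ hs) S.
Qed.

Lemma step_BV u s xs a b : a < b -> L1 `]a, b[ u -> s = 1 \/ s = -1 -> step u s xs a b ->
  BVpm1 `]a, b[ u.
Proof.
move=> ab L hs S; have iu : itg a b u by apply/itg_oo.
split; last exact: step_pm1 hs S.
split=> //; apply: (@le_lt_trans _ _ (2 * (size xs).+1%:R)%:E); last by rewrite ltry.
apply: ge_ereal_sup => _ [phi [T b1] <-]; rewrite lee_fin.
have [d c _] := T.
have D t : is_derive t 1 phi (derive1 phi t) by apply: DeriveDef => //; rewrite derive1E.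
have i1 : itg a b (fun t => u t * derive1 phi t) by exact: (itg_Mc _ _ _ _ iu (within_cont a b _ c)).
rewrite (I_oo _ _ _ i1); apply: le_trans (ler_norm _) _.
exact: (step_pairing u a b phi (derive1 phi) iu D c b1 xs s b).
Qed.

(** A Lebesgue point of the level set, with a tent around it so narrow that the
    average of [u] is close to [s]. *)
Lemma hat_detects_level u s a b c q : itg a b u -> a <= c -> q <= b -> s = 1 \/ s = -1 ->
  (0 < mu (level_set u s c q))%E -> exists z l, [/\ 0 < l, c < z - l, z + l < q &
    1 / 2 <= s * I a b (fun t => u t * hat l z t)].
Proof.
move=> iu ac qb hs A0.
have mu_ : measurable_fun `]a, b[ u.
  by apply/measurable_EFinP; case/integrableP: ((itg_oo a b u).2 iu).
have mA := level_set_measurable _ s _ _ _ _ mu_ ac qb.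
have [|z [] /=] := ae_exists _ (Lpt a b u) mA A0.
  apply: ae_imp (ae_Lpt _ _ _ iu) => x H [] /=; rewrite !in_itv /= => /andP[cx xq] _.
  by apply: H; rewrite in_itv /=; apply/andP; split; lra.
rewrite in_itv /= => /andP[cz zq] uz Lz.
have [d d0 Hd] := Lpt_avg _ _ _ _ iu Lz (1 / 2) ltac:(lra).
pose m := Num.min d (Num.min (z - c) (q - z)).
have m0 : 0 < m by rewrite !lt_min d0 !subr_gt0 cz.
have md : m <= d by rewrite ge_min lexx.
have mc : m <= z - c by rewrite !ge_min lexx orbT.
have mq : m <= q - z by rewrite !ge_min lexx !orbT.
have [_ _ B] := Hd (m / 2) ltac:(apply/andP; split; lra_from m0 md).
exists z, (m / 2); split; [lra_from m0|lra_from m0 mc|lra_from m0 mq|].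
move: B; rewrite uz ler_norml => /andP[B1 B2].
by case: hs B1 B2 => ->; lra.
Qed.

Lemma is_derive_add_ramp phi psi c l z : (forall t : R, is_derive t 1 phi (psi t)) ->
  forall t : R, is_derive t 1 (fun t => phi t + c * ramp l z t) (psi t + c * hat l z t).
Proof.
move=> D t; have X := is_derive_ramp l z t.
have Y : is_derive t 1 (fun t => c * ramp l z t) (c * hat l z t) := is_deriveZ c X.
exact: (is_deriveD (D t) Y).
Qed.

(** The test function jumps by [2 * s] at a point of each level set, alternately up
    and down, and thus stays between -1 and 1.  Only the first ramp, which starts
    from 0, has height 1.  A ramp of height 2 contributes at least 1, because the
    average of [s * u] around the chosen point is at least 1/2. *)
Lemma alternates_test_function u a b : itg a b u -> forall n s q, s = 1 \/ s = -1 -> q <= b ->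
  alternates u s n a q -> exists phi psi a' q', [/\ a < a' /\ q' < q, 
    (forall t : R, is_derive t 1 phi (psi t)) /\ continuous psi,
    forall x, `|phi x| <= 1,
    (forall x, x <= a' -> phi x = 0) /\ (forall x, q' <= x -> phi x = s) &
    n%:R <= I a b (fun t => u t * psi t)].
Proof.
move=> iu; have ik l z : itg a b (fun t => u t * hat l z t).
  by apply: itg_Mc => //; apply: within_cont; exact: hat_cont.
have nrm s : s = 1 \/ s = -1 -> `|s| = 1 by case=> ->; rewrite ?normrN normr1.
elim=> [|n IH] s q hs qb /=.
  move=> /(hat_detects_level _ _ _ _ _ _ iu (lexx _) qb hs)[z [l [l0 az zq B]]].
  exists (fun t => s * ramp l z t), (fun t => s * hat l z t), (z - l), (z + l); split.
  - by split.
  - split=> t; last by apply: cvgM; [exact: cvg_cst|exact: hat_cont].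
    have := is_deriveZ s (is_derive_ramp l z t); exact.
  - move=> x; have /andP[r0 r1] := step01_itv ((x - z) / l).
    by rewrite normrM nrm // mul1r ger0_norm.
  - by split=> x Hx; [rewrite ramp_l // mulr0|rewrite ramp_r // mulr1].
  - rewrite (I_ext _ _ _ (fun t => s * (u t * hat l z t))); last by move=> t _; ring.
    by rewrite I_Z //; lra.
move=> [c [ac cq A P]].
have [phi [psi [a' [q' [[aa' q'c] [D C] b1 [z0 zs] B]]]]] := IH _ _ (wellN _ hs) (le_trans (ltW cq) qb) A.
have [z [l [l0 cz zq Bz]]] := hat_detects_level _ _ _ _ _ _ iu (ltW ac) qb hs P.
exists (fun t => phi t + 2 * s * ramp l z t), (fun t => psi t + 2 * s * hat l z t).
exists (Num.min a' (z - l)), (z + l); split.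
- by split=> //; rewrite lt_min aa'; lra.
- split=> t; last first.
    by apply: cvgD; [exact: C|apply: cvgM; [exact: cvg_cst|exact: hat_cont]].
  exact: is_derive_add_ramp.
- move=> x; have [xz|zx] := leP x (z - l); first by rewrite ramp_l // mulr0 addr0.
  rewrite zs; last by lra.
  have /andP[r0 r1] := step01_itv ((x - z) / l).
  have -> : - s + 2 * s * ramp l z x = s * (2 * ramp l z x - 1) by ring.
  rewrite normrM nrm // mul1r ler_norml /ramp; apply/andP; split; lra_from r0 r1.
- split=> x Hx.
    by rewrite z0 ?ramp_l ?mulr0 ?addr0 //; move: Hx; rewrite le_min => /andP[].
  rewrite zs ?ramp_r //; last by lra.
  by ring.
- have ip : itg a b (fun t => u t * psi t) by apply: itg_Mc => //; exact: within_cont.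
  rewrite (I_ext _ _ _ (fun t => u t * psi t + 2 * s * (u t * hat l z t))); last by move=> t _; ring.
  rewrite I_D //; last exact: itg_Z.
  by rewrite I_Z // -natr1 -mulrA; lra.
Qed.

(** The function of [alternates_test_function] does not return to 0 at the right
    end; a last ramp closes it, at the price of at most 1. *)
Lemma alternates_total_variation u a b n s : itg a b u -> s = 1 \/ s = -1 ->
  {ae mu, forall x, x \in `]a, b[ -> u x = -1 \/ u x = 1} ->
  alternates u s n a b -> ((n%:R - 1)%:E <= total_variation_in `]a, b[ u)%E.
Proof.
move=> iu hs pm A.
have nrm : `|s| = 1 by case: hs => ->; rewrite ?normrN normr1.
have [phi [psi [a' [q' [[aa' q'b] [D C] b1 [z0 zs] B]]]]] := alternates_test_function u a b iu n s b hs (lexx _) A.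
(* Beyond q1 the function phi is constant; the closing ramp is placed there. *)
pose q1 := Num.max a' q'.
have [aq1 q1b] : a < q1 /\ q1 < b.
  rewrite lt_max aa'; split=> //; rewrite gt_max q'b andbT.
  rewrite ltNge; apply/negP => ba'.
  have := z0 q' (le_trans (ltW q'b) ba'); rewrite zs // => s0.
  by move: nrm; rewrite s0 normr0; lra.
pose z := (q1 + b) / 2; pose l := (b - q1) / 4.
have l0 : 0 < l by rewrite divr_gt0 // subr_gt0.
have q1z : q1 <= z - l by rewrite /z /l; lra.
have zb : z + l < b by rewrite /z /l; lra.
have q'z : q' <= z - l by apply: le_trans q1z; rewrite le_max lexx orbT.
have a'z : a' <= z - l by apply: le_trans q1z; rewrite le_max lexx.
pose phi1 t := phi t + - s * ramp l z t; pose psi1 t := psi t + - s * hat l z t.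
have D1 (t : R) : is_derive t 1 phi1 (psi1 t) by exact: is_derive_add_ramp.
have E1 : derive1 phi1 = psi1 by apply/funext => t; rewrite derive1E; have [_ ->] := D1 t.
have C1 : continuous psi1.
  by move=> t; apply: cvgD; [exact: C|apply: cvgM; [exact: cvg_cst|exact: hat_cont]].
have ik : itg a b (fun t => u t * hat l z t).
  by apply: itg_Mc => //; apply: within_cont; exact: hat_cont.
have ip : itg a b (fun t => u t * psi t) by apply: itg_Mc => //; exact: within_cont.
have ip1 : itg a b (fun t => u t * psi1 t) by apply: itg_Mc => //; exact: within_cont.
have Bk : `|I a b (fun t => u t * hat l z t)| <= 1.
  apply: le_trans (I_abs _ _ _ ik) _.
  have ikk y y' : itg y y' (hat l z) by apply: itg_cont; apply: within_cont; exact: hat_cont.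
  have -> : I a b (fun t => `|u t * hat l z t|) = I a b (hat l z).
    apply: I_ae => //; first exact: itg_abs.
    apply: ae_imp pm => t H tab; have /andP[k0 _] := hat_ge0 l z t l0.
    by rewrite normrM; case: (H tab) => ->; rewrite ?normrN normr1 mul1r ger0_norm.
  have k0 y y' : y' <= z - l -> I y y' (hat l z) = 0.
    move=> yz; rewrite (I_ext _ _ _ (fun=> 0)); first by rewrite /I Rintegral_cst // mul0r.
    by move=> t /andP[_ ty]; rewrite hat_out // (le_trans ty yz).
  have k1 y y' : z + l <= y -> I y y' (hat l z) = 0.
    move=> yz; rewrite (I_ext _ _ _ (fun=> 0)); first by rewrite /I Rintegral_cst // mul0r.
    by move=> t /andP[ty _]; rewrite hat_out // (le_trans yz ty) orbT.
  have h1 : a <= z - l by lra.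
  have h2 : z - l <= b by lra.
  have h3 : z - l <= z + l by lra.
  rewrite (I_chasles _ _ _ _ h1 h2 (ikk _ _)) (I_chasles _ _ _ _ h3 (ltW zb) (ikk _ _)).
  by rewrite k0 // (k1 _ b) // hat_int // add0r addr0.
have T : test_function `]a, b[ phi1.
  split.
  - by move=> t; have [] := D1 t.
  - by rewrite E1.
  - exists `[a', z + l]%classic; split.
    + exact: segment_compact.
    + move=> t /=; rewrite !in_itv /= => /andP[h1 h2].
      by apply/andP; split; lra_from aa' zb h1 h2.
    + move=> t /=; rewrite in_itv /= => /negP; rewrite negb_and -!ltNge => /orP[] H; rewrite /phi1.
      * by rewrite z0 ?ramp_l ?mulr0 ?addr0 //; lra_from H a'z.
      * by rewrite zs ?ramp_r ?mulr1 ?subrr //; lra_from H q'z l0.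
have b1' x : `|phi1 x| <= 1.
  rewrite /phi1; have [xz|zx] := leP x (z - l); first by rewrite ramp_l // mulr0 addr0.
  rewrite zs; last by lra_from zx q'z.
  have /andP[r0 r1] := step01_itv ((x - z) / l).
  have -> : s + - s * ramp l z x = s * (1 - ramp l z x) by ring.
  rewrite normrM nrm mul1r ler_norml /ramp; apply/andP; split; lra_from r0 r1.
apply: (@le_trans _ _ (\int[mu]_(x in `]a, b[) (u x * derive1 phi1 x))%:E); last first.
  by apply: ereal_sup_ubound; exists phi1.
rewrite E1 I_oo // lee_fin.
rewrite (I_ext _ _ _ (fun t => u t * psi t - s * (u t * hat l z t))); last first.
  by move=> t _; rewrite /psi1; ring.
rewrite I_B //; last exact: itg_Z.
rewrite I_Z //; apply: lerB => //; apply: le_trans (ler_norm _) _.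
by rewrite normrM nrm mul1r.
Qed.

(** More alternations than the total variation allows are impossible. *)
Lemma BV_step u a b : a < b -> BVpm1 `]a, b[ u ->
  exists s xs, (s = 1 \/ s = -1) /\ step u s xs a b.
Proof.
move=> ab [[L TV] pm]; have iu : itg a b u by apply/itg_oo.
have mu_ : measurable_fun `]a, b[ u by apply/measurable_EFinP; case/integrableP: L.
have [N HN] : exists N : nat, (total_variation_in `]a, b[ u <= N%:R%:E)%E.
  move: TV; case: (total_variation_in _ _) => [r _| //|_]; last by exists 0%N; rewrite leNye.
  by exists (Num.truncn `|r|).+1; rewrite lee_fin (le_trans (ler_norm r)) // ltW // truncnS_gt.
apply: (no_alternation_step u a b mu_ pm N.+2 b ab (lexx _)) => s hs A.
have := le_trans (alternates_total_variation u a b _ s iu hs pm A) HN.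
by rewrite lee_fin -natr1 addrK ler_nat ltnn.
Qed.

End BVStep.

(** * Gamma-convergence *)

Section Families.
Context {R : realType}.
Implicit Types (a b p q r x y c l z e d s t : R) (f g h u v w phi : R -> R) (xs : seq R).
Local Notation mu := (@lebesgue_measure R).

Lemma near_right0P (P : R -> Prop) :
  (\forall e \near (0 : R)^'+, P e) <-> exists2 d, 0 < d & forall e, 0 < e < d -> P e.
Proof.
split.
  rewrite near_withinE => -[d /= d0 H]; exists d => // e /andP[e0 ed].
  by apply: H => //=; rewrite sub0r normrN gtr0_norm.
move=> [d d0 H]; near=> e; apply: H; apply/andP; split; near: e.
- exact: nbhs_right_gt.
- exact: nbhs_right_lt.
Unshelve. all: by end_near. Qed.

Lemma cvgL1P a b (u_ : R -> R -> R) u : itg a b u ->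
  cvgL1 `]a, b[ u_ u <-> (forall e, 0 < e -> itg a b (u_ e)) /\
    forall rho, 0 < rho -> exists2 d, 0 < d &
      forall e, 0 < e < d -> I a b (fun x => `|u_ e x - u x|) <= rho.
Proof.
move=> iu.
have E v : itg a b v -> (\int[mu]_(x in `]a, b[) `|v x - u x|%:E =
    (I a b (fun x => `|v x - u x|))%:E)%E.
  move=> iv; have id : itg a b (fun x => `|v x - u x|) by apply: itg_abs; exact: itg_B.
  rewrite int_oo_cc ?EFin_I //.
  by case/integrableP: ((itg_oo _ _ _).2 id).
have G v : 0 <= I a b (fun x => `|v x - u x|) by apply: I_ge0.
split=> -[i C].
  have i' e : 0 < e -> itg a b (u_ e) by move=> /i /itg_oo.
  split=> // rho rho0.
  move/fine_cvgP: C => [_ /cvgrPdist_le /(_ _ rho0) /near_right0P[d d0 H]].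
  exists d => // e /[dup] /H /= + /andP[/i' ie _]; rewrite E //= sub0r normrN.
  exact: le_trans (ler_norm _).
split=> [e /i /itg_oo //|].
apply/fine_cvgP; split.
  by apply/near_right0P; exists 1 => // e /andP[/i /E -> _].
apply/cvgrPdist_le => rho rho0; apply/near_right0P.
have [d d0 H] := C _ rho0; exists d => // e /[dup] /H + /andP[/i ie _] /=.
by rewrite E //= sub0r normrN ger0_norm.
Qed.

Lemma real_between (x y : \bar R) : (x < y)%E -> exists r : R, (x < r%:E /\ r%:E < y)%E.
Proof.
case: x => [x||]; case: y => [y||] //.
- by rewrite lte_fin => xy; exists ((x + y) / 2); rewrite !lte_fin; split; lra.
- by move=> _; exists (x + 1); rewrite lte_fin ltry; split=> //; lra.
- by move=> _; exists (y - 1); rewrite lte_fin ltNyr; split=> //; lra.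
- by move=> _; exists 0; rewrite ltry ltNyr.
Qed.

(** The lower limit is below [M] exactly when [F] is below [M] arbitrarily close
    to 0; this is the only form in which lower limits are used. *)
Lemma le_liminf (F : R -> \bar R) (L : \bar R) :
  (forall M : R, (forall d, 0 < d -> exists2 e, 0 < e < d & (F e < M%:E)%E) -> (L <= M%:E)%E) ->
  (L <= limf_einf F 0^'+)%E.
Proof.
move=> H; rewrite leNgt; apply/negP => /real_between[M [FM]]; apply/negP; rewrite -leNgt.
apply: H => d d0; move: FM; rewrite limf_einfE => FM.
have : (ereal_inf (F @` [set e | (0 < e < d)%R]) < M%:E)%E.
  apply: le_lt_trans FM; apply: ereal_sup_ubound; exists [set e | 0 < e < d] => //.
  by apply/near_right0P; exists d.
by move=> /ereal_inf_lt[_ [e ed <-] eM]; exists e.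
Qed.

Lemma limsup_le (F : R -> \bar R) (L : R) :
  (forall d, 0 < d -> exists2 r, 0 < r & forall e, 0 < e < r -> (F e <= (L + d)%:E)%E) ->
  (limf_esup F 0^'+ <= L%:E)%E.
Proof.
move=> H; apply/lee_addgt0Pr => d d0; have [r r0 Hr] := H _ d0.
apply: (@le_trans _ _ (ereal_sup (F @` [set e | 0 < e < r]))).
  apply: ereal_inf_lbound; exists [set e | 0 < e < r] => //.
  by apply/near_right0P; exists r.
by apply: ge_ereal_sup => _ [e /Hr He <-].
Qed.

(** Each [e] selects an object of almost the best quality available to it, so that
    whatever quality is eventually available is eventually attained. *)
Lemma diagonal (G : R -> R -> (R -> R) -> Prop) :
  (forall e d d' v, d <= d' -> G e d v -> G e d' v) ->
  exists v_ : R -> R -> R, forall e d, 0 < e -> 0 < d -> (exists v, G e d v) -> G e (d + e) (v_ e).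
Proof.
move=> mono.
have /choice[v_ Hv] : forall e, exists v, forall d, 0 < e -> 0 < d -> (exists v, G e d v) -> G e (d + e) v.
  move=> e; pose D := [set d | 0 < d /\ exists v, G e d v].
  have [[d1 [d10 [v1 G1]]]|N] := pselect (D !=set0); last first.
    by exists (fun=> 0) => d e0 d0 X; case: N; exists d.
  have [e0|e0] := ltP 0 e; last by exists (fun=> 0).
  have hD : has_inf D.
    split; first by exists d1; split => //; exists v1.
    by exists 0 => d [/ltW].
  have [d [d0 [v Gv]] dD] := inf_adherent e0 hD.
  exists v => d' _ d'0 X; apply: mono Gv.
  apply/ltW; apply: lt_le_trans dD _; rewrite lerD2r.
  by apply: ge_inf; [case: hD|].
by exists v_ => e d; exact: Hv.
Qed.

End Families.

Section Gamma.
Context {R : realType}.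
Implicit Types (p q r x y c l z e d s t : R) (f g h u v w phi : R -> R) (xs : seq R).
Local Notation mu := (@lebesgue_measure R).
Context (W : R -> R) (cW : continuous W) (W_ge0 : forall s, 0 <= W s) (k k0 : R).
Context (k0_gt0 : 0 < k0) (hN : nonlinear_interpolation W k0).
Context (k_gt0 : 0 < k) (kk0 : k < k0).
Context (W1 : W 1 = 0) (WN1 : W (-1) = 0).
Context (cw : R) (cw_gt0 : 0 < cw) (Wcw : forall s, cw * (`|s| - 1) ^+ 2 <= W s).
Context (a b : R) (ab : a < b).
Local Notation IW p q f := (I p q (fun x => W (f x))).
Local Notation I2 p q g := (I p q (fun x => g x ^+ 2)).
Local Notation energy := (energy W k).

(** All that the lower bound retains of a family converging to [u] with energies
    at most [M] along a sequence of scales. *)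
Definition approachable u (M : R) := forall rho, 0 < rho -> exists e f g h,
  [/\ 0 < e, e <= rho, H2 a b f g h, I a b (fun x => `|f x - u x|) <= rho & energy e a b f g h <= M].

Lemma approachable_estimates u M : approachable u M -> forall rho, 0 < rho -> exists e f g h,
  [/\ 0 < e <= rho, H2 a b f g h, I a b (fun x => `|f x - u x|) <= rho, energy e a b f g h <= M &
   IW a b f <= rho /\ e ^+ 2 * I2 a b g <= rho].
Proof.
move=> A rho rho0.
have [C C0 [e0 e00 HE]] := energy_estimates W cW W_ge0 k k0 k0_gt0 hN k_gt0 kk0 M a b ab.
have r0 : 0 < Num.min rho (Num.min e0 (rho / C)) by rewrite !lt_min rho0 e00 divr_gt0.
have [e [f [g [h [e_gt0 er H Hu HM]]]]] := A _ r0.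
move: er Hu; rewrite !le_min => /and3P[er ee0 eC] /andP[Hu _].
have [B1 B2] := HE _ _ _ _ e_gt0 ee0 H HM.
have Ce : C * e <= rho by rewrite mulrC -ler_pdivlMr.
exists e, f, g, h; split=> //; first by rewrite e_gt0.
by split; [apply: le_trans B1 _|apply: le_trans B2 _].
Qed.

(** Quadratic growth of [W] at the wells controls the square of [|f| - 1], and
    [t <= eta + t^2 / eta] turns this into a bound on the L1 norm. *)
Lemma approachable_pm1 u M : itg a b u -> approachable u M ->
  {ae mu, forall x, x \in `]a, b[ -> u x = -1 \/ u x = 1}.
Proof.
move=> iu A; pose w x := `| `|u x| - 1|.
have iw : itg a b w by apply: itg_abs; apply: itg_B; [exact: itg_abs|exact: itg_cst].
pose K := 1 + (b - a) + cw^-1.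
have K0 : 0 < K.
  have : 0 < cw^-1 by rewrite invr_gt0.
  by move: ab; rewrite /K; lra.
have key eta : 0 < eta -> I a b w <= eta * K.
  move=> eta0; have r0 : 0 < Num.min eta (eta ^+ 2) by rewrite lt_min eta0 exprn_gt0.
  have [e [f [g [h [_ H Hu _ [HW _]]]]]] := approachable_estimates u M A _ r0.
  move: Hu HW; rewrite !le_min => /andP[Hu _] /andP[_ HW].
  have [iWf _ _] := H2_itg W cW _ _ _ _ _ H.
  have if_ : itg a b f by case: H => pf _ _; apply: itg_cont; exact: prim_cont pf.
  have id : itg a b (fun x => `|f x - u x|) by apply: itg_abs; exact: itg_B.
  have i2 : itg a b (fun x => eta + (eta * cw)^-1 * W (f x)).
    by apply: itg_D; [exact: itg_cst|exact: itg_Z].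
  apply: (@le_trans _ _ (I a b (fun x => `|f x - u x| + (eta + (eta * cw)^-1 * W (f x))))).
    apply: I_le => //; first exact: itg_D.
    move=> x _.
    have T1 : w x <= `|f x - u x| + `| `|f x| - 1|.
      rewrite /w (_ : `|u x| - 1 = (`|u x| - `|f x|) + (`|f x| - 1)); last by ring.
      apply: le_trans (ler_normD _ _) _; rewrite lerD2r distrC.
      exact: ler_dist_dist.
    apply: le_trans T1 _; rewrite lerD2l.
    have T2 : (eta * cw)^-1 * (cw * (`|f x| - 1) ^+ 2) <= (eta * cw)^-1 * W (f x).
      by apply: ler_wpM2l => //; rewrite invr_ge0 mulr_ge0 // ltW.
    apply: (@le_trans _ _ (eta + (eta * cw)^-1 * (cw * (`|f x| - 1) ^+ 2))); last by rewrite lerD2l.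
    rewrite invfM -mulrA mulKf ?gt_eqF // -[_ ^+ 2]real_normK ?num_real //.
    set n := `| `|f x| - 1|; have n0 : 0 <= n by exact: normr_ge0.
    rewrite -(ler_pM2l eta0) mulrDr mulVKf ?gt_eqF //.
    by nra.
  rewrite I_D // I_D //; [|exact: itg_cst|exact: itg_Z].
  rewrite I_Z // I_cst; last exact: ltW.
  have : (eta * cw)^-1 * IW a b f <= eta * cw^-1.
    apply: (@le_trans _ _ ((eta * cw)^-1 * eta ^+ 2)).
      by apply: ler_wpM2l => //; rewrite invr_ge0 mulr_ge0 // ltW.
    by rewrite invfM expr2 mulrACA mulVf ?gt_eqF // mul1r mulrC.
  by rewrite /K !mulrDr mulr1; lra.
have w0 : I a b w <= 0.
  rewrite leNgt; apply/negP => w0.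
  have := key (I a b w / K / 2) ltac:(by rewrite !divr_gt0).
  by rewrite mulrAC divfK ?gt_eqF //; lra.
have sub0 x y : a <= x -> x <= y -> y <= b -> I x y w = 0.
  move=> ax xy yb; have P p q : 0 <= I p q w by apply: I_ge0 => t _; exact: normr_ge0.
  apply/le_anti; rewrite P andbT; apply: le_trans w0.
  have iw' : itg x b w by apply: itg_sub iw.
  rewrite (I_chasles _ _ _ _ ax (le_trans xy yb) iw) (I_chasles _ _ _ _ xy yb iw').
  by have := P a x; have := P y b; lra.
have Z := int0_ae a b w iw sub0; move: Z; apply: ae_imp => x H xab.
have /normr0_eq0/subr0_eq ux := H xab.
by have [u0|u0] := leP 0 (u x); [right; rewrite -ux ger0_norm|left; rewrite -ux ltr0_norm // opprK].
Qed.

(** The error [d] in [lower_bound] is arbitrary. *)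
Lemma approachable_alternates u M m s n : connection_bound W k m -> itg a b u -> approachable u M ->
  s = 1 \/ s = -1 -> alternates u s n a b -> n%:R * m <= M.
Proof.
move=> mB iu A hs alt_u; apply/ler_addgt0Pr => d d0.
have d10 : 0 < d / n.+1%:R by rewrite divr_gt0.
have [rho rho0 H] := lower_bound W cW W_ge0 k k0 k0_gt0 hN k_gt0 kk0 W1 WN1 m _ u s n a b mB d10 iu hs alt_u.
have [e [f [g [h [/andP[e0 er] Hf Hu HM [_ Hg]]]]]] := approachable_estimates u M A _ rho0.
have := le_trans (H _ _ _ _ e0 er Hf Hu Hg) HM.
rewrite mulrBr lerBlDr => B; apply: le_trans B _; rewrite lerD2l.
by rewrite mulrA mulrAC ler_piMl ?(ltW d0) // ler_pdivrMr // mul1r ler_nat.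
Qed.

Lemma F_lim_step u s xs : measurable_fun `]a, b[ u -> L1 `]a, b[ u -> s = 1 \/ s = -1 ->
  step u s xs a b -> F_lim W `]a, b[ k u = (m_ W k * (size xs)%:R%:E)%E.
Proof.
move=> mu_ L hs S; rewrite /F_lim asboolT; last exact: step_BV S.
rewrite (step_jump_set u s xs a b mu_ hs ab S) counting_seq //.
by have [] := step_mem u xs s a b ab S.
Qed.

Lemma L1_measurable_fun u : L1 `]a, b[ u -> measurable_fun `]a, b[ u.
Proof. by move=> L; apply/measurable_EFinP; case/integrableP: L. Qed.

Lemma approachable_F_lim u M : L1 `]a, b[ u -> approachable u M -> (F_lim W `]a, b[ k u <= M%:E)%E.
Proof.
move=> L A; have iu : itg a b u by apply/itg_oo.
have mu_ := L1_measurable_fun u L.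
have [m [mE m0 mB _]] := m_finite_pos W cW W_ge0 k k0 k0_gt0 hN k_gt0 kk0 W1 WN1 cw cw_gt0 Wcw.
have [|s [xs [hs S]]] := no_alternation_step u a b mu_ (approachable_pm1 u M iu A)
    (Num.truncn (`|M| / m)).+1 b ab (lexx _).
  move=> s hs /(approachable_alternates u M m s _ mB iu A hs).
  apply/negP; rewrite -ltNge; apply: le_lt_trans (ler_norm M) _.
  by rewrite -ltr_pdivrMr //; exact: truncnS_gt.
rewrite (F_lim_step u s xs mu_ L hs S) mE -EFinM lee_fin mulrC.
exact: approachable_alternates mB iu A hs (step_alternates u a b mu_ xs s b ab (lexx _) S).
Qed.

Lemma liminf_inequality u (u_ : R -> R -> R) : L1 `]a, b[ u -> cvgL1 `]a, b[ u_ u ->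
  (F_lim W `]a, b[ k u <= limf_einf (fun e => F_eps W `]a, b[ k e (u_ e)) 0^'+)%E.
Proof.
move=> L; have iu : itg a b u by apply/itg_oo.
move=> /(cvgL1P a b u_ u iu)[iu_ C]; apply: le_liminf => M H.
apply: approachable_F_lim => // rho rho0.
have [d d0 Hd] := C _ rho0.
have d10 : 0 < Num.min rho d by rewrite lt_min rho0.
have [e /andP[e0 er] He] := H _ d10; move: er; rewrite lt_min => /andP[er ed].
have W22e : W22 `]a, b[ (u_ e).
  by apply: contrapT => N; move: He; rewrite /F_eps asboolF.
have [f [g [h [Hf uf E]]]] := F_eps_H2 W cW k e a b (u_ e) ab W22e.
exists e, f, g, h; split=> //; first exact: ltW.
- have if_ : itg a b f by case: Hf => pf _ _; apply: itg_cont; exact: prim_cont pf.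
  have e0d : 0 < e < d by rewrite e0.
  apply: le_trans (Hd _ e0d).
  rewrite (I_ae a b _ (fun x => `|u_ e x - u x|)) //.
  + by apply: itg_abs; exact: itg_B.
  + by apply: itg_abs; apply: itg_B => //; exact: iu_.
  + by apply: ae_imp uf => x Hx xab; rewrite Hx.
- by rewrite -lee_fin -E ltW.
Qed.

(** The connection is compressed by the factor [e], and reversed for [s = -1]. *)
Lemma rescaled_connection p q f g h x e s : connection p q f g h -> 0 < e -> s = 1 \/ s = -1 ->
  exists f' g' h', [/\ H2 x (x + e * (q - p)) f' g' h',
    f' x = - s /\ g' x = 0, f' (x + e * (q - p)) = s /\ g' (x + e * (q - p)) = 0,
    energy e x (x + e * (q - p)) f' g' h' = energy 1 p q f g h &
    forall B, (forall t, p <= t <= q -> `|f t| <= B) ->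
      forall t, x <= t <= x + e * (q - p) -> `|f' t| <= B].
Proof.
move=> [pq [H fp gp fq gq]] e0 hs; have ne : e != 0 by rewrite gt_eqF.
have xy : x <= x + e * (q - p) by rewrite lerDl mulr_ge0 ?subr_ge0 // ltW.
have ei : 0 < e^-1 by rewrite invr_gt0.
have bnd t : x <= t <= x + e * (q - p) -> 0 <= e^-1 * (t - x) <= q - p.
  move=> /andP[xt tq]; rewrite mulr_ge0 ?subr_ge0 ?(ltW ei) //=.
  by rewrite mulrC ler_pdivrMr // lerBlDl [X in _ + X]mulrC.
case: hs => ->.
  have E1 : (p - e^-1 * x) + e^-1 * x = p by ring.
  have E2 : (p - e^-1 * x) + e^-1 * (x + e * (q - p)) = q by rewrite mulrDr mulKf //; ring.
  have [H' HE] := H2_affine_eq W cW k e _ _ _ _ _ _ f g h ei xy E1 E2 H.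
  exists (fun t => f (p - e^-1 * x + e^-1 * t)), (fun t => e^-1 * g (p - e^-1 * x + e^-1 * t)),
    (fun t => e^-1 ^+ 2 * h (p - e^-1 * x + e^-1 * t)).
  split=> //; rewrite ?E1 ?E2 ?fp ?fq ?gp ?gq ?mulr0 //; first by rewrite -HE // mulVf.
  move=> B HB t /bnd /andP[t1 t2]; apply: HB.
  have -> : p - e^-1 * x + e^-1 * t = p + e^-1 * (t - x) by ring.
  by apply/andP; split; lra.
have ei' : - e^-1 < 0 by rewrite oppr_lt0.
have E1 : (q + e^-1 * x) + - e^-1 * x = q by ring.
have E2 : (q + e^-1 * x) + - e^-1 * (x + e * (q - p)) = p.
  by rewrite mulrDr [- e^-1 * (e * _)]mulNr mulKf //; ring.
have [H' HE] := H2_affineN_eq W cW k e _ _ _ _ _ _ f g h ei' xy E2 E1 H.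
exists (fun t => f (q + e^-1 * x + - e^-1 * t)), (fun t => - e^-1 * g (q + e^-1 * x + - e^-1 * t)),
  (fun t => (- e^-1) ^+ 2 * h (q + e^-1 * x + - e^-1 * t)).
split=> //; rewrite ?E1 ?E2 ?fp ?fq ?gp ?gq ?mulr0 ?opprK //; first by rewrite -HE // opprK mulVf.
move=> B HB t /bnd /andP[t1 t2]; apply: HB.
have -> : q + e^-1 * x + - e^-1 * t = q - e^-1 * (t - x) by ring.
by apply/andP; split; lra.
Qed.

Lemma H2_itg_dist p q f g h u : itg p q u -> H2 p q f g h -> itg p q (fun x => `|f x - u x|).
Proof.
move=> iu [pf _ _]; apply: itg_abs; apply: itg_B => //.
by apply: itg_cont; exact: prim_cont pf.
Qed.

(** The transition starts at the jump and lies to its right, where [u = s]; its L1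
    distance to [u] is at most the length of the transition times [B + 1]. *)
Lemma recovery_piece p q F G H B u x y s : connection p q F G H ->
  (forall t, p <= t <= q -> `|F t| <= B) -> itg x y u -> s = 1 \/ s = -1 ->
  {ae mu, forall t, t \in `]x, y[ -> u t = s} -> forall e, 0 < e -> x + e * (q - p) <= y ->
  exists f g h, [/\ H2 x y f g h, f x = - s /\ g x = 0, f y = s /\ g y = 0,
    energy e x y f g h = energy 1 p q F G H &
    I x y (fun t => `|f t - u t|) <= e * ((q - p) * (B + 1))].
Proof.
move=> C HB iu hs us e e0 ey; have [pq [HC _ _ _ _]] := C.
have [f [g [h [Hf [fx gx] [fz gz] E fB]]]] := rescaled_connection p q F G H x e s C e0 hs.
set z := x + e * (q - p) in Hf fz gz E fB ey *.
have xz : x <= z by rewrite lerDl mulr_ge0 ?subr_ge0 // ltW.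
have Ws : W s = 0 by case: hs => ->.
have Hs := H2_splice _ _ _ _ _ _ _ _ _ xz ey fz gz Hf (H2_cst z y s).
exists (splice z f (fun=> s)), (splice z g (fun=> 0)), (splice z h (fun=> 0)); split=> //.
- by rewrite !splice_l.
- by rewrite !splice_r.
- rewrite (energy_splice W cW k) // ?(energy_cst W) ?addr0 //; exact: H2_cst.
have idist := H2_itg_dist _ _ _ _ _ _ iu Hs.
rewrite (I_ae x y _ (fun t => `|splice z f (fun=> s) t - s|)) //; last 2 first.
- by apply: H2_itg_dist Hs; exact: itg_cst.
- by apply: ae_imp us => t Ht txy; rewrite Ht.
have idist' := H2_itg_dist _ _ _ _ _ _ (itg_cst x y s) Hs.
rewrite (I_chasles x z y) // [X in _ + X](I_ext z y _ (fun=> 0)); last first.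
  by move=> t /andP[zt _]; rewrite splice_r // subrr normr0.
rewrite I_cst // mul0r addr0.
apply: (@le_trans _ _ (I x z (fun=> B + 1))).
  apply: I_le; [by apply: itg_sub idist'|exact: itg_cst|].
  move=> t /andP[xt tz]; rewrite splice_l //; apply: le_trans (ler_normB _ _) _.
  have -> : `|s| = 1 by case: hs => ->; rewrite ?normrN normr1.
  by rewrite lerD2r; apply: (fB B HB); rewrite xt.
rewrite I_cst // /z; have -> : x + e * (q - p) - x = e * (q - p) by ring.
by rewrite mulrCA [(B + 1) * _]mulrC.
Qed.

(** From left to right: every jump adds one rescaled connection, followed by the
    constant value, to which the next one is glued. *)
Lemma recovery p q F G H B u : connection p q F G H ->
  (forall t, p <= t <= q -> `|F t| <= B) -> forall xs s y, itg a y u -> s = 1 \/ s = -1 -> a < y ->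
  step u s xs a y -> exists2 e0, 0 < e0 & forall e, 0 < e -> e <= e0 ->
  exists f g h, [/\ H2 a y f g h, f y = s /\ g y = 0,
    energy e a y f g h = (size xs)%:R * energy 1 p q F G H &
    I a y (fun t => `|f t - u t|) <= (size xs)%:R * (e * ((q - p) * (B + 1)))].
Proof.
move=> C HB; have [pq _] := C; elim=> [|x xs IH] s y iu hs ay /=.
  move=> us; exists 1 => // e e0 _; exists (fun=> s), (fun=> 0), (fun=> 0); split=> //.
  - exact: H2_cst.
  - by rewrite mul0r (energy_cst W) ?ltW //; case: hs => ->.
  - rewrite mul0r (I_ae a y _ (fun=> 0)).
    + by rewrite (I_cst _ _ _ (ltW ay)) mul0r.
    + by apply: itg_abs; apply: itg_B => //; exact: itg_cst.
    + exact: itg_cst.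
    + by apply: ae_imp us => t Ht tay; rewrite Ht // subrr normr0.
move=> [ax xy S us].
have iux : itg a x u by apply: itg_sub iu => //; exact: ltW.
have iuy : itg x y u by apply: itg_sub iu => //; exact: ltW.
have [e1 e10 He] := IH _ x iux (wellN _ hs) ax S.
have L0 : 0 < q - p by rewrite subr_gt0.
exists (Num.min e1 ((y - x) / (q - p))); first by rewrite lt_min e10 divr_gt0 // subr_gt0.
move=> e e0; rewrite le_min => /andP[ee1]; rewrite ler_pdivlMr // lerBrDl => ey.
have [f1 [g1 [h1 [H1 [f1x g1x] E1 B1]]]] := He e e0 ee1.
have [f2 [g2 [h2 [Hf2 [f2x g2x] [f2y g2y] E2 B2]]]] :=
  recovery_piece p q F G H B u x y s C HB iuy hs us e e0 ey.
have f12 : f1 x = f2 x by rewrite f1x f2x.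
have g12 : g1 x = g2 x by rewrite g1x g2x.
have ax' := ltW ax; have xy' := ltW xy.
have Hs := H2_splice _ _ _ _ _ _ _ _ _ ax' xy' f12 g12 H1 Hf2.
exists (splice x f1 f2), (splice x g1 g2), (splice x h1 h2); split=> //.
- by rewrite !splice_r.
- by rewrite (energy_splice W cW k) // E1 E2 -natr1 mulrDl mul1r.
rewrite (I_chasles a x y) //; last exact: H2_itg_dist iu Hs.
rewrite (I_ext a x _ (fun t => `|f1 t - u t|)); last first.
  by move=> t /andP[_ tx]; rewrite splice_l.
rewrite [X in _ + X](I_ext x y _ (fun t => `|f2 t - u t|)); last first.
  by move=> t /andP[xt _]; rewrite splice_r.
by rewrite -natr1 mulrDl mul1r lerD.
Qed.

Lemma recovery_energy u s xs m : itg a b u -> s = 1 \/ s = -1 -> step u s xs a b ->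
  (forall d, 0 < d -> exists p q f g h, connection p q f g h /\ energy 1 p q f g h <= m + d) ->
  forall d, 0 < d -> exists2 r, 0 < r & forall e, 0 < e < r -> exists v,
  [/\ itg a b v, I a b (fun t => `|v t - u t|) <= d &
      (F_eps W `]a, b[ k e v <= (m * (size xs)%:R + d)%:E)%E].
Proof.
move=> iu hs S Hm d d0; set n : R := (size xs)%:R.
have n0 : 0 <= n by exact: ler0n.
have d'0 : 0 < d / (n + 1) by rewrite divr_gt0 // ltr_wpDl.
have [p [q [F [G [H [C E]]]]]] := Hm _ d'0.
have [pq [[pF _ _] _ _ _ _]] := C.
have [B B0 HB] := cont_bounded p q F (prim_cont _ _ _ _ pF).
have [e0 e00 He] := recovery p q F G H B u C HB xs s b iu hs ab S.
pose K := (q - p) * (B + 1).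
have K0 : 0 < K by rewrite mulr_gt0 ?subr_gt0 // addr_gt0.
exists (Num.min e0 (d / (n + 1) / K)); first by rewrite lt_min e00 divr_gt0.
move=> e /andP[e_gt0]; rewrite lt_min => /andP[/ltW ee0].
rewrite ltr_pdivlMr // => eK.
have [f [g [h [Hf _ Ef Bf]]]] := He e e_gt0 ee0.
have nd : n * (d / (n + 1)) <= d.
  by rewrite mulrCA ler_piMr ?(ltW d0) // ler_pdivrMr ?mul1r ?lerDl // ltr_wpDl.
exists f; split.
- by case: Hf => pf _ _; apply: itg_cont; exact: prim_cont pf.
- by apply: le_trans Bf (le_trans _ nd); rewrite ler_wpM2l // ltW.
- rewrite (F_eps_of_H2 W cW k e a b f g h ab Hf) lee_fin Ef -/n.
  apply: (@le_trans _ _ (n * (m + d / (n + 1)))); first by rewrite ler_wpM2l.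
  by rewrite mulrDr [n * m]mulrC lerD2l.
Qed.

Lemma limsup_inequality u : L1 `]a, b[ u -> exists u_ : R -> R -> R, cvgL1 `]a, b[ u_ u /\
  (limf_esup (fun e => F_eps W `]a, b[ k e (u_ e)) 0^'+ <= F_lim W `]a, b[ k u)%E.
Proof.
move=> L; have iu : itg a b u by apply/itg_oo.
have [BV|nBV] := pselect (BVpm1 `]a, b[ u); last first.
  exists (fun=> u); split; last by rewrite /F_lim asboolF // leey.
  apply/(cvgL1P a b _ u iu); split=> // rho rho0; exists 1 => // e _.
  by rewrite (I_ext _ _ _ (fun=> 0)) ?(I_cst _ _ _ (ltW ab)) ?mul0r ?(ltW rho0) // => t _; rewrite subrr normr0.
have mu_ := L1_measurable_fun u L.
have [s [xs [hs S]]] := BV_step u a b ab BV.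
have [m [mE _ _ Hm]] := m_finite_pos W cW W_ge0 k k0 k0_gt0 hN k_gt0 kk0 W1 WN1 cw cw_gt0 Wcw.
have X := recovery_energy u s xs m iu hs S Hm.
pose P e d v := [/\ itg a b v, I a b (fun t => `|v t - u t|) <= d &
      (F_eps W `]a, b[ k e v <= (m * (size xs)%:R + d)%:E)%E].
have [|v_ Hv] := diagonal P.
  move=> e d d' v dd' [iv dv Fv]; split=> //; first exact: le_trans dv dd'.
  by apply: le_trans Fv _; rewrite lee_fin lerD2l.
have Y d : 0 < d -> exists2 r, 0 < r & forall e, 0 < e < r -> P e d (v_ e).
  move=> d0; have d20 : 0 < d / 2 by rewrite divr_gt0.
  have [r r0 Hr] := X _ d20; exists (Num.min r (d / 2)); first by rewrite lt_min r0.
  move=> e /andP[e0]; rewrite lt_min => /andP[er ed].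
  have [iv dv Fv] := Hv e (d / 2) e0 d20 (Hr e ltac:(by rewrite e0)).
  split=> //; first by lra.
  by apply: le_trans Fv _; rewrite lee_fin lerD2l; lra.
have [r1 r10 H1] := Y 1 ltr01.
(* The choice v_ e is meaningful for e < r1 only. *)
exists (fun e => if e < r1 then v_ e else u); split.
  apply/(cvgL1P a b _ u iu); split.
    move=> e e0; case: ifP => // er; have [|//] := H1 e; first by rewrite e0.
  move=> d d0; have [r r0 Hr] := Y d d0.
  exists (Num.min r r1); first by rewrite lt_min r0.
  move=> e /andP[e0]; rewrite lt_min => /andP[er ->].
  by have [|//] := Hr e; rewrite e0.
rewrite (F_lim_step u s xs mu_ L hs S) mE -EFinM; apply: limsup_le => d d0.
have [r r0 Hr] := Y d d0.
exists (Num.min r r1); first by rewrite lt_min r0.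
move=> e /andP[e0]; rewrite lt_min => /andP[er ->].
by have [|//] := Hr e; rewrite e0.
Qed.

Lemma F_lim_ge0 u : (0 <= F_lim W `]a, b[ k u)%E.
Proof.
have [m [mE m0 _ _]] := m_finite_pos W cW W_ge0 k k0 k0_gt0 hN k_gt0 kk0 W1 WN1 cw cw_gt0 Wcw.
rewrite /F_lim; case: ifP => // _; rewrite mE mule_ge0 ?lee_fin ?(ltW m0) //.
Qed.

End Gamma.

Lemma double_wellP (R : realType) (W : R -> R) : double_well W ->
  [/\ continuous W, forall s, 0 <= W s, W 1 = 0, W (-1) = 0 &
   exists2 c, 0 < c & forall s, c * (`|s| - 1) ^+ 2 <= W s].
Proof.
move=> [cW W0 Z [c [c0 Wp Wn]]].
have Z' x : ([set -1; 1] x -> W x = 0)%classic by rewrite -Z.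
split=> //; [by apply: Z'; right|by apply: Z'; left|].
exists c => // s; have [s0|s0] := leP 0 s; first by rewrite ger0_norm // Wp.
rewrite ltr0_norm // (_ : (- s - 1) ^+ 2 = (s + 1) ^+ 2); last by ring.
by apply: Wn; exact: ltW.
Qed.

Theorem theorem4p1 (R : realType) (W : R -> R) (hW : double_well W)
    (a b : R) (hab : a < b)
    (k0 : R) (hk0 : 0 < k0) (hN : nonlinear_interpolation W k0)
    (k : R) (hk : 0 < k) (hkk0 : k < k0) :
  (forall u : R -> R, L1 `]a, b[ u -> (0 <= F_lim W `]a, b[ k u)%E) /\
  Gamma_L1_cvg `]a, b[ (F_eps W `]a, b[ k) (F_lim W `]a, b[ k).
Proof.
have [cW W0 W1 WN1 [cw cw0 Wcw]] := double_wellP R W hW.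
split=> [u _|]; first exact: (F_lim_ge0 W cW W0 k k0 hk0 hN hk hkk0 W1 WN1 cw cw0 Wcw).
split=> [u u_|u] L.
- exact: (liminf_inequality W cW W0 k k0 hk0 hN hk hkk0 W1 WN1 cw cw0 Wcw a b hab u u_ L).
- exact: (limsup_inequality W cW W0 k k0 hk0 hN hk hkk0 W1 WN1 cw cw0 Wcw a b hab u L).
Qed.
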